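(* Let $\mathsf{A}_h:V_h\to V_h'$ be the operator defined by $\langle\mathsf{A}_hu,v\rangle=a_w(u,v)$ for all $u,v\in V_h$, and let $\mathsf{B}_h=\sum_{j=1}^J\mathsf{I}_j\mathsf{A}_j^{-1}\mathsf{I}_j^\top:V_h'\to V_h$ be the one-level additive Schwarz preconditioner associated with the overlapping subdomains $\Omega_1,\dots,\Omega_J$ with overlap parameter $\delta$. Then $$\kappa(\mathsf{B}_h\mathsf{A}_h):=\frac{\lambda_{\max}(\mathsf{B}_h\mathsf{A}_h)}{\lambda_{\min}(\mathsf{B}_h\mathsf{A}_h)}\le C\,\delta^{-4},$$ where $\lambda_{\max}(\mathsf{B}_h\mathsf{A}_h)$ and $\lambda_{\min}(\mathsf{B}_h\mathsf{A}_h)$ are the largest and smallest eigenvalues of $\mathsf{B}_h\mathsf{A}_h$, and $C>0$ is a constant independent of the discretization parameters (such as the mesh size $h$ and the overlap size $\delta$) and of the problem data.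
   Context: **Domain and mesh.** $\Omega\subset\mathbb{R}^d$, $d\in\{2,3\}$, is a bounded convex polygonal/polyhedral domain and $\mathcal{T}_h$ ranges over a shape-regular family of triangulations of $\Omega$ into triangles or tetrahedra, $h=\max_T h_T$ with $h_T=\mathrm{diam}(T)$. $\mathcal{E}_h^o$ is the set of interior edges/faces, $h_e=|e|^{1/(d-1)}$, $\mathbf{n}_T$ is the outward unit normal on $\partial T$. For $e\in\mathcal{E}_h^o$ shared by $T^+,T^-$, $\mathbf{n}_e$ is the unit normal pointing from $T^-$ to $T^+$, $[v]=v^+-v^-$, $\{v\}=(v^++v^-)/2$; on boundary edges/faces $[v]=\{v\}=v$. **Discrete form.** $V_h\subset H^1_0(\Omega)$ is the space of continuous piecewise quadratic ($P_2$) functions on $\mathcal{T}_h$ vanishing on $\partial\Omega$. For $v\in V_h$, $\Delta_wv$ is the piecewise constant function with $\Delta_wv|_T=\frac1{|T|}\int_{\partial T}\{\nabla v\}\cdot\mathbf{n}_T\,ds$. Define $$a_w(v,w)=\sum_{T\in\mathcal{T}_h}(\Delta_wv,\Delta_ww)_{L^2(T)}+\tfrac14\sum_{e\in\mathcal{E}_h^o}h_e^{-1}\big([\nabla v]\cdot\mathbf{n}_e,[\nabla w]\cdot\mathbf{n}_e\big)_{L^2(e)}.$$ **Subdomains.** $\Omega=\bigcup_{j=1}^J\Omega_j$ is a decomposition into overlapping subdomains with $\mathrm{diam}(\Omega_j)\approx H$, whose boundaries are aligned with $\mathcal{T}_h$. The overlap is measured by a parameter $\delta>0$, $\delta\lesssim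 H$. There are nonnegative functions $\theta_1,\dots,\theta_J\in C^\infty(\bar\Omega)$ with (i) $\theta_j=0$ on $\Omega\setminus\Omega_j$; (ii) $\sum_{j=1}^J\theta_j=1$ on $\bar\Omega$; (iii) $\|\nabla\theta_j\|_{L^\infty(\Omega)}\lesssim\delta^{-1}$ and $\|D^2\theta_j\|_{L^\infty(\Omega)}\lesssim\delta^{-2}$, where $D^2\theta_j$ is the Hessian. Any point of $\Omega$ belongs to at most $N_c$ subdomains, with $N_c$ a fixed constant. Here $A\lesssim B$ means $A\le CB$ with $C>0$ independent of $h$, $\delta$ and the problem data. **Local problems and preconditioner.** $V_j=\{v\in V_h: v=0\text{ on }\Omega\setminus\Omega_j\}$. $\mathsf{A}_j:V_j\to V_j'$ is defined by $\langle\mathsf{A}_ju_j,v_j\rangle=a_{w,j}(u_j,v_j)$ for all $u_j,v_j\in V_j$, where $$a_{w,j}(u_j,v_j)=\sum_{T\in\mathcal{T}_{h,j}}(\Delta_wu_j,\Delta_wv_j)_{L^2(T)}+\tfrac14\sum_{e\in\mathcal{E}_{h,j}}h_e^{-1}\big([\nabla u_j]\cdot\mathbf{n}_e,[\nabla v_j]\cdot\mathbf{n}_e\big)_{L^2(e)},$$ $\mathcal{T}_{h,j}$ is the set of elements of $\mathcal{T}_h$ contained in $\Omega_j$ (up to boundary), and $\mathcal{E}_{h,j}$ is the set of edges/faces contained in $\bar\Omega_j$ and not lying on $\partial\Omega$ (so edges/faces on $\partial\Omega_j\setminus\partial\Omega$ are included). $\mathsf{I}_j:V_j\to V_h$ is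 the natural injection and $\mathsf{I}_j^\top:V_h'\to V_j'$ is its transpose with respect to the duality pairing. *)

(* Defs.v *)
From HB Require Import structures.
From mathcomp Require Import all_boot all_order all_algebra.
From mathcomp Require Import all_classical all_reals all_analysis.
From mathcomp Require Import ring.

Set Implicit Arguments.
Unset Strict Implicit.
Unset Printing Implicit Defensive.

Import Order.TTheory GRing.Theory Num.Theory.
Import numFieldNormedType.Exports.

Local Open Scope classical_set_scope.
Local Open Scope ring_scope.

Section Euclid.
Context {R : realType} {d : nat}.
Implicit Types (x y : 'rV[R]_d) (f q : 'rV[R]_d -> R) (E : set 'rV[R]_d).

(* The library norm of 'rV[R]_d is the sup norm; lengths, angles and diameters
   are Euclidean and are therefore defined here. The topology is the same. *)
Definition dot x y : R := \sum_i x 0 i * y 0 i.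
Definition enorm x : R := Num.sqrt (dot x x).
Definition diam E : R := sup [set enorm (x - y) | x in E & y in E].

(* Diameter of the largest ball contained in E. *)
Definition inball_diam E : R :=
  sup [set 2 * r | r in
    [set r | 0 <= r /\ exists x, [set y | enorm (y - x) <= r] `<=` E]].

Definition frontier E : set 'rV[R]_d := closure E `\` interior E.

Definition hull n (p : 'I_n -> 'rV[R]_d) (A : {set 'I_n}) : set 'rV[R]_d :=
  [set x | exists l : 'I_n -> R,
    [/\ forall i, 0 <= l i, \sum_(i in A) l i = 1
      & x = \sum_(i in A) l i *: p i]].

Definition convex_polytope_domain E : Prop :=
  E !=set0 /\
  exists n (p : 'I_n -> 'rV[R]_d), E = interior (hull p [set: 'I_n]).

Definition partial (i : 'I_d) f : 'rV[R]_d -> R :=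
  fun x => 'D_(delta_mx 0 i) f x.
Definition grad f x : 'rV[R]_d := \row_i partial i f x.
Definition hess f x : 'M[R]_d := \matrix_(i, j) partial j (partial i f) x.
Definition frobenius (M : 'M[R]_d) : R :=
  Num.sqrt (\sum_i \sum_j M i j ^+ 2).

Fixpoint Ck (k : nat) f : Prop :=
  continuous f /\
  if k is k'.+1 then
    forall i : 'I_d, (forall x, derivable f x (delta_mx 0 i)) /\
                     Ck k' (partial i f)
  else True.
Definition smooth f : Prop := forall k, Ck k f.

(* Polynomials of degree at most 2. *)
Definition quadratic f : Prop :=
  exists (Q : 'M[R]_d) (b : 'rV[R]_d) (c : R),
    forall x, f x = dot (x *m Q) x + dot b x + c.

End Euclid.

Section SimplexIntegral.
Context {R : realType}.

(* Iterated Lebesgue integral of f over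
   { t in R^k | t_i >= 0 and t_0 + ... + t_(k-1) <= s }. *)
Fixpoint ref_int (k : nat) (s : R) : ('rV[R]_k -> R) -> R :=
  if k is k'.+1 then fun f =>
    \int[lebesgue_measure]_(t in `[0, s])
      ref_int (s - t) (fun y : 'rV[R]_k' =>
        f (row_mx (const_mx t : 'rV[R]_1) y))
  else fun f => f 0.

(* Integral over the simplex with vertices p_0, ..., p_k with respect to the
   k-dimensional surface measure, through the affine parametrization
   t |-> p_0 + \sum_i t_i (p_(i+1) - p_0) of the simplex by the reference
   simplex; its Jacobian is the square root of the Gram determinant. *)
Definition edge_mx d (p : seq 'rV[R]_d) : 'M[R]_((size p).-1, d) :=
  \matrix_(i < (size p).-1) (p`_i.+1 - p`_0).

Definition simplex_int d (p : seq 'rV[R]_d) (f : 'rV[R]_d -> R) : R :=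
  Num.sqrt (\det (edge_mx p *m (edge_mx p)^T)) *
  ref_int 1 (fun t => f (p`_0 + t *m edge_mx p)).

End SimplexIntegral.

(* Elements and faces are sets of vertex indices; the condition conforming
   forbids hanging nodes and overlapping elements. *)
Record triangulation (R : realType) (d : nat) (Omega : set 'rV[R]_d) :=
  Triangulation {
    nvert : nat;
    vertex : 'I_nvert -> 'rV[R]_d;
    cells : {set {set 'I_nvert}};
    card_cell : forall T, T \in cells -> #|T| = d.+1;
    cell_nondegenerate :
      forall T, T \in cells -> interior (hull vertex T) !=set0;
    conforming : forall T T', T \in cells -> T' \in cells ->
      hull vertex T `&` hull vertex T' = hull vertex (T :&: T');
    cells_cover : closure Omega = \bigcup_(T in [set` cells]) hull vertex T }.

Section Mesh.
Context {R : realType} {d : nat} {Omega : set 'rV[R]_d}.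
Variable Th : triangulation Omega.
Local Notation simplex := {set 'I_(nvert Th)}.
Implicit Types (A T e : simplex) (v w : 'rV[R]_d -> R) (x : 'rV[R]_d).

Definition geom A : set 'rV[R]_d := hull (vertex (t := Th)) A.

Definition shape_regular (sigma : R) : Prop :=
  forall T, T \in cells Th -> diam (geom T) <= sigma * inball_diam (geom T).

Definition integral_on A (f : 'rV[R]_d -> R) : R :=
  simplex_int [seq vertex i | i <- enum A] f.
Definition meas A : R := integral_on A (fun=> 1).

Definition adjacent e : {set simplex} := [set T in cells Th | e \subset T].
Definition faces : {set simplex} :=
  [set e : simplex | (#|e| == d) && (adjacent e != finset.set0)].
Definition interior_faces : {set simplex} :=
  [set e in faces | #|adjacent e| == 2].
Definition face_diam e : R := meas e `^ (d.-1%:R)^-1.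

(* The elements T^- and T^+ sharing an interior face, in an arbitrary order
   (jumps in the normal direction do not depend on it); on a boundary face
   cell_minus is the only element containing it. *)
Definition cell_minus e : simplex :=
  odflt finset.set0 [pick T in adjacent e].
Definition cell_plus e : simplex :=
  odflt finset.set0 [pick T in adjacent e :\ cell_minus e].

(* Unit normal of the face e of T pointing out of T. *)
Definition outward_normal T e : 'rV[R]_d :=
  xget 0 [set n | [/\ enorm n = 1,
    forall i j, i \in e -> j \in e -> dot n (vertex i - vertex j) = 0
  & forall i k, i \in e -> k \in T :\: e ->
      0 < dot n (vertex i - vertex k)]].
Definition face_normal e : 'rV[R]_d := outward_normal (cell_minus e) e.

(* Elements of V_h are extended by 0 outside Omega. *)
Definition fe_space : {pred ('rV[R]_d -> R)} :=
  mem [set v : 'rV[R]_d -> R |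
    [/\ continuous v, forall x, ~ Omega x -> v x = 0
      & forall T, T \in cells Th ->
          exists2 q, quadratic q & forall x, geom T x -> v x = q x]].

(* The polynomial that coincides with v on T; its gradient on a face of T is
   the trace of the gradient of v from the inside of T. *)
Definition piece v T : 'rV[R]_d -> R :=
  xget 0 [set q | quadratic q /\ forall x, geom T x -> v x = q x].
Definition grad_on v T x : 'rV[R]_d := grad (piece v T) x.

Definition grad_jump v e x : 'rV[R]_d :=
  grad_on v (cell_plus e) x - grad_on v (cell_minus e) x.
Definition grad_avg v e x : 'rV[R]_d :=
  if e \in interior_faces then
    2^-1 *: (grad_on v (cell_plus e) x + grad_on v (cell_minus e) x)
  else grad_on v (cell_minus e) x.

Definition weak_laplacian v T : R :=
  (meas T)^-1 * \sum_(e in faces | e \subset T)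
    integral_on e (fun x => dot (grad_avg v e x) (outward_normal T e)).

Definition broken_form (S F : {set simplex}) v w : R :=
  \sum_(T in S)
     integral_on T (fun=> weak_laplacian v T * weak_laplacian w T) +
  4^-1 * \sum_(e in F) (face_diam e)^-1 *
     integral_on e (fun x => dot (grad_jump v e x) (face_normal e) *
                             dot (grad_jump w e x) (face_normal e)).

Definition cells_in (G : set 'rV[R]_d) : {set simplex} :=
  [set T in cells Th | `[< geom T `<=` closure G >]].
Definition interior_faces_in (G : set 'rV[R]_d) : {set simplex} :=
  [set e in interior_faces | `[< geom e `<=` closure G >]].

End Mesh.

Section DotTheory.
Context {R : realType} {d : nat}.
Implicit Types (x y z : 'rV[R]_d).

Lemma dotC x y : dot x y = dot y x.
Proof. by rewrite /dot; apply: eq_bigr => i _; rewrite mulrC. Qed.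

Lemma dotDl x y z : dot (x + y) z = dot x z + dot y z.
Proof.
by rewrite /dot -big_split; apply: eq_bigr => i _; rewrite mxE mulrDl.
Qed.

Lemma dotZl a x y : dot (a *: x) y = a * dot x y.
Proof. by rewrite /dot mulr_sumr; apply: eq_bigr => i _; rewrite mxE mulrA. Qed.

Lemma dotDr x y z : dot x (y + z) = dot x y + dot x z.
Proof. by rewrite dotC dotDl !(dotC x). Qed.

Lemma dotZr a x y : dot x (a *: y) = a * dot x y.
Proof. by rewrite dotC dotZl (dotC x). Qed.

Lemma dot0l x : dot 0 x = 0.
Proof. by rewrite /dot big1 // => i _; rewrite mxE mul0r. Qed.

Lemma dot_delta x i : dot x (delta_mx 0 i) = x 0 i.
Proof.
rewrite /dot (bigD1 i) //= big1 => [|j ji]; first by rewrite mxE !eqxx mulr1 addr0.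
by rewrite mxE eqxx (negbTE ji) mulr0.
Qed.

Lemma is_derive_quadratic (Q : 'M[R]_d) b c x v :
  is_derive x v (fun x => dot (x *m Q) x + dot b x + c : R)
    (dot (x *m Q) v + dot (v *m Q) x + dot b v).
Proof.
set f := (fun x => _); set L := (X in is_derive _ _ _ X).
have : h^-1 *: (f (h *: v + x) - f x) @[h --> 0^'] --> L.
  apply: (@cvg_trans _ (L + h * dot (v *m Q) v @[h --> (0:R)^'])).
    apply: near_eq_cvg; near=> h.
    have h0 : h != 0 by near: h; exact: nbhs_dnbhs_neq.
    rewrite /f /L mulmxDl -scalemxAl !(dotDl, dotDr, dotZl, dotZr) /GRing.scale /=.
    by field.
  apply: (@cvg_within_filter _ _ _ (nbhs (0:R))).
  have {2}-> : L = L + 0 * dot (v *m Q) v by rewrite mul0r addr0.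
  by apply: cvgD; [exact: cvg_cst | apply: cvgMr_tmp; exact: cvg_id].
move=> cf; apply: DeriveDef; first by apply/cvg_ex; exists L.
exact: cvg_lim.
Unshelve. all: by end_near.
Qed.

Lemma quadratic_derivable (q : 'rV[R]_d -> R) x v : quadratic q -> derivable q x v.
Proof.
move=> [Q [b [c qE]]].
have -> : q = (fun x => dot (x *m Q) x + dot b x + c) by apply/funext.
by have [] := is_derive_quadratic Q b c x v.
Qed.

Lemma quadratic_lin a (f g : 'rV[R]_d -> R) :
  quadratic f -> quadratic g -> quadratic (a *: f + g).
Proof.
move=> [Q [b [c fE]]] [Q' [b' [c' gE]]].
exists (a *: Q + Q'), (a *: b + b'), (a * c + c') => x.
rewrite !fctE fE gE mulmxDr -scalemxAr !(dotDl, dotZl) /GRing.scale /=; ring.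
Qed.

Lemma quadratic0 : quadratic (0 : 'rV[R]_d -> R).
Proof.
exists 0, 0, 0 => x.
by rewrite mulmx0 dot0l !addr0.
Qed.

Definition affine (f : 'rV[R]_d -> R) : Prop :=
  exists (b : 'rV[R]_d) (c : R), forall x, f x = dot b x + c.

Lemma affineD f g : affine f -> affine g -> affine (fun x => f x + g x).
Proof.
move=> [b [c fE]] [b' [c' gE]]; exists (b + b'), (c + c') => x.
by rewrite fE gE dotDl; ring.
Qed.

Lemma affineZ a f : affine f -> affine (fun x => a * f x).
Proof.
move=> [b [c fE]]; exists (a *: b), (a * c) => x; rewrite fE dotZl; ring.
Qed.

Lemma affine_cst c : affine (fun=> c).
Proof. by exists 0, c => x; rewrite dot0l add0r. Qed.

Lemma affine_sum (I : Type) (r : seq I) (F : I -> 'rV[R]_d -> R) :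
  (forall i, affine (F i)) -> affine (fun x => \sum_(i <- r) F i x).
Proof.
move=> aF; elim: r => [|i r IH].
  by under eq_fun do rewrite big_nil; exact: affine_cst.
by under eq_fun do rewrite big_cons; exact: affineD.
Qed.

Lemma affine_quadratic f : affine f -> quadratic f.
Proof.
move=> [b [c fE]]; exists 0, b, c => x.
by rewrite fE mulmx0 dot0l add0r.
Qed.

Lemma affineM f g : affine f -> affine g -> quadratic (fun x => f x * g x).
Proof.
move=> [b [c fE]] [b' [c' gE]].
exists (b^T *m b'), (c' *: b + c *: b'), (c * c') => x.
rewrite fE gE dotDl !dotZl.
have -> : dot (x *m (b^T *m b')) x = dot b x * dot b' x.
  rewrite mulmxA.
  have -> : x *m b^T = (dot b x)%:M.
    rewrite [LHS]mx11_scalar /dot mxE; congr (_%:M).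
    by apply: eq_bigr => k _; rewrite !mxE mulrC.
  by rewrite mul_scalar_mx dotZl.
ring.
Qed.

Lemma grad_quadratic q : quadratic q -> forall n, affine (fun x => dot (grad q x) n).
Proof.
move=> [Q [b [c qE]]] n.
have -> : q = (fun x => dot (x *m Q) x + dot b x + c) by apply/funext.
rewrite /dot; apply: affine_sum => i.
under eq_fun do rewrite mxE mulrC.
apply: affineZ.
have -> : partial i (fun x => dot (x *m Q) x + dot b x + c) =
  (fun x => dot (\row_j Q j i + \row_j Q i j) x + b 0 i).
  apply/funext => x; rewrite /partial.
  have [_ ->] := is_derive_quadratic Q b c x (delta_mx 0 i).
  rewrite !dot_delta dotDl; congr (_ + _ + _).
    by rewrite mxE /dot; apply: eq_bigr => j _; rewrite mxE mulrC.
  by rewrite -rowE /dot; apply: eq_bigr => j _; rewrite !mxE.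
by exists (\row_j Q j i + \row_j Q i j), (b 0 i).
Qed.

Lemma grad_lin a (f g : 'rV[R]_d -> R) x : quadratic f -> quadratic g ->
  grad (a *: f + g) x = a *: grad f x + grad g x.
Proof.
move=> qf qg; apply/rowP => i; rewrite !mxE /partial.
have [Q [b [c fE]]] := qf; have [Q' [b' [c' gE]]] := qg.
have pE (h : 'rV[R]_d -> R) P u e : (forall x, h x = dot (x *m P) x + dot u x + e) ->
    'D_(delta_mx 0 i) h x = dot (x *m P) (delta_mx 0 i) +
      dot (delta_mx 0 i *m P) x + dot u (delta_mx 0 i).
  move=> hE; have -> : h = (fun x => dot (x *m P) x + dot u x + e) by apply/funext.
  by have [_ ->] := is_derive_quadratic P u e x (delta_mx 0 i).
rewrite (pE _ _ _ _ fE) (pE _ _ _ _ gE).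
rewrite (pE _ (a *: Q + Q') (a *: b + b') (a * c + c')).
  by rewrite !mulmxDr -!scalemxAr !(dotDl, dotZl); ring.
move=> y; rewrite !fctE fE gE mulmxDr -scalemxAr !(dotDl, dotZl).
by rewrite /GRing.scale /=; ring.
Qed.

Lemma quadratic_eq (E : set 'rV[R]_d) f g : interior E !=set0 ->
  quadratic f -> quadratic g -> (forall x, E x -> f x = g x) -> f = g.
Proof.
move=> [x0 Ex0] qf qg fg.
have : quadratic (-1 *: f + g) by exact: quadratic_lin.
have : forall x, E x -> (-1 *: f + g) x = 0.
  by move=> x Ex; rewrite !fctE fg // /GRing.scale /= mulN1r addNr.
set h := (X in quadratic X) => h0 [Q [b [c hE]]].
suff h00 : forall x, h x = 0.
  by apply/funext => x; have := h00 x; rewrite /h !fctE /GRing.scale /= mulN1r addrC => /subr0_eq.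
move=> x; have [v vE] : exists v, v = x - x0 by exists (x - x0).
pose A := dot (v *m Q) v; pose B := dot (x0 *m Q) v + dot (v *m Q) x0 + dot b v.
have hs s : h (x0 + s *: v) = h x0 + s * B + s ^+ 2 * A.
  rewrite !hE mulmxDl -scalemxAl !(dotDl, dotDr, dotZl, dotZr) /A /B; ring.
have : \forall s \near (0 : R), E (x0 + s *: v).
  have : (fun s : R => x0 + s *: v) @ 0 --> x0.
    have {2}-> : x0 = x0 + 0 *: v by rewrite scale0r addr0.
    by apply: cvgD; [exact: cvg_cst | apply: cvgZr_tmp; exact: cvg_id].
  exact.
move=> /nbhs_ballP [e /= e0 He].
have z s : `|s| < e -> h x0 + s * B + s ^+ 2 * A = 0.
  by move=> se; rewrite -hs; apply: h0; apply: He; rewrite /ball /= sub0r normrN.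
have hx0 : h x0 = 0 by have := z 0; rewrite normr0 mul0r expr0n /= mul0r !addr0; exact.
have e2 : 0 < e / 2 by rewrite divr_gt0.
have e2e : `|e / 2| < e by rewrite gtr0_norm // ltr_pdivrMr // ltr_pMr // ltr1n.
have z1 := z _ e2e; have := z (- (e / 2)); rewrite normrN => /(_ e2e) z2.
have A0 : A = 0.
  apply: (@mulfI _ ((e/2)^+2 *+ 2)); first by rewrite mulrn_eq0 /= expf_eq0 /= gt_eqF.
  rewrite mulr0 -[RHS](addr0 0) -{1}z1 -z2 hx0; ring.
have B0 : B = 0.
  apply: (@mulfI _ (e/2)); first by rewrite gt_eqF.
  by move: z1; rewrite hx0 A0 !mulr0 addr0 add0r.
by have := hs 1; rewrite scale1r vE addrC subrK hx0 A0 B0 !mulr0 !addr0.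
Qed.

End DotTheory.

Section IntegralTheory.
Context {R : realType}.
Local Notation mu := lebesgue_measure.

Lemma dot_mulmxC d (Q : 'M[R]_d) (x y : 'rV[R]_d) :
  dot (x *m Q) y = dot (y *m Q^T) x.
Proof.
rewrite /dot; under eq_bigr do rewrite mxE mulr_suml.
rewrite exchange_big /=; apply: eq_bigr => i _.
by rewrite mxE mulr_suml; apply: eq_bigr => j _; rewrite mxE; ring.
Qed.

Lemma quadratic_comp k d (z : 'rV[R]_d) (E : 'M[R]_(k, d)) (f : 'rV[R]_d -> R) :
  quadratic f -> quadratic (fun y => f (z + y *m E)).
Proof.
move=> [Q [b [c fE]]].
have dotM (x : 'rV[R]_d) (y : 'rV[R]_k) : dot x (y *m E) = dot (x *m E^T) y.
  rewrite /dot; under eq_bigr do rewrite mxE mulr_sumr.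
  rewrite exchange_big /=; apply: eq_bigr => i _.
  by rewrite mxE mulr_suml; apply: eq_bigr => j _; rewrite mxE; ring.
exists (E *m Q *m E^T), (z *m Q *m E^T + z *m Q^T *m E^T + b *m E^T),
  (dot (z *m Q) z + dot b z + c) => y.
rewrite fE mulmxDl !(dotDl, dotDr) !dotM (dot_mulmxC _ (y *m E) z) dotM !mulmxA; ring.
Qed.

Lemma continuous_integrable (f : R -> R) s : continuous f ->
  mu.-integrable `[0, s] (EFin \o f).
Proof.
move=> cf; apply: continuous_compact_integrable; first exact: segment_compact.
exact: continuous_subspaceT.
Qed.

Lemma Rintegral_horner (p : {poly R}) s : 0 <= s ->
  \int[mu]_(t in `[0, s]) p.[t] =
  \sum_(i < size p) p`_i / i.+1%:R * s ^+ i.+1.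
Proof.
rewrite le_eqVlt => /predU1P[<-|s0].
  rewrite set_itv1 Rintegral_set1 big1 // => i _.
  by rewrite expr0n mulr0.
pose P := \sum_(i < size p) (p`_i / i.+1%:R) *: 'X^(i.+1) : {poly R}.
have PE t : P.[t] = \sum_(i < size p) p`_i / i.+1%:R * t ^+ i.+1.
  by rewrite horner_sum; apply: eq_bigr => i _; rewrite !hornerE.
have Pd : P^`() = p.
  rewrite /P raddf_sum /= -[RHS]coefK poly_def; apply: eq_bigr => i _.
  by rewrite derivZ derivXn /= -(scaler_nat _ 'X^i) scalerA divfK // pnatr_eq0.
rewrite /Rintegral (@continuous_FTC2 _ _ (horner P)) //.
- have P0 : P.[0] = 0 by rewrite PE big1 // => i _; rewrite expr0n mulr0.
  by rewrite -PE P0 -EFinB subr0.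
- exact/continuous_subspaceT/continuous_horner.
- split.
  + by move=> x _; exact: derivable_horner.
  + exact/cvg_at_right_filter/continuous_horner.
  + exact/cvg_at_left_filter/continuous_horner.
- by move=> x _; rewrite -derivE Pd.
Qed.

Definition slice (P : {poly {poly R}}) (s : R) : {poly R} :=
  \sum_(n < size P) (P`_n).[s] *: 'X^n.

Lemma sliceE P s t : P.[t%:P].[s] = (slice P s).[t].
Proof.
rewrite /slice (horner_coef P) !horner_sum; apply: eq_bigr => i _.
by rewrite !hornerE.
Qed.

Lemma horner_shift (r : {poly R}) : exists P : {poly {poly R}},
  forall s t, r.[s - t] = P.[t%:P].[s].
Proof.
exists (map_poly polyC r \Po ('X%:P - 'X)) => s t.
rewrite horner_comp !hornerE.
elim/poly_ind: r => [|r c IH]; first by rewrite map_poly0 !horner0.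
by rewrite rmorphD rmorphM /= map_polyX map_polyC /= !hornerE IH ?hornerE.
Qed.

Lemma Rintegral_slice (P : {poly {poly R}}) : exists p : {poly R},
  forall s, 0 <= s -> \int[mu]_(t in `[0, s]) (slice P s).[t] = p.[s].
Proof.
exists (\sum_(n < size P) (n.+1%:R^-1 *: (P`_n * 'X^(n.+1)))) => s s0.
have sP : (size (slice P s) <= size P)%N.
  apply: (leq_trans (size_sum _ _ _)); apply/bigmax_leqP => i _.
  by rewrite (leq_trans (size_scale_leq _ _)) // size_polyXn.
have cP i : (i < size P)%N -> (slice P s)`_i = (P`_i).[s].
  move=> iP; rewrite coef_sum (bigD1 (Ordinal iP)) //= big1 => [|j ji].
    by rewrite coefZ coefXn eqxx mulr1 addr0.
  rewrite coefZ coefXn; have -> : (i == j) = false; last by rewrite mulr0.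
  by apply/negbTE; apply: contraNneq ji => e; apply/eqP/val_inj.
rewrite Rintegral_horner // (big_ord_widen _ (fun i => (slice P s)`_i / i.+1%:R * s ^+ i.+1) sP).
rewrite big_mkcond horner_sum; apply: eq_bigr => i _ /=.
rewrite !hornerE -cP //=; case: ltnP => [_|si]; first by rewrite [in RHS](mulrC i.+1%:R^-1).
by rewrite /= (nth_default _ si) !(mul0r, mulr0) /=.
Qed.

Lemma ref_int_quadratic k :
  (forall a (f g : 'rV[R]_k -> R) s, quadratic f -> quadratic g -> 0 <= s ->
     ref_int s (a *: f + g) = a * ref_int s f + ref_int s g) /\
  (forall f : 'rV[R]_k -> R, quadratic f ->
     exists p : {poly R}, forall s, 0 <= s -> ref_int s f = p.[s]).
Proof.
elim: k => [|k [IHl IHp]].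
  by split=> [//|f qf]; exists (f 0)%:P => s _; rewrite hornerC.
pose sl (f : 'rV[R]_k.+1 -> R) (t : R) : 'rV[R]_k -> R := fun y =>
  f (row_mx (const_mx t : 'rV[R]_1) y).
have slP f : quadratic f -> (forall t, quadratic (sl f t)) /\
    exists P : {poly {poly R}}, forall s t, 0 <= t <= s ->
      ref_int (s - t) (sl f t) = (slice P s).[t].
  move=> qf; have [Q [b [c fE]]] := qf.
  pose u : 'rV[R]_(1 + k) := row_mx (const_mx 1) 0.
  pose E : 'M[R]_(k, 1 + k) := row_mx 0 1%:M.
  have rE t y : row_mx (const_mx t : 'rV[R]_1) y = t *: u + y *m E.
    rewrite /u /E scale_row_mx mul_mx_row mulmx1 mulmx0 scaler0 add_row_mx.
    rewrite addr0 add0r; congr row_mx.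
    by apply/rowP => i; rewrite !mxE mulr1.
  have qs t : quadratic (sl f t).
    rewrite /sl; under eq_fun do rewrite rE.
    exact: (@quadratic_comp k (1 + k)).
  split=> //.
  pose f0 (y : 'rV[R]_k) := f (0 + y *m E).
  pose g1 (w : 'rV[R]_(1 + k)) := dot (u *m Q) w + dot (w *m Q) u + dot b u.
  pose f1 (y : 'rV[R]_k) := g1 (0 + y *m E).
  pose f2 (y : 'rV[R]_k) := dot (u *m Q) u.
  have q0 : quadratic f0 by exact: (@quadratic_comp k (1 + k)).
  have q1 : quadratic f1.
    apply: (@quadratic_comp k (1 + k)); apply: affine_quadratic.
    apply: affineD; last exact: affine_cst.
    apply: affineD; first by exists (u *m Q), 0 => x; rewrite addr0.
    by exists (u *m Q^T), 0 => x; rewrite addr0 dot_mulmxC.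
  have q2 : quadratic f2 by apply: affine_quadratic; exact: affine_cst.
  have slE t : sl f t = t ^+ 2 *: f2 + (t *: f1 + f0).
    apply/funext => y; rewrite /sl rE !fctE /f2 /f1 /f0 /g1 !fE add0r.
    rewrite mulmxDl -scalemxAl !(dotDl, dotDr, dotZl, dotZr) /GRing.scale /=.
    ring.
  have [r0 r0E] := IHp _ q0; have [r1 r1E] := IHp _ q1.
  have [r2 r2E] := IHp _ q2.
  have [P0 P0E] := horner_shift r0; have [P1 P1E] := horner_shift r1.
  have [P2 P2E] := horner_shift r2.
  exists ('X ^+ 2 * P2 + ('X * P1 + P0)) => s t /andP[t0 ts].
  have st : 0 <= s - t by rewrite subr_ge0.
  have q10 : quadratic (t *: f1 + f0) by exact: quadratic_lin.
  rewrite slE !IHl // r0E // r1E // r2E // P0E P1E P2E -sliceE.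
  by rewrite !hornerE /= expr2.
have eqI f (P : {poly {poly R}}) s :
    (forall s t, 0 <= t <= s -> ref_int (s - t) (sl f t) = (slice P s).[t]) ->
    ref_int s f = \int[mu]_(t in `[0, s]) (slice P s).[t].
  move=> fP; rewrite /=; apply: eq_Rintegral => t.
  by rewrite inE /= in_itv /= => ts; exact: fP.
split=> [a f g s qf qg s0|f qf]; last first.
  have [_ [P PE]] := slP f qf; have [p pE] := Rintegral_slice P.
  by exists p => s s0; rewrite (eqI _ _ _ PE) pE.
have [qsf [P PE]] := slP f qf; have [qsg [P' PE']] := slP g qg.
rewrite (eqI _ _ _ PE) (eqI _ _ _ PE') /=.
under eq_Rintegral => t.
  rewrite inE /= in_itv /= => ts.
  have -> : (fun y : 'rV[R]_k => (a *: f + g) (row_mx (const_mx t : 'rV[R]_1) y)) =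
    a *: sl f t + sl g t by [].
  rewrite IHl //; last by case/andP: ts => _; rewrite subr_ge0.
  rewrite PE // PE' //.
  over.
rewrite RintegralD //=.
- rewrite RintegralZl //; apply: continuous_integrable; exact: continuous_horner.
- apply: (@continuous_integrable (fun t => a * (slice P s).[t])) => t.
  by apply: cvgMl_tmp; exact: continuous_horner.
- exact/continuous_integrable/continuous_horner.
Qed.

Lemma simplex_int_lin d (p : seq 'rV[R]_d) a (f g : 'rV[R]_d -> R) :
  quadratic f -> quadratic g ->
  simplex_int p (a *: f + g) = a * simplex_int p f + simplex_int p g.
Proof.
move=> qf qg; rewrite /simplex_int.
have [lin _] := ref_int_quadratic (size p).-1.
rewrite mulrCA -mulrDr -lin //; try exact: quadratic_comp.
Qed.

End IntegralTheory.

Section FormTheory.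
Context {R : realType} {d : nat} {Omega : set 'rV[R]_d}.
Variable Th : triangulation Omega.
Local Notation simplex := {set 'I_(nvert Th)}.
Implicit Types (T e : simplex) (v w : 'rV[R]_d -> R) (x n : 'rV[R]_d).

Lemma continuous_lin (a : R) v w :
  continuous v -> continuous w -> continuous (a *: v + w).
Proof.
move=> cv cw x; pose c : 'rV[R]_d -> R := fun=> a.
have cc : continuous c by exact: cst_continuous.
exact: (continuousD (continuousM (cc x) (cv x)) (cw x)).
Qed.

Lemma fe_spaceP v : v \in fe_space Th <->
  [/\ continuous v, forall x, ~ Omega x -> v x = 0
    & forall T, T \in cells Th ->
        exists2 q, quadratic q & forall x, geom T x -> v x = q x].
Proof. by split=> [/set_mem|/mem_set]. Qed.

Lemma fe_space_submod_closed : submod_closed (fe_space Th).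
Proof.
split=> [|a v w /fe_spaceP[cv v0 vq] /fe_spaceP[cw w0 wq]]; apply/fe_spaceP; split.
- exact: cst_continuous.
- by [].
- by move=> T _; exists 0; first exact: quadratic0.
- exact: continuous_lin.
- by move=> x nx; rewrite !fctE v0 // w0 // scaler0 addr0.
- move=> T TTh; have [p qp vp] := vq T TTh; have [q qq wq'] := wq T TTh.
  exists (a *: p + q); first exact: quadratic_lin.
  by move=> x Tx; rewrite !fctE vp // wq'.
Qed.

HB.instance Definition _ := GRing.isSubmodClosed.Build _ _ (fe_space Th)
  fe_space_submod_closed.

Lemma piece_spec v T : v \in fe_space Th -> T \in cells Th ->
  quadratic (piece v T) /\ forall x, geom T x -> v x = piece v T x.
Proof.
move=> /fe_spaceP[_ _ vq] /vq[q qq vqE].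
exact: (@xgetI _ 0 [set q | quadratic q /\ forall x, geom T x -> v x = q x] q
  (conj qq vqE)).
Qed.

Lemma piece_lin a v w T : v \in fe_space Th -> w \in fe_space Th ->
  T \in cells Th -> piece (a *: v + w) T = a *: piece v T + piece w T.
Proof.
move=> vV wV TTh.
have uV : a *: v + w \in fe_space Th.
  by case: fe_space_submod_closed => _; exact.
have [qv vE] := piece_spec vV TTh; have [qw wE] := piece_spec wV TTh.
have [qu uE] := piece_spec uV TTh.
apply: (quadratic_eq (cell_nondegenerate TTh)) => //.
  exact: quadratic_lin.
by move=> x Tx; rewrite -uE // !fctE vE // wE.
Qed.

Lemma grad_on_lin a v w T x : v \in fe_space Th -> w \in fe_space Th ->
  T \in cells Th ->
  grad_on (a *: v + w) T x = a *: grad_on v T x + grad_on w T x.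
Proof.
move=> vV wV TTh; rewrite /grad_on piece_lin // grad_lin //.
  by have [] := piece_spec vV TTh.
by have [] := piece_spec wV TTh.
Qed.

Lemma grad_on_affine v T n : v \in fe_space Th -> T \in cells Th ->
  affine (fun x => dot (grad_on v T x) n).
Proof.
by move=> vV TTh; apply: grad_quadratic; have [] := piece_spec vV TTh.
Qed.

Lemma cell_minusP e : e \in faces Th -> cell_minus e \in cells Th.
Proof.
rewrite !inE => /andP[_ /set0Pn[T Te]]; rewrite /cell_minus; case: pickP => /=.
  by move=> T'; rewrite inE => /andP[].
by move/(_ T); rewrite Te.
Qed.

Lemma cell_plusP e : e \in interior_faces Th -> cell_plus e \in cells Th.
Proof.
rewrite !inE => /andP[/andP[_ /set0Pn[T Te]] /eqP e2].
rewrite /cell_plus; case: pickP => /= [T'|].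
  by rewrite !inE => /andP[_ /andP[]].
move=> e0; have := cardsD1 (cell_minus e) (adjacent e).
rewrite e2 (_ : #|_ :\ _| = 0%N) => [|]; first by case: (_ \in _).
by apply/eqP; rewrite cards_eq0; apply/eqP/setP => T'; rewrite e0 inE.
Qed.

Lemma grad_jump_lin a v w e x : v \in fe_space Th -> w \in fe_space Th ->
  e \in interior_faces Th ->
  grad_jump (a *: v + w) e x = a *: grad_jump v e x + grad_jump w e x.
Proof.
move=> vV wV eI; have eF : e \in faces Th by move: eI; rewrite inE => /andP[].
rewrite /grad_jump !grad_on_lin ?cell_plusP ?cell_minusP //.
by rewrite scalerBr opprD addrACA.
Qed.

Lemma grad_avg_lin a v w e x : v \in fe_space Th -> w \in fe_space Th ->
  e \in faces Th ->
  grad_avg (a *: v + w) e x = a *: grad_avg v e x + grad_avg w e x.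
Proof.
move=> vV wV eF; rewrite /grad_avg; case: ifP => eI.
  rewrite !grad_on_lin ?cell_plusP ?cell_minusP //.
  by rewrite addrACA -(scalerDr a) [LHS]scalerDr !scalerA (mulrC a).
by rewrite grad_on_lin ?cell_minusP.
Qed.

Lemma grad_jump_affine v e n : v \in fe_space Th -> e \in interior_faces Th ->
  affine (fun x => dot (grad_jump v e x) n).
Proof.
move=> vV eI; have eF : e \in faces Th by move: eI; rewrite inE => /andP[].
rewrite /grad_jump.
under eq_fun do rewrite -scaleN1r dotDl dotZl.
apply: affineD; first exact: (grad_on_affine n vV (cell_plusP eI)).
by apply: affineZ; exact: (grad_on_affine n vV (cell_minusP eF)).
Qed.

Lemma grad_avg_affine v e n : v \in fe_space Th -> e \in faces Th ->
  affine (fun x => dot (grad_avg v e x) n).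
Proof.
move=> vV eF; rewrite /grad_avg; case eI : (e \in interior_faces Th); last first.
  exact: (grad_on_affine n vV (cell_minusP eF)).
under eq_fun do rewrite dotZl dotDl.
apply: affineZ; apply: affineD.
  exact: (grad_on_affine n vV (cell_plusP eI)).
exact: (grad_on_affine n vV (cell_minusP eF)).
Qed.

Lemma weak_laplacian_lin a v w T : v \in fe_space Th -> w \in fe_space Th ->
  weak_laplacian (a *: v + w) T =
  a * weak_laplacian v T + weak_laplacian w T.
Proof.
move=> vV wV; rewrite /weak_laplacian mulrCA -mulrDr; congr (_ * _).
rewrite mulr_sumr -big_split /=; apply: eq_bigr => e /andP[eF _].
rewrite /integral_on -simplex_int_lin.
- congr simplex_int; apply/funext => x.
  by rewrite grad_avg_lin // dotDl dotZl.
- by apply: affine_quadratic; exact: grad_avg_affine.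
- by apply: affine_quadratic; exact: grad_avg_affine.
Qed.

Lemma broken_form_lin (S F : {set simplex}) u a v w :
  F \subset interior_faces Th -> u \in fe_space Th ->
  v \in fe_space Th -> w \in fe_space Th ->
  broken_form S F u (a *: v + w) = a * broken_form S F u v + broken_form S F u w.
Proof.
move=> FI uV vV wV; rewrite /broken_form mulrDr addrACA; congr (_ + _).
  rewrite mulr_sumr -big_split /=; apply: eq_bigr => T _.
  rewrite /integral_on -simplex_int_lin; do ?exact/affine_quadratic/affine_cst.
  congr simplex_int; apply/funext => x; rewrite !fctE weak_laplacian_lin //.
  by rewrite /GRing.scale /=; ring.
rewrite mulrCA -mulrDr; congr (_ * _).
rewrite mulr_sumr -big_split /=; apply: eq_bigr => e eF.
have eI := fintype.subsetP FI e eF.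
rewrite [a * (_ * _)]mulrCA -mulrDr; congr (_ * _).
rewrite /integral_on -simplex_int_lin; do ?by apply: affineM; exact: grad_jump_affine.
congr simplex_int; apply/funext => x; rewrite grad_jump_lin //.
by rewrite !fctE (dotDl (a *: _)) dotZl /GRing.scale /=; ring.
Qed.

End FormTheory.

Section Schwarz.
Context {R : realType} {d : nat} {Omega : set 'rV[R]_d}.
Variable Th : triangulation Omega.

Definition Vh : Type := {v : 'rV[R]_d -> R | v \in fe_space Th}.
HB.instance Definition _ := SubChoice.on Vh.
HB.instance Definition _ := [SubChoice_isSubLmodule of Vh by <:].

Definition local_space (G : set 'rV[R]_d) : {pred Vh} :=
  mem [set v : Vh | forall x, (Omega `\` G) x -> val v x = 0].

Lemma local_space_submod_closed G : submod_closed (local_space G).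
Proof.
split=> [|a v w /set_mem vG /set_mem wG]; apply/mem_set => x xG.
  by rewrite raddf0.
rewrite linearP; change (a * val v x + val w x = 0).
by rewrite (vG x xG) (wG x xG) mulr0 addr0.
Qed.

HB.instance Definition _ G := GRing.isSubmodClosed.Build _ _ (local_space G)
  (local_space_submod_closed G).

Definition Vloc (G : set 'rV[R]_d) : Type := {v : Vh | v \in local_space G}.
HB.instance Definition _ G := SubChoice.on (Vloc G).
HB.instance Definition _ G := [SubChoice_isSubLmodule of Vloc G by <:].

Definition a_w (u v : Vh) : R :=
  broken_form (cells Th) (interior_faces Th) (val u) (val v).

Definition a_w_loc G (u v : Vloc G) : R :=
  broken_form (cells_in Th G) (interior_faces_in Th G) (val (val u)) (val (val v)).

Lemma a_w_linear u : linear_for *%R (a_w u).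
Proof.
by move=> a v w; rewrite /a_w linearP; apply: broken_form_lin; do ?exact: valP.
Qed.

Lemma a_w_loc_linear G u : linear_for *%R (@a_w_loc G u).
Proof.
move=> a v w; rewrite /a_w_loc !linearP; apply: broken_form_lin; do ?exact: valP.
by apply/fintype.subsetP => e; rewrite inE => /andP[].
Qed.

HB.instance Definition _ u := GRing.isLinear.Build R Vh R *%R (a_w u)
  (a_w_linear u).
HB.instance Definition _ G u := GRing.isLinear.Build R (Vloc G) R *%R
  (@a_w_loc G u) (@a_w_loc_linear G u).

Definition A_h (u : Vh) : {scalar Vh} := a_w u.
Definition A_loc G (u : Vloc G) : {scalar Vloc G} := @a_w_loc G u.

(* The inverse of A_loc G when A_loc G is bijective. *)
Definition A_loc_inv G (l : {scalar Vloc G}) : Vloc G :=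
  xget 0 [set u | A_loc u = l].

Definition injection G : {linear Vloc G -> Vh} := val.
Definition injection_tr G (l : {scalar Vh}) : {scalar Vloc G} := l \o injection G.

Definition B_h J (Om : 'I_J -> set 'rV[R]_d) (l : {scalar Vh}) : Vh :=
  \sum_(j < J) injection (Om j) (A_loc_inv (injection_tr (Om j) l)).

End Schwarz.

Definition is_eigenvalue (R : realType) (V : lmodType R) (L : V -> V) (lam : R) :=
  exists2 u : V, u != 0 & L u = lam *: u.
Definition max_eigenvalue (R : realType) (V : lmodType R) (L : V -> V) lam :=
  is_eigenvalue L lam /\ forall m, is_eigenvalue L m -> m <= lam.
Definition min_eigenvalue (R : realType) (V : lmodType R) (L : V -> V) lam :=
  is_eigenvalue L lam /\ forall m, is_eigenvalue L m -> lam <= m.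

(* K bounds all the constants hidden in the relations <~ and ~ between the
   subdomains, H, delta and theta. theta j stands for any smooth extension to R^d of a
   function of C^oo(closure Omega); only its values on closure Omega are
   constrained, and the L^oo(Omega) bounds on its continuous derivatives are
   pointwise bounds. *)
Record overlapping_decomposition (R : realType) (d : nat)
    (Omega : set 'rV[R]_d) (Th : triangulation Omega) (K : R) (Nc : nat)
    (H delta : R) (J : nat) (Om : 'I_J -> set 'rV[R]_d)
    (theta : 'I_J -> 'rV[R]_d -> R) : Prop := OverlappingDecomposition {
  sub_open : forall j, open (Om j);
  sub_cover : Omega = \bigcup_j Om j;
  sub_aligned : forall j, exists2 F : {set {set 'I_(nvert Th)}},
    F \subset faces Th &
    frontier (Om j) = \bigcup_(e in [set` F]) geom e;
  sub_diam : forall j, K^-1 * H <= diam (Om j) <= K * H;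
  delta_gt0 : 0 < delta;
  delta_le : delta <= K * H;
  sub_overlap : forall x, Omega x ->
    (#|[set j | `[< Om j x >]]%SET| <= Nc)%N;
  theta_smooth : forall j, smooth (theta j);
  theta_ge0 : forall j x, closure Omega x -> 0 <= theta j x;
  theta_support : forall j x, (Omega `\` Om j) x -> theta j x = 0;
  theta_sum : forall x, closure Omega x -> \sum_j theta j x = 1;
  theta_grad : forall j x, Omega x -> enorm (grad (theta j) x) <= K * delta^-1;
  theta_hess : forall j x, Omega x ->
    frobenius (hess (theta j) x) <= K * delta ^- 2 }.

(* Main.v *)
Require Import Defs.
From HB Require Import structures.
From mathcomp Require Import all_boot all_order all_algebra.
From mathcomp Require Import all_classical all_reals all_analysis.
From mathcomp Require Import perm ring lra zify.

Set Implicit Arguments.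
Unset Strict Implicit.
Unset Printing Implicit Defensive.

Import Order.TTheory GRing.Theory Num.Theory.
Import numFieldNormedType.Exports.

Local Open Scope classical_set_scope.
Local Open Scope ring_scope.

(** The bound rests on the abstract theory of additive Schwarz operators. Write
    a for the global form, a_j for the local ones, and w_j for the local
    solutions, a_j(w_j, z) = a(u, z) on V_j. Then B_h A_h u is the sum of the w_j
    and a(B_h A_h u, u) is the sum of the a_j(w_j, w_j), so that the operator is
    self-adjoint for a and its extreme eigenvalues are attained values of a
    Rayleigh quotient (rayleigh, extreme_eigenvalues). They are bounded above and
    below (schwarz_le, schwarz_ge) by the constants of two inequalities:
    a of a sum of local functions u_j is at most c_1 times the sum of the
    a_j(u_j, u_j), and every u is a sum of local functions with the sum of the
    a_j(u_j, u_j) at most c_2 a(u, u), where c_2 is of the order of delta^-4.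

    All forms are compared with the mesh norm N(v) = sum over the cells of
    |T| (Lap v)^2 plus sum over the interior faces of the scaled squared normal
    jumps (mesh_norm2). By the divergence theorem the weak Laplacian differs from
    the elementwise one by means of jumps (weak_laplacian_lap), which gives the
    equivalence (broken_form_le, mesh_norm2_le), also for the local forms. The
    first inequality is then finite overlap: at a cell or a face at most N_c or
    2 N_c of the u_j are active (mesh_norm2_sum_le).

    For the second one, N controls |v|^2 + |grad v|^2 (norms_le): Green's formula
    tested with v, in which a trace inequality absorbs the jump terms, bounds the
    gradient (energy), and the divergence of x_0 v^2 yields a Poincare inequality
    (poincare).

    The splitting is u_j = interpolant of theta_j v. On a cell with polynomial q,
    let c be a point of Omega, m = v(c) and L the first order Taylor polynomial of
    theta_j at c. Then theta_j q = m L + theta_j(c) (q - m) + r. Quadratic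
    interpolation reproduces the first two terms. The remainder r is of the order
    h^2 (|v| delta^-2 + |grad v| delta^-1), and an inverse estimate turns it into
    |v| delta^-2 + |grad v| delta^-1 for the Laplacian and h times this for the
    gradient. The only other new term in the gradient is m grad theta_j(c); when
    the same c serves both cells of a face, it has no jump (local_error,
    cutoff_lap_le, cutoff_jump_le). Squaring and summing gives delta^-4
    (stable_decomposition).

    Integrals over cells and faces are handled in barycentric coordinates: the
    integrands are polynomials, whose means are given by the Dirichlet integral
    (ref_int_monomials), and the divergence theorem on a simplex is an identity
    between monomials (smean_divergence). *)

(** * Euclidean geometry and quadratic polynomials *)

Section Euclidean.
Context {R : realType} {d : nat}.
Implicit Types (x y z : 'rV[R]_d).

Lemma dot_sumr (I : Type) (r : seq I) (P : pred I) (F : I -> 'rV[R]_d) x :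
  dot x (\sum_(i <- r | P i) F i) = \sum_(i <- r | P i) dot x (F i).
Proof.
elim/big_rec2: _ => [|i u v _ <-]; last by rewrite dotDr.
by rewrite dotC dot0l.
Qed.

Lemma dot_suml (I : Type) (r : seq I) (P : pred I) (F : I -> 'rV[R]_d) x :
  dot (\sum_(i <- r | P i) F i) x = \sum_(i <- r | P i) dot (F i) x.
Proof. by rewrite dotC dot_sumr; apply: eq_bigr => i _; rewrite dotC. Qed.

Lemma dotNl x y : dot (- x) y = - dot x y.
Proof. by rewrite -scaleN1r dotZl mulN1r. Qed.

Lemma dotNr x y : dot x (- y) = - dot x y.
Proof. by rewrite dotC dotNl dotC. Qed.

Lemma dotBl x y z : dot (x - y) z = dot x z - dot y z.
Proof. by rewrite dotDl dotNl. Qed.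

Lemma dotBr x y z : dot x (y - z) = dot x y - dot x z.
Proof. by rewrite dotDr dotNr. Qed.

Lemma dot0r x : dot x 0 = 0.
Proof. by rewrite dotC dot0l. Qed.

Lemma dotxx_ge0 x : 0 <= dot x x.
Proof. by apply: sumr_ge0 => i _; rewrite -expr2 sqr_ge0. Qed.

Lemma dotxx_eq0 x : (dot x x == 0) = (x == 0).
Proof.
apply/idP/eqP => [|->]; last by rewrite dot0l.
rewrite psumr_eq0 => [/allP h|i _]; last by rewrite -expr2 sqr_ge0.
apply/rowP => i; have := h i; rewrite mem_index_enum => /(_ isT) /=.
by rewrite mulf_eq0 orbb mxE => /eqP.
Qed.

Lemma dot_eq_all x : (forall y, dot x y = 0) -> x = 0.
Proof. by move=> h; apply/eqP; rewrite -dotxx_eq0 h. Qed.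

Lemma dot_CS x y : dot x y ^+ 2 <= dot x x * dot y y.
Proof.
have [->|y0] := eqVneq y 0; first by rewrite dot0r dot0l mulr0 expr0n.
have yy : 0 < dot y y by rewrite lt_def dotxx_eq0 y0 dotxx_ge0.
have := dotxx_ge0 (dot y y *: x - dot x y *: y).
rewrite !(dotBl, dotBr, dotZl, dotZr) (dotC y x).
set a := dot x x; set b := dot x y; set c := dot y y => h.
have : 0 <= c * (a * c - b ^+ 2) by apply: le_trans h _; rewrite le_eqVlt; apply/orP; left; apply/eqP; ring.
by rewrite pmulr_rge0 // subr_ge0.
Qed.

Lemma enorm_ge0 x : 0 <= enorm x.
Proof. exact: sqrtr_ge0. Qed.

Lemma enorm_sqr x : enorm x ^+ 2 = dot x x.
Proof. by rewrite sqr_sqrtr ?dotxx_ge0. Qed.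

Lemma enorm_eq0 x : (enorm x == 0) = (x == 0).
Proof. by rewrite -dotxx_eq0 -enorm_sqr sqrf_eq0. Qed.

Lemma enorm0 : enorm (0 : 'rV[R]_d) = 0.
Proof. by apply/eqP; rewrite enorm_eq0. Qed.

Lemma enormN x : enorm (- x) = enorm x.
Proof. by rewrite /enorm dotNl dotNr opprK. Qed.

Lemma enormZ a x : enorm (a *: x) = `|a| * enorm x.
Proof. by rewrite /enorm dotZl dotZr mulrA -expr2 sqrtrM ?sqr_ge0// sqrtr_sqr. Qed.

Lemma dot_le x y : `|dot x y| <= enorm x * enorm y.
Proof.
rewrite -(@ler_pXn2r _ 2) ?nnegrE ?mulr_ge0 ?enorm_ge0// -normrX ger0_norm ?sqr_ge0//.
by rewrite exprMn !enorm_sqr dot_CS.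
Qed.

Lemma enormD x y : enorm (x + y) <= enorm x + enorm y.
Proof.
rewrite -(@ler_pXn2r _ 2) ?nnegrE ?addr_ge0 ?enorm_ge0// sqrrD !enorm_sqr.
rewrite !(dotDl, dotDr) (dotC y x).
by have := le_trans (ler_norm _) (dot_le x y); set u := _ * enorm y; lra.
Qed.

Lemma enorm_sum (I : Type) (r : seq I) (P : pred I) (F : I -> 'rV[R]_d) :
  enorm (\sum_(i <- r | P i) F i) <= \sum_(i <- r | P i) enorm (F i).
Proof.
elim/big_rec2: _ => [|i u v _ h]; first by rewrite enorm0.
by apply: le_trans (enormD _ _) _; rewrite lerD2l.
Qed.

End Euclidean.

Section SumInequalities.
Context {R : realType}.

(** Cauchy-Schwarz against the constant 1; the size of the index set is what
   finite overlap controls. *)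
Lemma sqr_sum_le (I : finType) (P : pred I) (F : I -> R) :
  (\sum_(i | P i) F i) ^+ 2 <= #|P|%:R * \sum_(i | P i) F i ^+ 2.
Proof.
have h : 0 <= \sum_(i | P i) \sum_(j | P j) (F i - F j) ^+ 2.
  by apply: sumr_ge0 => i _; apply: sumr_ge0 => j _; exact: sqr_ge0.
suff E : \sum_(i | P i) \sum_(j | P j) (F i - F j) ^+ 2 =
   2 * (#|P|%:R * \sum_(i | P i) F i ^+ 2 - (\sum_(i | P i) F i) ^+ 2).
  by move: h; rewrite E pmulr_rge0 // subr_ge0.
have E i : \sum_(j | P j) (F i - F j) ^+ 2 =
    #|P|%:R * F i ^+ 2 + \sum_(j | P j) F j ^+ 2 - 2 * (F i * \sum_(j | P j) F j).
  rewrite -[#|P|]/#|[eta P]| [#|_|%:R * _]mulr_natl -sumr_const !mulr_sumr.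
  rewrite -sumrN -!big_split /=; apply: eq_bigr => j _; ring.
under eq_bigr do rewrite E.
rewrite sumrB !big_split /= -!mulr_sumr -mulr_suml sumr_const -[_ *+ #|_|]mulr_natl.
ring.
Qed.

Lemma sqr_sum_le_nat (I : finType) (P : pred I) (F : I -> R) (n : nat) : (#|P| <= n)%N ->
  (\sum_(i | P i) F i) ^+ 2 <= n%:R * \sum_(i | P i) F i ^+ 2.
Proof.
move=> Pn; apply: le_trans (sqr_sum_le _ _) _.
by apply: ler_wpM2r; [apply: sumr_ge0 => i _; exact: sqr_ge0 | rewrite ler_nat].
Qed.

Lemma sqrD_le (a b : R) : (a + b) ^+ 2 <= 2 * a ^+ 2 + 2 * b ^+ 2.
Proof. have := sqr_ge0 (a - b); rewrite sqrrB sqrrD; lra. Qed.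

Lemma sqr_le_of_norm (a b : R) : `|a| <= b -> a ^+ 2 <= b ^+ 2.
Proof.
move=> ab; rewrite -real_normK ?num_real// ler_pXn2r ?nnegrE//.
exact: le_trans ab.
Qed.

End SumInequalities.

Section QuadraticCalculus.
Context {R : realType} {d : nat}.
Implicit Types (x y z : 'rV[R]_d) (q : 'rV[R]_d -> R).

(** The Hessian of a quadratic polynomial is constant, and the origin stands
    for any point. *)
Definition laplacian q : R := \tr (hess q 0).

Lemma grad_formula q (Q : 'M[R]_d) b c :
  (forall x, q x = dot (x *m Q) x + dot b x + c) ->
  forall x, grad q x = x *m (Q + Q^T) + b.
Proof.
move=> qE x; apply/rowP => i; rewrite mxE /partial.
have -> : q = (fun x => dot (x *m Q) x + dot b x + c) by apply/funext.
have [_ ->] := is_derive_quadratic Q b c x (delta_mx 0 i).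
by rewrite (dot_mulmxC _ (delta_mx _ _)) -!dotDl dot_delta mulmxDr.
Qed.

Lemma partial_formula q (Q : 'M[R]_d) b c :
  (forall x, q x = dot (x *m Q) x + dot b x + c) ->
  forall i x, partial i q x = dot x (\row_j (Q + Q^T) j i) + b 0 i.
Proof.
move=> qE i x; have := grad_formula qE x => /rowP/(_ i); rewrite !mxE => ->.
by congr (_ + _); rewrite /dot; apply: eq_bigr => j _; rewrite !mxE.
Qed.

Lemma hess_formula q (Q : 'M[R]_d) b c :
  (forall x, q x = dot (x *m Q) x + dot b x + c) ->
  forall x, hess q x = Q + Q^T.
Proof.
move=> qE x; apply/matrixP => i j; rewrite mxE.
have /grad_formula h : forall y, partial i q y =
    dot (y *m 0) y + dot (\row_j (Q + Q^T) j i) y + b 0 i.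
  by move=> y; rewrite (partial_formula qE) mulmx0 dot0l add0r dotC.
by have := h x => /rowP/(_ j); rewrite trmx0 addr0 mulmx0 add0r !mxE => ->; rewrite addrC.
Qed.

Lemma laplacian_formula q (Q : 'M[R]_d) b c :
  (forall x, q x = dot (x *m Q) x + dot b x + c) -> laplacian q = 2 * \tr Q.
Proof.
by move=> qE; rewrite /laplacian (hess_formula qE) mxtraceD mxtrace_tr mulr_natl mulr2n.
Qed.

Lemma grad_shift q x y : quadratic q -> grad q y = grad q x + (y - x) *m hess q 0.
Proof.
move=> [Q [b [c qE]]]; rewrite !(grad_formula qE) (hess_formula qE) mulmxBl.
by rewrite [RHS]addrC addrA subrK.
Qed.

(** The midpoint rule integrates the affine gradient of a quadratic exactly. *)
Lemma quadratic_midpoint q x y : quadratic q ->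
  q y - q x = dot (grad q (2^-1 *: (x + y))) (y - x).
Proof.
move=> [Q [b [c qE]]]; rewrite (grad_formula qE) !qE -scalemxAl dotDl dotZl.
rewrite mulmxDr !mulmxDl !(dotDl, dotDr, dotNr) !(dot_mulmxC Q^T) trmxK.
by field.
Qed.

Lemma quadratic_grad_comp q i : quadratic q -> affine (fun x => grad q x 0 i).
Proof.
move=> [Q [b [c qE]]]; exists (\row_j (Q + Q^T) j i), (b 0 i) => x.
by rewrite mxE (partial_formula qE) dotC.
Qed.

Lemma laplacian_lin a q q' : quadratic q -> quadratic q' ->
  laplacian (a *: q + q') = a * laplacian q + laplacian q'.
Proof.
move=> [Q [b [c qE]]] [Q' [b' [c' qE']]].
rewrite (laplacian_formula qE) (laplacian_formula qE').
rewrite (@laplacian_formula _ (a *: Q + Q') (a *: b + b') (a * c + c')).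
  by rewrite mxtraceD mxtraceZ; ring.
move=> x; rewrite !fctE qE qE' mulmxDr -scalemxAr !(dotDl, dotZl) /GRing.scale /=; ring.
Qed.

End QuadraticCalculus.

(** * Polynomial integrals over simplices *)

Section Dirichlet.
Context {R : realType}.
Local Notation mu := lebesgue_measure.

Lemma Rintegral_deriv (P : {poly R}) s : 0 <= s ->
  \int[mu]_(t in `[0, s]) (P^`()).[t] = P.[s] - P.[0].
Proof.
rewrite le_eqVlt => /predU1P[<-|s0].
  by rewrite set_itv1 Rintegral_set1 subrr.
rewrite /Rintegral (@continuous_FTC2 _ _ (horner P)) //.
- exact/continuous_subspaceT/continuous_horner.
- split.
  + by move=> x _; exact: derivable_horner.
  + exact/cvg_at_right_filter/continuous_horner.
  + exact/cvg_at_left_filter/continuous_horner.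
- by move=> x _; rewrite -derivE.
Qed.

Lemma factr_neq0 n : n`!%:R != 0 :> R.
Proof. by rewrite pnatr_eq0 -lt0n fact_gt0. Qed.

(** Euler's Beta integral, obtained by moving one power at a time from the
   second factor to the first by parts. *)
Lemma beta_primitive (s : R) a b : exists P : {poly R},
  [/\ P^`() = 'X^a * (s%:P - 'X) ^+ b, P.[0] = 0 &
    P.[s] = (a`! * b`!)%:R / (a + b).+1`!%:R * s ^+ (a + b).+1].
Proof.
elim: b a => [|b IH] a.
  exists (a.+1%:R^-1 *: 'X^(a.+1)); split.
  - by rewrite derivZ derivXn /= expr0 mulr1 -[X in _ *: X]scaler_nat scalerA mulVf ?scale1r//.
  - by rewrite !hornerE expr0n mulr0.
  - rewrite hornerZ hornerXn addn0 fact0 muln1 factS natrM; field.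
    by rewrite factr_neq0 nat1r pnatr_eq0.
have [P [dP P0 Ps]] := IH a.+1.
exists (a.+1%:R^-1 *: ('X^(a.+1) * (s%:P - 'X) ^+ b.+1 + b.+1%:R *: P)).
have a0 : a.+1%:R != 0 :> R by rewrite pnatr_eq0.
split.
- apply: (scalerI a0); rewrite derivZ scalerA mulfV// scale1r.
  rewrite derivD derivZ dP derivM derivXn deriv_exp derivB derivC derivX /=.
  by rewrite !scaler_nat exprS [X in _ = X *+ _]mulrC; ring.
- by rewrite !hornerE P0 expr0n /= !(mul0r, mulr0, addr0).
- rewrite !(hornerE, horner_exp) Ps subrr expr0n /= mulr0 add0r.
  have -> : (a.+1 + b).+1 = (a + b.+1).+1 by rewrite addSnnS.
  rewrite !factS !natrM; field.
  by rewrite factr_neq0 !nat1r -natrD nat1r !pnatr_eq0.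
Qed.

Lemma cons_row0 k (t : R) (y : 'rV[R]_k) :
  (row_mx (const_mx t : 'rV[R]_1) y) 0 (@ord0 k) = t.
Proof.
transitivity ((row_mx (const_mx t : 'rV[R]_1) y) 0 (lshift k ord0)).
  by congr (fun_of_matrix _ _ _); exact/val_inj.
by rewrite row_mxEl mxE.
Qed.

Lemma cons_rowS k (t : R) (y : 'rV[R]_k) i :
  (row_mx (const_mx t : 'rV[R]_1) y) 0 (lift (@ord0 k) i) = y 0 i.
Proof.
transitivity ((row_mx (const_mx t : 'rV[R]_1) y) 0 (rshift 1 i)).
  by congr (fun_of_matrix _ _ _); exact/val_inj.
by rewrite row_mxEr.
Qed.

(** The Dirichlet integral of prod_i l_i ^ a_i over the simplex of size s in
   R^k, where l_0 = s - sum_i t_i is the barycentric coordinate of the origin;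
   it is symmetric in all the exponents. *)
Lemma ref_int_monomials k (I : Type) (r : seq I) (c : I -> R) (a0 : I -> nat)
    (a : I -> 'I_k -> nat) (s : R) : 0 <= s ->
  ref_int s (fun t : 'rV[R]_k => \sum_(m <- r)
     c m * ((s - \sum_i t 0 i) ^+ a0 m * \prod_i t 0 i ^+ a m i)) =
  \sum_(m <- r) c m *
    (((a0 m)`! * \prod_i (a m i)`!)%:R / (a0 m + \sum_i a m i + k)`!%:R *
     s ^+ (a0 m + \sum_i a m i + k)).
Proof.
elim: k I r c a0 a s => [|k IH] I r c a0 a s s0 /=.
  apply: eq_bigr => m _; rewrite !big_ord0 !addn0 subr0 muln1 mulr1 divff ?factr_neq0 ?mul1r//.
pose a' m (i : 'I_k) := a m (lift ord0 i).
pose N m := (a0 m + \sum_i a' m i + k)%N.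
pose D m : R := ((a0 m)`! * \prod_i (a' m i)`!)%:R / (N m)`!%:R.
have [P PP] := choice (fun m => beta_primitive s (a m ord0) (N m)).
pose Q := \sum_(m <- r) (c m * D m) *: P m.
transitivity (\int[mu]_(t in `[0, s]) (Q^`()).[t]).
  apply: eq_Rintegral => t; rewrite inE /= in_itv /= => /andP[t0 ts].
  transitivity (ref_int (s - t) (fun y : 'rV[R]_k => \sum_(m <- r)
     (c m * t ^+ a m ord0) * ((s - t - \sum_i y 0 i) ^+ a0 m *
        \prod_i y 0 i ^+ a' m i))).
    congr ref_int; apply/funext => y; apply: eq_bigr => m _.
    rewrite !big_ord_recl cons_row0 (eq_bigr _ (fun i _ => cons_rowS t y i)).
    have -> : \prod_(i < k)
        (row_mx (const_mx t : 'rV[R]_1) y) 0 (lift (@ord0 k) i) ^+ a m (lift ord0 i) =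
        \prod_(i < k) y 0 i ^+ a' m i by apply: eq_bigr => i _; rewrite cons_rowS.
    by rewrite opprD addrA; ring.
  rewrite IH ?subr_ge0// /Q raddf_sum /= horner_sum; apply: eq_bigr => m _.
  have [dP _ _] := PP m.
  by rewrite derivZ dP !hornerE /= -/(N m) -/(D m); ring.
rewrite Rintegral_deriv // /Q !horner_sum -sumrB; apply: eq_bigr => m _.
have [_ P0 Ps] := PP m.
rewrite !hornerZ P0 Ps mulr0 subr0 !big_ord_recl /=.
have -> : (a0 m + (a m ord0 + \sum_(i < k) a m (lift ord0 i)) + k.+1)%N =
  (a m ord0 + N m).+1.
  by rewrite /N -/(\sum_i a' m i)%N; move: (\sum_i a' m i)%N => S; lia.
rewrite /D /a'; move: (a m ord0 + N m).+1 => M.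
rewrite !natrM; field.
by rewrite !factr_neq0.
Qed.

Lemma ref_int_ge0 k (s : R) (f : 'rV[R]_k -> R) : 0 <= s ->
  (forall t : 'rV[R]_k, (forall i, 0 <= t 0 i) -> \sum_i t 0 i <= s -> 0 <= f t) ->
  0 <= ref_int s f.
Proof.
elim: k s f => [|k IH] s f s0 f0 /=; first by apply: f0 => [[]//|]; rewrite big_ord0.
apply: Rintegral_ge0 => t; rewrite /= in_itv /= => /andP[t0 ts].
apply: IH => [|y y0 ys]; first by rewrite subr_ge0.
apply: f0 => [i|].
  by case: (unliftP ord0 i) => [j ->|->]; rewrite ?cons_rowS ?cons_row0.
rewrite big_ord_recl cons_row0 (eq_bigr _ (fun i _ => cons_rowS t y i)).
by rewrite -lerBrDl.
Qed.

Lemma eq_ref_int k (s : R) (f g : 'rV[R]_k -> R) : 0 <= s ->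
  (forall t : 'rV[R]_k, (forall i, 0 <= t 0 i) -> \sum_i t 0 i <= s -> f t = g t) ->
  ref_int s f = ref_int s g.
Proof.
elim: k s f g => [|k IH] s f g s0 fg /=; first by apply: fg => [[]//|]; rewrite big_ord0.
apply: eq_Rintegral => t; rewrite inE /= in_itv /= => /andP[t0 ts].
apply: IH => [|y y0 ys]; first by rewrite subr_ge0.
apply: fg => [i|].
  by case: (unliftP ord0 i) => [j ->|->]; rewrite ?cons_rowS ?cons_row0.
rewrite big_ord_recl cons_row0 (eq_bigr _ (fun i _ => cons_rowS t y i)).
by rewrite -lerBrDl.
Qed.

End Dirichlet.

(** * Means over simplices in barycentric coordinates *)

Section SimplexMean.
Context {R : realType} {n : nat}.
Implicit Types (A T : {set 'I_n}) (l : 'I_n -> R) (F G : ('I_n -> R) -> R).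

Definition in_simplex A l : Prop :=
  [/\ forall i, 0 <= l i, forall i, i \notin A -> l i = 0 & \sum_i l i = 1].

(** The barycentric coordinates with respect to the vertices of A of the point
   with parameter t of the reference simplex; the first vertex is the origin. *)
Definition scatter A k (t : 'rV[R]_k) : 'I_n -> R := fun i =>
  if i \in A then
    nth 0 ((1 - \sum_j t 0 j) :: [seq t 0 j | j <- enum 'I_k]) (index i (enum A))
  else 0.

(** The mean value, over the simplex with vertex set A, of a function of the
    barycentric coordinates: the reference simplex of dimension k has volume
    1 / k!. The coordinates outside A vanish, so that a function keeps the
    same arguments on a cell and on its faces. *)
Definition smean A F : R :=
  (#|A|.-1)`!%:R * ref_int 1 (fun t : 'rV[R]_(#|A|.-1) => F (scatter A t)).

Lemma big_enum_recl (V : Type) (idx : V) (op : Monoid.com_law idx) A k (x0 : 'I_n)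
    (G : 'I_n -> V) : #|A| = k.+1 ->
  \big[op/idx]_(i in A) G i = op (G (nth x0 (enum A) 0))
    (\big[op/idx]_(j < k) G (nth x0 (enum A) j.+1)).
Proof.
move=> Ak; rewrite -big_enum /= (big_nth x0) -cardE Ak big_mkord.
by rewrite big_ord_recl; congr (op _ _); apply: eq_bigr => j _; rewrite lift0.
Qed.

Lemma scatter0 A k (t : 'rV[R]_k) x0 : #|A| = k.+1 ->
  scatter A t (nth x0 (enum A) 0) = 1 - \sum_j t 0 j.
Proof.
move=> Ak; have sA : (0 < size (enum A))%N by rewrite -cardE Ak.
by rewrite /scatter -mem_enum mem_nth// index_uniq ?enum_uniq.
Qed.

Lemma scatterS A k (t : 'rV[R]_k) x0 (j : 'I_k) : #|A| = k.+1 ->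
  scatter A t (nth x0 (enum A) j.+1) = t 0 j.
Proof.
move=> Ak; have sA : (j.+1 < size (enum A))%N by rewrite -cardE Ak ltnS.
rewrite /scatter -mem_enum mem_nth// index_uniq ?enum_uniq//=.
by rewrite (nth_map j) ?size_enum_ord// nth_ord_enum.
Qed.

Lemma scatter_elim A k (t : 'rV[R]_k) (P : R -> Prop) : #|A| = k.+1 ->
  P (1 - \sum_j t 0 j) -> (forall j, P (t 0 j)) ->
  forall i, i \in A -> P (scatter A t i).
Proof.
move=> Ak P0 PS i iA.
have : (index i (enum A) < k.+1)%N by rewrite -Ak cardE index_mem mem_enum.
have -> : scatter A t i = scatter A t (nth i (enum A) (index i (enum A))).
  by rewrite nth_index ?mem_enum.
case: index => [|j] jk; first by rewrite scatter0.
by rewrite (scatterS _ _ (Ordinal (jk : (j < k)%N))).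
Qed.

Lemma scatter_in_simplex A (t : 'rV[R]_(#|A|.-1)) : A != finset.set0 ->
  (forall i, 0 <= t 0 i) -> \sum_i t 0 i <= 1 -> in_simplex A (scatter A t).
Proof.
move=> /[dup] /set0Pn[x0 x0A]; rewrite -card_gt0 => /prednK/esym Ak t0 t1.
have out i : i \notin A -> scatter A t i = 0 by rewrite /scatter => /negbTE ->.
split=> // [i|].
  have [iA|/out -> //] := boolP (i \in A).
  by apply: (scatter_elim (P := fun x => 0 <= x) Ak) => //; rewrite subr_ge0.
rewrite (bigID (mem A)) /= [X in _ + X]big1 ?addr0 => [|i /out //].
rewrite (big_enum_recl _ x0 _ Ak) scatter0//=.
by rewrite (eq_bigr _ (fun j _ => scatterS t x0 j Ak)) subrK.
Qed.

Lemma eq_smean A F G : A != finset.set0 ->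
  (forall l, in_simplex A l -> F l = G l) -> smean A F = smean A G.
Proof.
move=> A0 FG; congr (_ * _); apply: eq_ref_int => // t t0 t1.
by apply: FG; exact: scatter_in_simplex.
Qed.

Lemma smean_ge0 A F : A != finset.set0 ->
  (forall l, in_simplex A l -> 0 <= F l) -> 0 <= smean A F.
Proof.
move=> A0 F0; apply: mulr_ge0; rewrite ?ler0n//; apply: ref_int_ge0 => // t t0 t1.
by apply: F0; exact: scatter_in_simplex.
Qed.

(** The mean of the monomial of exponents a, which vanishes on the simplex as
    soon as it involves a vertex outside A. *)
Definition dirichlet A (a : 'I_n -> nat) : R :=
  if [forall i, (i \in A) || (a i == 0)%N] then
    ((#|A|.-1)`! * \prod_i (a i)`!)%:R / (\sum_i a i + #|A|.-1)`!%:R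
  else 0.

Lemma smean_monomials A (I : Type) (r : seq I) (c : I -> R) (a : I -> 'I_n -> nat) :
  A != finset.set0 ->
  smean A (fun l => \sum_(m <- r) c m * \prod_i l i ^+ a m i) =
  \sum_(m <- r) c m * dirichlet A (a m).
Proof.
move=> /[dup] A0 /set0Pn[x0 x0A]; move: A0; rewrite -card_gt0 => /prednK/esym Ak.
set k := #|A|.-1 in Ak.
pose ok m := [forall i, (i \in A) || (a m i == 0)%N].
pose e i := nth x0 (enum A) i.
rewrite /smean -/k.
transitivity (k`!%:R * ref_int 1 (fun t : 'rV[R]_k => \sum_(m <- r)
    (c m * (ok m)%:R) * ((1 - \sum_i t 0 i) ^+ a m (e 0%N) *
      \prod_(i < k) t 0 i ^+ a m (e i.+1)))).
  congr (_ * ref_int _ _); apply/funext => t; apply: eq_bigr => m _.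
  rewrite -mulrA; congr (_ * _); rewrite (bigID (mem A)) /=.
  case okm: (ok m); last first.
    move/negbT: okm; rewrite negb_forall => /existsP[i].
    rewrite negb_or -lt0n => /andP[iA ai].
    rewrite [X in _ * X](bigD1 i) //= /scatter (negbTE iA) expr0n.
    by rewrite gtn_eqF// mul0r mulr0 mul0r.
  rewrite mul1r [X in _ * X]big1 ?mulr1 => [|i iA]; last first.
    by have /forallP/(_ i) := okm; rewrite (negbTE iA) /= => /eqP ->.
  rewrite (big_enum_recl _ x0 _ Ak) scatter0//=; congr (_ * _).
  by apply: eq_bigr => j _; rewrite scatterS.
rewrite ref_int_monomials // mulr_sumr; apply: eq_bigr => m _.
rewrite /dirichlet -/(ok m); case okm: (ok m); last by rewrite !(mulr0, mul0r).
have out i : i \notin A -> a m i = 0%N.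
  by have /forallP/(_ i) := okm; case: (i \in A) => //= /eqP.
have -> : (\prod_i (a m i)`! = (a m (e 0))`! * \prod_(i < k) (a m (e i.+1))`!)%N.
  rewrite (bigID (mem A)) /= [X in (_ * X)%N]big1 ?muln1 => [|i /out -> //].
  by rewrite (big_enum_recl _ x0 _ Ak).
have -> : (\sum_i a m i = a m (e 0) + \sum_(i < k) a m (e i.+1))%N.
  rewrite (bigID (mem A)) /= [X in (_ + X)%N]big1 ?addn0 => [|i /out -> //].
  by rewrite (big_enum_recl _ x0 _ Ak).
by rewrite expr1n mulr1 mulr1 -/k [in RHS]natrM; ring.
Qed.

Definition dmono (a : 'I_n -> nat) k l : R :=
  (a k)%:R * l k ^+ (a k).-1 * \prod_(i | i != k) l i ^+ a i.

(** The integration formulas hold monomial by monomial, so that the monomials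
    are kept as data. *)
Definition polyf F : Prop := exists r : seq (R * ('I_n -> nat)),
  forall l, F l = \sum_(m <- r) m.1 * \prod_i l i ^+ m.2 i.

(** The derivatives are formal: the n coordinates count as independent
    variables, although they add up to 1 on a simplex. *)
Definition pder F (dF : 'I_n -> ('I_n -> R) -> R) : Prop :=
  exists r : seq (R * ('I_n -> nat)),
    (forall l, F l = \sum_(m <- r) m.1 * \prod_i l i ^+ m.2 i) /\
    (forall k l, dF k l = \sum_(m <- r) m.1 * dmono m.2 k l).

Lemma pder_polyf F dF : pder F dF -> polyf F.
Proof. by move=> [r [FE _]]; exists r. Qed.

Lemma eq_pder F dF G dG : F =1 G -> (forall k, dF k =1 dG k) -> pder F dF -> pder G dG.
Proof.
move=> FG dFG [r [FE dFE]]; exists r; split=> [l|k l]; first by rewrite -FG.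
by rewrite -dFG.
Qed.

Lemma dmono_monomial a k l :
  dmono a k l = (a k)%:R * \prod_i l i ^+ (a i - (i == k)).
Proof.
rewrite /dmono -mulrA [in RHS](bigD1 k)//= eqxx subn1; congr (_ * (_ * _)).
by apply: eq_bigr => i /negbTE ->; rewrite subn0.
Qed.

Lemma pder_polyf_der F dF k : pder F dF -> polyf (dF k).
Proof.
move=> [r [_ dFE]].
exists [seq (m.1 * (m.2 k)%:R, fun i => (m.2 i - (i == k))%N) | m <- r] => l.
rewrite dFE big_map; apply: eq_bigr => m _ /=.
by rewrite dmono_monomial mulrA.
Qed.

Lemma pder_cst c : pder (fun=> c) (fun=> fun=> 0).
Proof.
exists [:: (c, fun=> 0%N)]; split=> [l|k l]; rewrite big_seq1 /=.
  by rewrite big1 ?mulr1.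
by rewrite /dmono !mul0r mulr0.
Qed.

Lemma pder_coord j : pder (fun l => l j) (fun k => fun=> (k == j)%:R).
Proof.
exists [:: (1, fun i => (i == j) : nat)]; split=> [l|k l]; rewrite big_seq1 /= mul1r.
  by rewrite (bigD1 j)//= eqxx expr1 big1 ?mulr1// => i /negbTE ->.
rewrite /dmono; case: (eqVneq k j) => [->|kj]; last by rewrite !mul0r.
by rewrite expr0 !mul1r big1// => i /negbTE ->.
Qed.

Lemma pderD F dF G dG : pder F dF -> pder G dG ->
  pder (fun l => F l + G l) (fun k l => dF k l + dG k l).
Proof.
move=> [r [FE dFE]] [r' [GE dGE]]; exists (r ++ r'); split=> [l|k l].
  by rewrite big_cat /= FE GE.
by rewrite big_cat /= dFE dGE.
Qed.

Lemma dmonoM a b k l : dmono (fun i => a i + b i)%N k l =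
  dmono a k l * \prod_i l i ^+ b i + \prod_i l i ^+ a i * dmono b k l.
Proof.
rewrite /dmono !(bigD1 k (P := xpredT))//=.
under eq_bigr do rewrite exprD.
rewrite big_split /=; set A := \prod_(_ | _) _; set B := \prod_(_ | _) _.
have H (m p : nat) : (m + p)%:R * l k ^+ (m + p).-1 =
   m%:R * l k ^+ m.-1 * l k ^+ p + l k ^+ m * (p%:R * l k ^+ p.-1).
  case: m p => [|m] [|p] /=; rewrite ?(mul0r, mulr0, addr0, add0r, mulr1, mul1r)//.
  - by rewrite !addn0.
  - by rewrite natrD exprD !exprS; ring.
rewrite H; ring.
Qed.

Lemma pderM F dF G dG : pder F dF -> pder G dG ->
  pder (fun l => F l * G l) (fun k l => dF k l * G l + F l * dG k l).
Proof.
move=> [r [FE dFE]] [r' [GE dGE]].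
exists [seq (m.1 * p.1, fun i => (m.2 i + p.2 i)%N) | m <- r, p <- r'].
split=> [l|k l]; rewrite big_allpairs_dep /=.
  rewrite FE GE mulr_suml; apply: eq_bigr => m _; rewrite mulr_sumr.
  apply: eq_bigr => p _.
  have -> : \prod_i l i ^+ (m.2 i + p.2 i) =
      (\prod_i l i ^+ m.2 i) * \prod_i l i ^+ p.2 i.
    by rewrite -big_split; apply: eq_bigr => i _; rewrite exprD.
  ring.
rewrite dFE dGE FE GE !mulr_suml -big_split /=; apply: eq_bigr => m _.
rewrite !mulr_sumr -big_split /=; apply: eq_bigr => p _.
by rewrite dmonoM; ring.
Qed.

Lemma pderZ c F dF : pder F dF -> pder (fun l => c * F l) (fun k l => c * dF k l).
Proof.
move=> pF; apply: eq_pder (pderM (pder_cst c) pF) => // k l.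
by rewrite mul0r add0r.
Qed.

Lemma pder_sum (I : Type) (s : seq I) (F : I -> ('I_n -> R) -> R) dF :
  (forall i, pder (F i) (dF i)) ->
  pder (fun l => \sum_(i <- s) F i l) (fun k l => \sum_(i <- s) dF i k l).
Proof.
move=> pF; elim: s => [|i s IH].
  by apply: eq_pder (pder_cst 0) => [l|k l]; rewrite big_nil.
by apply: eq_pder (pderD (pF i) IH) => [l|k l]; rewrite big_cons.
Qed.

Lemma polyf_pder F : polyf F -> exists dF, pder F dF.
Proof. by move=> [r FE]; exists (fun k l => \sum_(m <- r) m.1 * dmono m.2 k l), r. Qed.

Lemma polyf_cst c : polyf (fun=> c).
Proof. exact: pder_polyf (pder_cst c). Qed.

Lemma polyfD F G : polyf F -> polyf G -> polyf (fun l => F l + G l).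
Proof. by move=> /polyf_pder[? p] /polyf_pder[? q]; exact: pder_polyf (pderD p q). Qed.

Lemma polyfM F G : polyf F -> polyf G -> polyf (fun l => F l * G l).
Proof. by move=> /polyf_pder[? p] /polyf_pder[? q]; exact: pder_polyf (pderM p q). Qed.

Lemma polyfZ c F : polyf F -> polyf (fun l => c * F l).
Proof. exact/polyfM/polyf_cst. Qed.

Lemma polyfX F m : polyf F -> polyf (fun l => F l ^+ m).
Proof.
move=> pF; elim: m => [|m IH]; first by under eq_fun do rewrite expr0; exact: polyf_cst.
by under eq_fun do rewrite exprS; exact: polyfM.
Qed.

Lemma polyf_sum (I : Type) (s : seq I) (F : I -> ('I_n -> R) -> R) :
  (forall i, polyf (F i)) -> polyf (fun l => \sum_(i <- s) F i l).
Proof.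
move=> pF; elim: s => [|i s IH].
  by under eq_fun do rewrite big_nil; exact: polyf_cst.
by under eq_fun do rewrite big_cons; exact: polyfD.
Qed.

Lemma smean_lin A c F G : A != finset.set0 -> polyf F -> polyf G ->
  smean A (fun l => c * F l + G l) = c * smean A F + smean A G.
Proof.
move=> A0 [r FE] [s GE].
have -> : F = (fun l => \sum_(m <- r) m.1 * \prod_i l i ^+ m.2 i) by exact/funext.
have -> : G = (fun l => \sum_(m <- s) m.1 * \prod_i l i ^+ m.2 i) by exact/funext.
rewrite !smean_monomials//.
rewrite mulr_sumr; under [X in X + _]eq_bigr do rewrite mulrA.
transitivity (smean A (fun l => \sum_(m <- [seq (c * m.1, m.2) | m <- r] ++ s)
    m.1 * \prod_i l i ^+ m.2 i)).
  congr smean; apply/funext => l; rewrite big_cat big_map /= mulr_sumr.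
  by congr (_ + _); apply: eq_bigr => m _; rewrite mulrA.
by rewrite smean_monomials// big_cat big_map.
Qed.

Lemma smean_cst A c : A != finset.set0 -> smean A (fun=> c) = c.
Proof.
move=> A0; have -> : (fun=> c) = (fun l : 'I_n -> R => \sum_(m <- [:: tt])
    c * \prod_i l i ^+ (fun=> fun=> 0%N) m i).
  by apply/funext => l; rewrite big_seq1 big1 ?mulr1.
rewrite smean_monomials// big_seq1 /dirichlet.
have -> : [forall i : 'I_n, (i \in A) || (0 == 0)%N] by apply/forallP => i; rewrite orbT.
by rewrite big1// big1 ?muln1// divff ?mulr1 ?factr_neq0.
Qed.

Lemma smeanZ A c F : A != finset.set0 -> polyf F ->
  smean A (fun l => c * F l) = c * smean A F.
Proof.
move=> A0 pF; have := smean_lin c A0 pF (polyf_cst 0).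
by under eq_fun do rewrite addr0; rewrite smean_cst// addr0.
Qed.

Lemma smeanD A F G : A != finset.set0 -> polyf F -> polyf G ->
  smean A (fun l => F l + G l) = smean A F + smean A G.
Proof.
move=> A0 pF pG; have := smean_lin 1 A0 pF pG; rewrite mul1r => <-.
by under [in RHS]eq_fun do rewrite mul1r.
Qed.

Lemma smean_sum A (I : Type) (s : seq I) (F : I -> ('I_n -> R) -> R) :
  A != finset.set0 -> (forall i, polyf (F i)) ->
  smean A (fun l => \sum_(i <- s) F i l) = \sum_(i <- s) smean A (F i).
Proof.
move=> A0 pF; elim: s => [|i s IH].
  by under eq_fun do rewrite big_nil; rewrite smean_cst// big_nil.
under eq_fun do rewrite big_cons.
by rewrite smeanD// ?IH ?big_cons//; exact: polyf_sum.
Qed.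

Lemma ler_smean A F G : A != finset.set0 -> polyf F -> polyf G ->
  (forall l, in_simplex A l -> F l <= G l) -> smean A F <= smean A G.
Proof.
move=> A0 pF pG FG; rewrite -subr_ge0 -mulN1r addrC -smean_lin//.
by apply: smean_ge0 => // l lA; rewrite mulN1r addrC subr_ge0; exact: FG.
Qed.

(** Jensen's inequality for the square, from the mean of (F - mean F)^2. *)
Lemma sqr_smean_le A F : A != finset.set0 -> polyf F ->
  smean A F ^+ 2 <= smean A (fun l => F l ^+ 2).
Proof.
move=> A0 pF; set m := smean A F.
have : 0 <= smean A (fun l => (F l - m) ^+ 2) by apply: smean_ge0 => // l _; exact: sqr_ge0.
have -> : (fun l => (F l - m) ^+ 2) = (fun l => (- 2 * m) * F l + (F l ^+ 2 + m ^+ 2)).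
  by apply/funext => l; ring.
have pF2 := polyfX 2 pF.
rewrite smean_lin ?smeanD ?smean_cst -/m//; try exact: polyf_cst; last first.
  by apply: polyfD => //; exact: polyf_cst.
by move: (smean A (fun l => F l ^+ 2)) => S h; lra.
Qed.

(** The divergence theorem. On a monomial of exponents a, the derivative in the
   direction of coordinate k and the restriction to the face opposite to
   vertex k contribute the same multiple of u_k, respectively when a_k > 0 and
   when a_k = 0; the sum over k then vanishes because the u_k, the derivatives
   of the barycentric coordinates in one direction, add up to 0. *)
Lemma smean_divergence T F dF (u : 'I_n -> R) d : #|T| = d.+1 -> (0 < d)%N ->
  pder F dF -> (forall i, i \notin T -> u i = 0) -> \sum_i u i = 0 ->
  smean T (fun l => \sum_i u i * dF i l) =
  - d%:R * \sum_(k in T) u k * smean (T :\ k)%SET F.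
Proof.
move=> Td d0 [r [FE dFE]] uT u0.
have T0 : T != finset.set0 by rewrite -card_gt0 Td.
have Tk k : k \in T -> #|(T :\ k)%SET| = d.
  by move=> kT; move: Td; rewrite (cardsD1 k) kT add1n => -[].
have Tk0 k : k \in T -> (T :\ k)%SET != finset.set0.
  by move=> kT; rewrite -card_gt0 Tk.
have -> : F = (fun l => \sum_(m <- r) m.1 * \prod_i l i ^+ m.2 i) by exact/funext.
transitivity (\sum_i u i * \sum_(m <- r) m.1 * ((m.2 i)%:R *
    dirichlet T (fun j => m.2 j - (j == i))%N)).
  rewrite smean_sum// => [|i]; last first.
    by apply: polyfZ; apply: (@pder_polyf_der F); exists r; split.
  apply: eq_bigr => i _; rewrite smeanZ//; last first.
    by apply: (@pder_polyf_der F); exists r; split.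
  congr (_ * _).
  transitivity (smean T (fun l => \sum_(m <- r) (m.1 * (m.2 i)%:R) *
      \prod_j l j ^+ (m.2 j - (j == i)))).
    congr smean; apply/funext => l; rewrite dFE; apply: eq_bigr => m _.
    by rewrite dmono_monomial mulrA.
  by rewrite smean_monomials//; apply: eq_bigr => m _; rewrite mulrA.
have -> : \sum_(k in T) u k * smean (T :\ k)%SET
      (fun l => \sum_(m <- r) m.1 * \prod_i l i ^+ m.2 i) =
    \sum_(k in T) u k * \sum_(m <- r) m.1 * dirichlet (T :\ k)%SET m.2.
  by apply: eq_bigr => k kT; rewrite smean_monomials ?Tk0.
under eq_bigr do rewrite mulr_sumr.
rewrite exchange_big /=.
under [in RHS]eq_bigr do rewrite mulr_sumr.
rewrite [in RHS]exchange_big /= mulr_sumr; apply: eq_bigr => m _.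
set a := m.2.
under eq_bigr do rewrite mulrCA.
under [in RHS]eq_bigr do rewrite mulrCA.
rewrite -!mulr_sumr mulrCA; congr (_ * _).
have [ok|] := boolP [forall i, (i \in T) || (a i == 0)%N]; last first.
  rewrite negb_forall => /existsP[j]; rewrite negb_or => /andP[jT aj].
  rewrite big1 => [|i _]; last first.
    have [iT|/uT ->] := boolP (i \in T); last by rewrite mul0r.
    rewrite /dirichlet ifF ?mulr0//; apply/negP => /forallP/(_ j).
    have ji : j != i by apply: contraNneq jT => ->.
    by rewrite (negbTE jT) (negbTE ji) subn0 (negbTE aj).
  rewrite big1 ?mulr0// => k kT.
  rewrite /dirichlet ifF ?mulr0//; apply/negP => /forallP/(_ j).
  by rewrite !inE (negbTE jT) andbF (negbTE aj).
have aT i : i \notin T -> a i = 0%N.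
  by have /forallP/(_ i) := ok; case: (i \in T) => //= /eqP.
pose S := (\sum_i a i)%N; pose P := (\prod_i (a i)`!)%N.
pose Q : R := (d`! * P)%:R / (S + d.-1)`!%:R.
have h1 k : u k * ((a k)%:R * dirichlet T (fun j => a j - (j == k))%N) =
    u k * ((0 < a k)%N%:R * Q).
  have [ak|ak] := posnP (a k); first by rewrite ak !mul0r.
  rewrite mul1r /dirichlet ifT; last first.
    apply/forallP => i; have /forallP/(_ i) := ok.
    by case: (i \in T) => //= /eqP ->.
  have -> : (\sum_i (a i - (i == k)) = S.-1)%N.
    rewrite /S [in RHS](bigD1 k)//= [in LHS](bigD1 k)//= eqxx subn1.
    rewrite (eq_bigr a) => [|i /negbTE ->]; last by rewrite subn0.
    by case: (a k) ak.
  have -> : (\prod_i (a i - (i == k))`! = (a k).-1`! * \prod_(i | i != k) (a i)`!)%N.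
    rewrite (bigD1 k)//= eqxx subn1; congr (_ * _)%N.
    by apply: eq_bigr => i /negbTE ->; rewrite subn0.
  have S0 : (0 < S)%N by rewrite /S (bigD1 k)//= addn_gt0 ak.
  have -> : (S.-1 + #|T|.-1 = S + d.-1)%N by rewrite Td /=; lia.
  have PE : P = (a k * ((a k).-1`! * \prod_(i | i != k) (a i)`!))%N.
    by rewrite /P (bigD1 k)//= -{1}(prednK ak) factS prednK// mulnA.
  by rewrite Td /= /Q PE !natrM; ring.
have h2 k : k \in T -> u k * dirichlet (T :\ k)%SET a =
    u k * ((a k == 0)%N%:R * (d%:R^-1 * Q)).
  move=> kT; rewrite /dirichlet Tk//; case: (eqVneq (a k) 0%N) => ak; last first.
    rewrite ifF ?mul0r//; apply/negP => /forallP/(_ k).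
    by rewrite !inE eqxx (negbTE ak).
  rewrite ifT; last first.
    apply/forallP => i; rewrite !inE; have /forallP/(_ i) := ok.
    by case: (eqVneq i k) => [->|_] //=; rewrite ak orbT.
  have dE : d`! = (d * (d.-1)`!)%N by rewrite -{1}(prednK d0) factS prednK.
  rewrite mul1r -/S -/P /Q dE !natrM.
  by congr (_ * _); field; rewrite factr_neq0 pnatr_eq0 -lt0n.
rewrite (eq_bigr _ (fun k _ => h1 k)) (eq_bigr _ h2).
rewrite [in LHS](bigID (mem T)) /= [X in _ + X]big1 ?addr0 => [|i /uT ->]; last by rewrite mul0r.
rewrite mulr_sumr; apply/eqP; rewrite -subr_eq0 -sumrB; apply/eqP.
transitivity (\sum_(k in T) u k * Q).
  apply: eq_bigr => k kT; have dn0 : d%:R != 0 :> R by rewrite pnatr_eq0 -lt0n.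
  by rewrite lt0n; case: (a k == 0)%N; rewrite /= ?(mul0r, mul1r); field.
rewrite -mulr_suml; suff -> : \sum_(k in T) u k = 0 by rewrite mul0r.
by move: u0; rewrite (bigID (mem T)) /= [X in _ + X]big1 ?addr0// => i /uT.
Qed.

End SimplexMean.

(** * Barycentric coordinates and the measure of simplices *)

Section FaceGram.
Context {R : realType} {d' : nat}.
Local Notation d := d'.+1.
Implicit Types (P : 'I_d.+1 -> 'rV[R]_d).

Definition vertex_mx P : 'M[R]_(1 + d) :=
  \matrix_(j < 1 + d) row_mx (1%:M : 'rV[R]_1) (P j).

Definition edges P : 'M[R]_d := \matrix_(i < d) (P (lift ord0 i) - P ord0).

Definition face_edges P (k : 'I_d.+1) : 'M[R]_(d', d) :=
  \matrix_(i < d') (P (lift k (lift (@ord0 d') i)) - P (lift k (@ord0 d'))).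

Lemma rshift1_lift m (i : 'I_m) : rshift 1 i = lift (@ord0 m) i.
Proof. exact/val_inj. Qed.

Lemma lshift1_ord0 m (i : 'I_1) : lshift m i = @ord0 m.
Proof. by rewrite ord1; exact/val_inj. Qed.

(** Subtracting the first row from the others leaves the edges. *)
Lemma det_vertex_mx P : \det (vertex_mx P) = \det (edges P).
Proof.
have -> : vertex_mx P = (block_mx 1%:M 0 (const_mx 1) 1%:M : 'M[R]_(1 + d)) *m
    (block_mx 1%:M (P ord0) 0 (edges P) : 'M[R]_(1 + d)).
  rewrite mulmx_block !mul1mx !mul0mx !addr0 mulmx1.
  apply/row_matrixP => j; rewrite rowK /block_mx.
  case: (split_ordP j) => i ->.
    by rewrite rowKu row_row_mx ord1 lshift1_ord0 !row_id.
  rewrite rowKd row_row_mx linearD /= rowK rshift1_lift.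
  congr row_mx; first by apply/rowP => l; rewrite !mxE ord1 eqxx.
  apply/rowP => l; rewrite !mxE big_ord1 mxE mul1r.
  by rewrite addrC subrK.
by rewrite det_mulmx det_lblock det_ublock !det1 !mul1r.
Qed.

(** Moving vertex k to the front changes the determinant by a sign only, since
   the bordered matrix of the vertices has its rows permuted. *)
Lemma det_edges_from P (k : 'I_d.+1) :
  \det (\matrix_(i < d) (P (lift k i) - P k)) ^+ 2 = \det (edges P) ^+ 2.
Proof.
pose s : {perm 'I_d.+1} := lift_perm ord0 k 1.
have -> : \matrix_(i < d) (P (lift k i) - P k) = edges (P \o s).
  by apply/matrixP => i j; rewrite !mxE /= lift_perm_id lift_perm_lift perm1.
rewrite -!det_vertex_mx.
have -> : vertex_mx (P \o s) = row_perm s (vertex_mx P).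
  by apply/row_matrixP => j; rewrite rowK; apply/rowP => l; rewrite !mxE.
by rewrite row_permE det_mulmx det_perm exprMn sqrr_sign mul1r.
Qed.

(** The altitude formula: the Gram determinant of the face opposite to vertex k
   is that of the simplex times the square of the gradient g of the barycentric
   coordinate of k. With q the edge from the face to vertex k and F the edges of
   the face, F g^T = 0 and q g^T = 1, so the product of (q, F) with the transpose
   of (g, F) is block triangular, while g = |g|^2 q modulo the rows of F. *)
Lemma det_face_gram P (k : 'I_d.+1) (g : 'rV[R]_d) : \det (edges P) != 0 ->
  (forall i, dot g (P (lift k i) - P k) = - 1) ->
  \det (face_edges P k *m (face_edges P k)^T) = dot g g * \det (edges P) ^+ 2.
Proof.
move=> E0 gP; set F := face_edges P k.
pose q : 'rV[R]_d := P k - P (lift k (@ord0 d')).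
pose W : 'M[R]_(1 + d') := col_mx q F.
pose Z : 'M[R]_(1 + d') := col_mx g F.
have dotE (x y : 'rV[R]_d) : x *m y^T = (dot x y)%:M.
  rewrite [LHS]mx11_scalar /dot mxE; congr (_%:M).
  by apply: eq_bigr => l _; rewrite mxE.
have qg : q *m g^T = 1%:M.
  by rewrite dotE /q dotC -opprB dotNr gP opprK.
have Fg : F *m g^T = 0.
  apply/colP => i; rewrite !mxE.
  transitivity (dot (row i F) g); first by apply: eq_bigr => l _; rewrite !mxE.
  rewrite rowK dotC.
  rewrite -[P (lift k (lift ord0 i))](subrK (P k)) -addrA dotDr gP.
  by rewrite -opprB dotNr gP subrr.
have gF : g *m F^T = 0 by rewrite -[LHS]trmxK trmx_mul trmxK Fg trmx0.
have detW : \det W ^+ 2 = \det (edges P) ^+ 2.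
  rewrite -(det_edges_from P k).
  pose Q1 : 'M[R]_(d', d) := \matrix_(i < d') (P (lift k (lift ord0 i)) - P k).
  have -> : W = (block_mx (- 1) 0 (- const_mx 1) 1%:M : 'M[R]_(1 + d')) *m
      (\matrix_(i < d) (P (lift k i) - P k) : 'M[R]_(1 + d')).
    have -> : (\matrix_(i < d) (P (lift k i) - P k) : 'M[R]_(1 + d')) = col_mx (- q) Q1.
      apply/row_matrixP => j; case: (split_ordP j) => i ->.
        by rewrite rowKu row_id rowK lshift1_ord0 opprB.
      by rewrite rowKd !rowK rshift1_lift.
    rewrite mul_block_col mulNmx mul1mx opprK mul0mx addr0 mul1mx /W; congr col_mx.
    apply/matrixP => i j; rewrite !mxE big_ord1 !mxE.
    ring.
  rewrite det_mulmx det_lblock det1 mulr1 exprMn.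
  by rewrite det_mx11 !mxE eqxx mulr1n sqrrN expr1n mul1r.
have W0 : W \in unitmx.
  by rewrite unitmxE unitfE -sqrf_eq0 detW sqrf_eq0.
have DWZ : \det (F *m F^T) = \det W * \det Z.
  rewrite -(det_tr Z) -det_mulmx /Z tr_col_mx mul_col_row qg Fg.
  by rewrite det_ublock det1 mul1r.
pose c : 'rV[R]_(1 + d') := g *m invmx W.
have cW : lsubmx c *m q + rsubmx c *m F = g.
  by rewrite -mul_row_col hsubmxK mulmxKV.
have ca : lsubmx c = (dot g g)%:M.
  have : (lsubmx c *m q + rsubmx c *m F) *m g^T = (dot g g)%:M by rewrite cW dotE.
  by rewrite mulmxDl -!mulmxA qg Fg mulmx0 addr0 mulmx1.
have ZW : Z = block_mx (lsubmx c) (rsubmx c) 0 1%:M *m W.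
  by rewrite /W mul_block_col cW mul0mx add0r mul1mx.
rewrite DWZ ZW det_mulmx det_ublock det1 mulr1 ca det_scalar1 -detW expr2; ring.
Qed.

End FaceGram.

Section SimplexVolume.
Context {R : realType} {n d : nat} (p : 'I_n -> 'rV[R]_d).
Implicit Types (A T : {set 'I_n}) (l : 'I_n -> R) (x : 'rV[R]_d).

Definition pt l : 'rV[R]_d := \sum_i l i *: p i.

Definition vol A : R := simplex_int [seq p i | i <- enum A] (fun=> 1).

Lemma simplex_int_edges A k (x0 : 'I_n) (f : 'rV[R]_d -> R) : #|A| = k.+1 ->
  let P i := p (nth x0 (enum A) i) in
  let E := \matrix_(i < k) (P i.+1 - P 0%N) in
  simplex_int [seq p i | i <- enum A] f =
  Num.sqrt (\det (E *m E^T)) * ref_int 1 (fun t : 'rV[R]_k => f (P 0%N + t *m E)).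
Proof.
move=> Ak P E; rewrite /simplex_int /edge_mx.
have sk : (size [seq p i | i <- enum A]).-1 = k by rewrite size_map -cardE Ak.
have PE i : (i < k.+1)%N -> [seq p i | i <- enum A]`_i = P i.
  by move=> ik; rewrite (nth_map x0)// -cardE Ak.
move: (size _).-1 sk => m mk; subst m.
have -> : \matrix_(i < k) ([seq p i | i <- enum A]`_i.+1 - [seq p i | i <- enum A]`_0) = E.
  by apply/row_matrixP => i; rewrite !rowK !PE// ltnS.
by rewrite PE.
Qed.

Lemma pt_scatter A k (x0 : 'I_n) (t : 'rV[R]_k) : #|A| = k.+1 ->
  let P i := p (nth x0 (enum A) i) in
  P 0%N + t *m (\matrix_(i < k) (P i.+1 - P 0%N)) = pt (scatter A t).
Proof.
move=> Ak P; rewrite /pt (bigID (mem A)) /= [X in _ = _ + X]big1 ?addr0 => [|i iA]; last first.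
  by rewrite /scatter (negbTE iA) scale0r.
rewrite (big_enum_recl _ x0 _ Ak) scatter0//= mulmx_sum_row -/(P 0%N).
have -> : \sum_j t 0 j *: row j (\matrix_(i < k) (P i.+1 - P 0%N)) =
   \sum_j t 0 j *: P j.+1 - (\sum_j t 0 j) *: P 0%N.
  by rewrite scaler_suml -sumrB; apply: eq_bigr => j _; rewrite rowK scalerBr.
rewrite scalerBl scale1r [LHS]addrCA [RHS]addrC; congr (_ + _).
by apply: eq_bigr => j _; rewrite scatterS.
Qed.

(** The affine parametrization has a constant Jacobian. *)
Lemma simplex_int_smean A f : A != finset.set0 ->
  simplex_int [seq p i | i <- enum A] f = vol A * smean A (fun l => f (pt l)).
Proof.
move=> /[dup] A0 /set0Pn[x0 x0A].
have /prednK/esym Ak : (0 < #|A|)%N by rewrite card_gt0.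
rewrite /vol !(simplex_int_edges x0 _ Ak) -mulrA; congr (_ * _).
have k1 : (#|A|.-1)`!%:R * ref_int 1 (fun _ : 'rV[R]_(#|A|.-1) => 1) = 1 :> R.
  exact: (smean_cst 1 A0).
rewrite /smean mulrCA mulrA k1 mul1r; congr ref_int; apply/funext => t.
by rewrite (pt_scatter x0 _ Ak).
Qed.

Lemma vol_gram A k (x0 : 'I_n) : #|A| = k.+1 ->
  let P i := p (nth x0 (enum A) i) in
  let E := \matrix_(i < k) (P i.+1 - P 0%N) in
  vol A = Num.sqrt (\det (E *m E^T)) / k`!%:R.
Proof.
move=> Ak P E; rewrite /vol (simplex_int_edges x0 _ Ak); congr (_ * _).
have A0 : A != finset.set0 by rewrite -card_gt0 Ak.
have := smean_cst (1 : R) A0; rewrite /smean Ak /= => h.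
by apply: (mulfI (factr_neq0 k)); rewrite h mulfV// factr_neq0.
Qed.

Lemma vol_ge0 A : 0 <= vol A.
Proof. by rewrite mulr_ge0 ?sqrtr_ge0//; exact: ref_int_ge0. Qed.

End SimplexVolume.

Section Barycentric.
Context {R : realType} {n d : nat} (p : 'I_n -> 'rV[R]_d).
Implicit Types (A T : {set 'I_n}) (l : 'I_n -> R) (x : 'rV[R]_d).

(** The gradients gc.1 i and the constant terms gc.2 i of the barycentric
    coordinates. The coordinates of vertices outside T are taken to be 0, so
    that sums may range over all the vertices of the mesh. *)
Definition bary_spec T (gc : ('I_n -> 'rV[R]_d) * ('I_n -> R)) : Prop :=
  [/\ forall i, i \notin T -> gc.1 i = 0 /\ gc.2 i = 0,
      forall i j, i \in T -> j \in T -> dot (gc.1 i) (p j) + gc.2 i = (i == j)%:R,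
      forall x, \sum_i (dot (gc.1 i) x + gc.2 i) = 1 &
      forall x, \sum_i (dot (gc.1 i) x + gc.2 i) *: p i = x].

Definition bary_data T := xget (fun=> 0, fun=> 0) (bary_spec T).
Definition bgrad T i : 'rV[R]_d := (bary_data T).1 i.
Definition bary T i x : R := dot (bgrad T i) x + (bary_data T).2 i.

Definition full_cell T : Prop := #|T| = d.+1 /\ interior (hull p T) !=set0.

Lemma interior_line (E : set 'rV[R]_d) x v : interior E x ->
  exists2 e : R, 0 < e & forall s, `|s| < e -> E (x + s *: v).
Proof.
move=> Ex.
have : \forall s \near (0 : R), E (x + s *: v).
  have : (fun s : R => x + s *: v) @ 0 --> x.
    have {2}-> : x = x + 0 *: v by rewrite scale0r addr0.
    by apply: cvgD; [exact: cvg_cst | apply: cvgZr_tmp; exact: cvg_id].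
  exact.
move=> /nbhs_ballP [e /= e0 He]; exists e => // s se.
by apply: He; rewrite /ball /= sub0r normrN.
Qed.

Lemma dot_hull A x v c : hull p A x -> (forall i, i \in A -> dot v (p i) = c) -> dot v x = c.
Proof.
move=> [l [_ l1 ->]] h; rewrite dot_sumr.
under eq_bigr => i iA do rewrite dotZr h//.
by rewrite -mulr_suml l1 mul1r.
Qed.

(** The bordered matrix (1, p_j) of the vertices is invertible: a vector in its
   kernel is an affine function vanishing on the simplex, which has interior
   points. The barycentric coordinates are then (1, x) times the inverse. *)
Lemma bary_exists T : full_cell T -> exists gc, bary_spec T gc.
Proof.
move=> [Td [x Tx]].
have /set0Pn[x0 x0T] : T != finset.set0 by rewrite -card_gt0 Td.
pose e j := nth x0 (enum T) j.
have szT : size (enum T) = d.+1 by rewrite -cardE.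
have eT (j : 'I_d.+1) : e j \in T by rewrite -mem_enum mem_nth// szT.
pose M : 'M[R]_(1 + d) := \matrix_(j < 1 + d) row_mx (1%:M : 'rV[R]_1) (p (e j)).
have dotE (m : nat) (y z : 'rV[R]_m) : (y *m z^T) 0 0 = dot y z.
  by rewrite mxE; apply: eq_bigr => l _; rewrite mxE.
have MU : M \in unitmx.
  rewrite -unitmx_tr unitmxE unitfE; apply/det0P => -[v v0 vM].
  pose c := lsubmx v 0 0; pose w := rsubmx v.
  have vE : v = row_mx c%:M w.
    by rewrite -[LHS]hsubmxK; congr row_mx; rewrite [LHS]mx11_scalar.
  have cw (j : 'I_d.+1) : c + dot w (p (e j)) = 0.
    have : (v *m M^T) 0 j = 0 by rewrite vM mxE.
    rewrite mxE => <-; rewrite -[c]mulr1 -(dotE _ w).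
    rewrite vE.
    transitivity ((row_mx c%:M w *m (row_mx (1%:M : 'rV[R]_1) (p (e j)))^T) 0 0).
      rewrite tr_row_mx mul_row_col trmx1 mulmx1 [RHS]mxE; congr (_ + _).
      by rewrite mxE eqxx mulr1.
    by rewrite mxE; apply: eq_bigr => l _; rewrite !mxE.
  have wc i : i \in T -> dot w (p i) = - c.
    move=> iT; have ij : (index i (enum T) < d.+1)%N by rewrite -szT index_mem mem_enum.
    have := cw (Ordinal ij); rewrite /e /= nth_index ?mem_enum// => h.
    by apply/eqP; rewrite -addr_eq0 addrC h.
  have [r r0 hr] := interior_line w Tx.
  have h1 : dot w x = - c by apply: dot_hull wc; exact: interior_subset.
  have r2 : `|r / 2| < r by rewrite gtr0_norm ?divr_gt0// ltr_pdivrMr// ltr_pMr// ltr1n.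
  have := dot_hull (hr _ r2) wc; rewrite dotDr dotZr h1 => h2.
  have /eqP : r / 2 * dot w w = 0 by lra.
  rewrite mulf_eq0 gt_eqF ?divr_gt0//= dotxx_eq0 => /eqP w0.
  have c0 : c = 0 by have := cw ord0; rewrite w0 dot0l addr0.
  by move/eqP: v0; apply; rewrite vE w0 c0 raddf0 row_mx0.
pose N := invmx M.
pose ix i : 'I_(1 + d) := inord (index i (enum T)).
pose g i : 'rV[R]_d := if i \in T then \row_k N (rshift 1 k) (ix i) else 0.
pose c i : R := if i \in T then N (lshift d ord0) (ix i) else 0.
have bE i y : i \in T -> dot (g i) y + c i = (row_mx (1%:M : 'rV[R]_1) y *m N) 0 (ix i).
  move=> iT; rewrite /g /c iT mxE big_split_ord /= big_ord1 addrC; congr (_ + _); last first.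
    by rewrite row_mxEl mxE eqxx mul1r.
  by apply: eq_bigr => k _; rewrite row_mxEr !mxE mulrC.
have ixK i : i \in T -> e (ix i) = i.
  move=> iT; rewrite /e /ix inordK; last by rewrite -szT index_mem mem_enum.
  by rewrite nth_index ?mem_enum.
have sumT (V : nmodType) (G : 'I_n -> V) (H : 'I_(1 + d) -> V) :
    (forall i, i \notin T -> G i = 0) -> (forall i, i \in T -> G i = H (ix i)) ->
    \sum_i G i = \sum_j H j.
  move=> G0 GH; rewrite (bigID (mem T)) /= [X in _ + X]big1 ?addr0// (eq_bigr _ GH).
  rewrite -big_enum /= (big_nth x0) szT big_mkord; apply: eq_bigr => j _.
  congr H; apply/val_inj; rewrite /= inordK ?index_uniq ?enum_uniq ?szT//.
exists (g, c); split=> /= [i iT|i j iT jT|y|y].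
- by rewrite /g /c (negbTE iT).
- rewrite bE//.
  have -> : row_mx (1%:M : 'rV[R]_1) (p j) = row (ix j) M by rewrite rowK ixK.
  rewrite -row_mul mulmxV// mxE mxE; congr (_%:R).
  case: (eqVneq i j) => [->|ij]; first by rewrite eqxx.
  by apply/eqP; rewrite eqb0; apply: contraNneq ij => h; rewrite -(ixK i iT) -(ixK j jT) h.
- rewrite (sumT _ _ (fun j => (row_mx (1%:M : 'rV[R]_1) y *m N) 0 j)); last 2 first.
  + by move=> i iT; rewrite /g /c (negbTE iT) dot0l addr0.
  + by move=> i iT; rewrite bE.
  have : (row_mx (1%:M : 'rV[R]_1) y *m N *m M) 0 (lshift d ord0) = 1.
    by rewrite mulmxKV// row_mxEl mxE eqxx.
  rewrite mxE => h; rewrite -[RHS]h; apply: eq_bigr => j _.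
  by rewrite [M _ _]mxE row_mxEl [1%:M _ _]mxE eqxx mulr1.
- rewrite (sumT _ _ (fun j => (row_mx (1%:M : 'rV[R]_1) y *m N) 0 j *: p (e j))); last 2 first.
  + by move=> i iT; rewrite /g /c (negbTE iT) dot0l addr0 scale0r.
  + by move=> i iT; rewrite bE// ixK.
  apply/rowP => k.
  have : (row_mx (1%:M : 'rV[R]_1) y *m N *m M) 0 (rshift 1 k) = y 0 k.
    by rewrite mulmxKV// row_mxEr.
  rewrite mxE => h; rewrite -[RHS]h summxE; apply: eq_bigr => j _.
  by rewrite [M _ _]mxE row_mxEr mxE.
Qed.

Section Cell.
Variables (T : {set 'I_n}) (ndT : full_cell T).

Lemma bary_dataP : bary_spec T (bary_data T).
Proof. by have [gc h] := bary_exists ndT; exact: (xgetI _ h). Qed.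

Lemma bgrad_out i : i \notin T -> bgrad T i = 0.
Proof. by move=> iT; have [/(_ i iT)[] ] := bary_dataP. Qed.

Lemma bary_out i x : i \notin T -> bary T i x = 0.
Proof.
move=> iT; have [/(_ i iT)[g0 c0] _ _ _] := bary_dataP.
by rewrite /bary /bgrad g0 c0 dot0l addr0.
Qed.

Lemma bary_vertex i j : i \in T -> j \in T -> bary T i (p j) = (i == j)%:R.
Proof. by have [_ + _ _] := bary_dataP => h iT jT; rewrite /bary h. Qed.

Lemma sum_bary x : \sum_i bary T i x = 1.
Proof. by have [_ _ + _] := bary_dataP => h; exact: h. Qed.

Lemma pt_bary x : pt p (bary T ^~ x) = x.
Proof. by have [_ _ _] := bary_dataP => h; exact: h. Qed.

Lemma baryB i x y : bary T i x - bary T i y = dot (bgrad T i) (x - y).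
Proof. by rewrite /bary opprD addrACA subrr addr0 -dotBr. Qed.

Lemma baryD i x v : bary T i (x + v) = bary T i x + dot (bgrad T i) v.
Proof. by rewrite /bary dotDr addrAC. Qed.

Lemma bary_pt i l : (forall j, j \notin T -> l j = 0) -> \sum_j l j = 1 ->
  bary T i (pt p l) = l i.
Proof.
move=> lT l1; have [iT|iT] := boolP (i \in T); last by rewrite bary_out// lT.
rewrite /bary /pt dot_sumr.
transitivity (\sum_j l j * bary T i (p j)).
  rewrite -[(bary_data T).2 i]mul1r -l1 mulr_suml -big_split /=.
  by apply: eq_bigr => j _; rewrite dotZr -mulrDr.
rewrite (bigD1 i)//= bary_vertex// eqxx mulr1 big1 ?addr0// => j ji.
have [jT|jT] := boolP (j \in T); last by rewrite lT ?mul0r.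
by rewrite bary_vertex// eq_sym (negbTE ji) mulr0.
Qed.

Lemma sum_bgrad : \sum_i bgrad T i = 0.
Proof.
apply: dot_eq_all => y; rewrite dot_suml.
have := sum_bary y; rewrite -(sum_bary 0) => /eqP.
rewrite -subr_eq0 -sumrB => /eqP h; rewrite -[RHS]h; apply: eq_bigr => i _.
by rewrite baryB subr0.
Qed.

Lemma bgrad_vertices v : \sum_i dot (bgrad T i) v *: p i = v.
Proof.
have h : pt p (bary T ^~ v) - pt p (bary T ^~ 0) = v by rewrite !pt_bary subr0.
rewrite -[RHS]h -sumrB; apply: eq_bigr => i _.
by rewrite -scalerBl baryB subr0.
Qed.

Lemma hullP x : hull p T x <-> forall i, 0 <= bary T i x.
Proof.
split=> [[l [l0 l1 ->]] i|b0].
  pose l' j := if j \in T then l j else 0.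
  have s1 : \sum_j l' j = 1 by rewrite /l' -big_mkcond.
  have -> : \sum_(i in T) l i *: p i = pt p l'.
    rewrite /pt big_mkcond; apply: eq_bigr => j _.
    by rewrite /l'; case: ifP => // _; rewrite scale0r.
  rewrite bary_pt// /l' => [|j /negbTE ->//].
  by case: ifP.
exists (bary T ^~ x); split=> //.
  rewrite -(sum_bary x) [RHS](bigID (mem T)) /= [X in _ = _ + X]big1 ?addr0//.
  by move=> i iT; rewrite bary_out.
rewrite -{1}(pt_bary x) /pt (bigID (mem T)) /= [X in _ + X]big1 ?addr0//.
by move=> i iT; rewrite bary_out// scale0r.
Qed.

Lemma bary_simplex x : hull p T x -> in_simplex T (bary T ^~ x).
Proof.
by move=> /hullP h; split=> // [i iT|]; [rewrite bary_out | rewrite sum_bary].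
Qed.

End Cell.

Lemma hull_pt A l : in_simplex A l -> hull p A (pt p l).
Proof.
move=> [l0 lA l1]; exists l; split=> //.
  by move: l1; rewrite (bigID (mem A)) /= [X in _ + X]big1 ?addr0.
rewrite /pt (bigID (mem A)) /= [X in _ + X]big1 ?addr0// => i iA.
by rewrite lA// scale0r.
Qed.

Lemma hull_ptP A x : hull p A x <-> exists2 l, in_simplex A l & x = pt p l.
Proof.
split=> [[l [l0 l1 ->]]|[l lA ->]]; last exact: hull_pt.
exists (fun j => if j \in A then l j else 0).
  split=> [i|i /negbTE -> //|]; first by case: ifP.
  by rewrite -big_mkcond.
rewrite /pt big_mkcond; apply: eq_bigr => j _.
by case: ifP => // _; rewrite scale0r.
Qed.

Lemma in_simplexS A (B : {set 'I_n}) l : A \subset B -> in_simplex A l -> in_simplex B l.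
Proof.
move=> AB [l0 lA l1]; split=> // i iB; apply: lA.
by apply: contra iB; apply: (fintype.subsetP AB).
Qed.

Lemma hullS A (B : {set 'I_n}) : A \subset B -> hull p A `<=` hull p B.
Proof.
by move=> AB x /hull_ptP[l lA ->]; apply: hull_pt; exact: in_simplexS lA.
Qed.

Lemma hull_bounded A x : hull p A x -> enorm x <= \sum_i enorm (p i).
Proof.
move=> /hull_ptP[l [l0 lA l1] ->]; apply: le_trans (enorm_sum _ _ _) _.
apply: ler_sum => i _; rewrite enormZ ger0_norm// ler_piMl ?enorm_ge0//.
rewrite -l1 (bigD1 i)//= lerDl; exact: sumr_ge0.
Qed.

Lemma enorm_le_diam A x y : hull p A x -> hull p A y -> enorm (x - y) <= diam (hull p A).
Proof.
move=> Ax Ay; apply: ub_le_sup; last by exists x => //; exists y.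
exists (\sum_i enorm (p i) + \sum_i enorm (p i)) => _ [u Au [v Av <-]].
by apply: le_trans (enormD _ _) _; rewrite enormN; apply: lerD; [exact: hull_bounded Au | exact: hull_bounded Av].
Qed.

Lemma hull_vertex A i : i \in A -> hull p A (p i).
Proof.
move=> iA; exists (fun j => (j == i)%:R); split=> [j||].
- by rewrite ler0n.
- by rewrite (bigD1 i)//= eqxx big1 ?addr0// => j /andP[_ /negbTE ->].
- rewrite (bigD1 i)//= eqxx scale1r big1 ?addr0// => j /andP[_ /negbTE ->].
  by rewrite scale0r.
Qed.

End Barycentric.

Section CellMeasure.
Context {R : realType} {n d' : nat} (p : 'I_n -> 'rV[R]_d'.+1).
Local Notation d := d'.+1.
Implicit Types (A T : {set 'I_n}) (l : 'I_n -> R) (x : 'rV[R]_d).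
Local Notation bgrad := (bgrad p).
Local Notation bary := (bary p).

Lemma enum_setD1 T k : enum (T :\ k)%SET = rem k (enum T).
Proof.
rewrite rem_filter ?enum_uniq// /enum_mem -filter_predI.
by apply: eq_filter => i; rewrite !inE.
Qed.

Lemma nth_rem (U : eqType) (i0 k : U) s i :
  nth i0 (rem k s) i = nth i0 s (bump (index k s) i).
Proof.
elim: s i => [|y s IH] i /=; first by rewrite !nth_nil.
have [->|yk] := eqVneq y k; first by rewrite /bump add1n.
case: i => [|i] /=; first by rewrite /bump.
by rewrite IH /bump ltnS addnS.
Qed.

Definition corner T (i0 : 'I_n) (j : 'I_d.+1) := p (nth i0 (enum T) j).

Section Cell.
Variables (T : {set 'I_n}) (ndT : full_cell p T).

Lemma card_full_cell : #|T| = d.+1.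
Proof. by have [] := ndT. Qed.

Lemma other_vertex k : exists2 j, j \in T & j != k.
Proof.
have : (0 < #|(T :\ k)%SET|)%N.
  by have := cardsD1 k T; rewrite card_full_cell; case: (k \in T) => /=; lia.
by rewrite card_gt0 => /set0Pn[j]; rewrite !inE => /andP[jk jT]; exists j.
Qed.

Lemma cell_neq0 : T != finset.set0.
Proof. by rewrite -card_gt0 card_full_cell. Qed.

Lemma card_face k : k \in T -> #|(T :\ k)%SET| = d.
Proof. by move=> kT; have := cardsD1 k T; rewrite kT card_full_cell add1n => -[]. Qed.

Lemma face_neq0 k : k \in T -> (T :\ k)%SET != finset.set0.
Proof. by move=> kT; rewrite -card_gt0 card_face. Qed.

Lemma nth_enum_in (i0 : 'I_n) (j : 'I_d.+1) : nth i0 (enum T) j \in T.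
Proof. by rewrite -mem_enum mem_nth// -cardE card_full_cell. Qed.

Lemma dot_bgrad_corner i0 i j k : k \in T ->
  dot (bgrad T k) (corner T i0 i - corner T i0 j) =
  (k == nth i0 (enum T) i)%:R - (k == nth i0 (enum T) j)%:R.
Proof. by move=> kT; rewrite -(baryB p) !bary_vertex// nth_enum_in. Qed.

Lemma nth_enum_eq (i0 : 'I_n) (i j : 'I_d.+1) :
  (nth i0 (enum T) i == nth i0 (enum T) j) = (i == j).
Proof. by rewrite nth_uniq ?enum_uniq// -cardE card_full_cell. Qed.

Definition dual_edges i0 : 'M[R]_d :=
  \matrix_(i < d) bgrad T (nth i0 (enum T) (lift ord0 i)).

Lemma edges_dual (i0 : 'I_n) : edges (corner T i0) *m (dual_edges i0)^T = 1%:M.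
Proof.
apply/matrixP => i j; rewrite !mxE.
transitivity (dot (bgrad T (nth i0 (enum T) (lift ord0 j)))
   (corner T i0 (lift ord0 i) - corner T i0 ord0)).
  by rewrite /dot; apply: eq_bigr => k _; rewrite !mxE mulrC.
rewrite dot_bgrad_corner ?nth_enum_in// !nth_enum_eq.
rewrite (inj_eq lift_inj) [_ == ord0]eq_sym (negbTE (neq_lift _ _)) subr0 eq_sym.
by case: (i == j).
Qed.

Lemma det_edges_dual i0 : \det (edges (corner T i0)) * \det (dual_edges i0) = 1.
Proof. by rewrite -(det_tr (dual_edges i0)) -det_mulmx edges_dual det1. Qed.

Lemma det_edges_neq0 i0 : \det (edges (corner T i0)) != 0.
Proof.
apply/eqP => h; have := det_edges_dual i0; rewrite h mul0r => /esym/eqP.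
by rewrite oner_eq0.
Qed.

Lemma vol_cell i0 : vol p T = `|\det (edges (corner T i0))| / d`!%:R.
Proof.
rewrite (vol_gram p i0 card_full_cell).
set E := \matrix_(i < d) _.
have -> : E = edges (corner T i0).
  by apply/matrixP => i j; rewrite /E /edges !mxE /corner.
by rewrite (det_mulmx (edges _)) det_tr -expr2 sqrtr_sqr.
Qed.

Lemma vol_cell_gt0 : 0 < vol p T.
Proof.
have /set0Pn[i0 _] := cell_neq0.
by rewrite (vol_cell i0) divr_gt0 ?normr_gt0 ?det_edges_neq0// ltr0n fact_gt0.
Qed.

(** The altitude from vertex k is the inverse of the length of the gradient
    of its barycentric coordinate. *)
Lemma vol_face k : k \in T ->
  vol p (T :\ k)%SET = d%:R * vol p T * enorm (bgrad T k).
Proof.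
move=> kT; have kd : (index k (enum T) < d.+1)%N.
  by rewrite -card_full_cell cardE index_mem mem_enum.
pose m : 'I_d.+1 := Ordinal kd.
have mk : nth k (enum T) m = k by rewrite nth_index// mem_enum.
have gP i : dot (bgrad T k) (corner T k (lift m i) - corner T k m) = - 1.
  rewrite dot_bgrad_corner// mk eqxx -[X in X == _]mk nth_enum_eq.
  by rewrite (negbTE (neq_lift _ _)) sub0r.
rewrite (vol_gram p k (card_face kT)).
set F := \matrix_(i < d') _.
have -> : F = face_edges (corner T k) m.
  by apply/matrixP => i j; rewrite /F /face_edges !mxE /corner !enum_setD1 !nth_rem.
rewrite (det_face_gram (det_edges_neq0 k) gP) sqrtrM ?dotxx_ge0// sqrtr_sqr.
rewrite (vol_cell k) factS -/(enorm _) natrM; field.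
by rewrite factr_neq0 nat1r pnatr_eq0.
Qed.

End Cell.

Lemma det_le m (A : 'M[R]_m) (B : R) : (forall i j, `|A i j| <= B) ->
  `|\det A| <= m`!%:R * B ^+ m.
Proof.
move=> AB; apply: le_trans (ler_norm_sum _ _ _) _.
have -> : m`!%:R * B ^+ m = \sum_(s : 'S_m) B ^+ m.
  by rewrite sumr_const card_Sn mulr_natl.
apply: ler_sum => s _; rewrite normrM normrX normrN1 expr1n mul1r normr_prod.
have -> : B ^+ m = \prod_(i < m) B by rewrite prodr_const card_ord.
by apply: ler_prod => i _; rewrite normr_ge0 AB.
Qed.

Lemma enorm_entry m (x : 'rV[R]_m) j : `|x 0 j| <= enorm x.
Proof.
rewrite -(@ler_pXn2r _ 2) ?nnegrE ?enorm_ge0// enorm_sqr real_normK ?num_real//.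
rewrite /dot (bigD1 j)//= -expr2 lerDl.
by apply: sumr_ge0 => i _; rewrite -expr2 sqr_ge0.
Qed.

Section CellSize.
Variables (T : {set 'I_n}) (ndT : full_cell p T).
Local Notation h := (diam (hull p T)).

(** The coordinate of k drops from 1 to 0 along an edge from k. *)
Lemma bgrad_diam_ge1 k : k \in T -> 1 <= enorm (bgrad T k) * h.
Proof.
move=> kT; have [j jT jk] := other_vertex ndT k.
have : bary T k (p k) - bary T k (p j) = 1.
  by rewrite !bary_vertex// eqxx eq_sym (negbTE jk) subr0.
rewrite baryB => <-; apply: le_trans (ler_norm _) _; apply: le_trans (dot_le _ _) _.
by rewrite ler_wpM2l ?enorm_ge0// enorm_le_diam//; exact: hull_vertex.
Qed.

(** Between two opposite points of a ball inside the cell, a barycentric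
   coordinate increases by at most 1. *)
Lemma bgrad_inball k : k \in T -> enorm (bgrad T k) * inball_diam (hull p T) <= 1.
Proof.
move=> kT; set g := bgrad T k.
have g0 : 0 < enorm g.
  rewrite lt_def enorm_ge0 andbT; apply/eqP => g0.
  by have := bgrad_diam_ge1 kT; rewrite -/g g0 mul0r ler10.
rewrite mulrC -ler_pdivlMr// mul1r; apply: ge_sup.
  exists (2 * 0), 0 => //; split=> //; exists (p k) => y /= yk.
  have /eqP : enorm (y - p k) = 0 by apply/eqP; rewrite eq_le yk enorm_ge0.
  by rewrite enorm_eq0 subr_eq0 => /eqP ->; exact: hull_vertex.
move=> _ [r [r0 [x xr]] <-].
have b v : enorm v <= r -> hull p T (x + v) by move=> vr; apply: xr; rewrite /= addrAC subrr add0r.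
pose v := (r / enorm g) *: g.
have vr : enorm v <= r.
  by rewrite enormZ ger0_norm ?divfK ?gt_eqF// divr_ge0// enorm_ge0.
have gv : dot g v = r * enorm g.
  by rewrite dotZr -enorm_sqr expr2 mulrA divfK ?gt_eqF.
have /hullP/(_ k) : hull p T (x - v) by apply: b; rewrite enormN.
have /(bary_simplex ndT)[b0 _ b1] := b _ vr.
have : bary T k (x + v) <= 1.
  by rewrite -b1 (bigD1 k)//= lerDl sumr_ge0.
move=> + /(_ ndT); rewrite !baryD dotNr gv => h1 h2.
rewrite -[leRHS]mul1r ler_pdivlMr//; lra.
Qed.

Variables (sigma : R) (regT : h <= sigma * inball_diam (hull p T)).

Lemma diam_cell_gt0 : 0 < h.
Proof.
have /set0Pn[k kT] := cell_neq0 ndT.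
have := bgrad_diam_ge1 kT; rewrite ltNge => k1; apply/negP => h0.
by have := lt_le_trans ltr01 k1; rewrite ltNge mulr_ge0_le0 ?enorm_ge0.
Qed.

Lemma bgrad_le k : k \in T -> 0 <= sigma -> enorm (bgrad T k) * h <= sigma.
Proof.
move=> kT s0; apply: le_trans (ler_wpM2l (enorm_ge0 _) regT) _.
by rewrite mulrCA -[leRHS]mulr1 ler_wpM2l// bgrad_inball.
Qed.

Lemma bgrad_le_div k : k \in T -> 0 <= sigma -> enorm (bgrad T k) <= sigma / h.
Proof. by move=> kT s0; rewrite ler_pdivlMr ?diam_cell_gt0// bgrad_le. Qed.

Lemma vol_le : vol p T <= h ^+ d.
Proof.
have /set0Pn[i0 _] := cell_neq0 ndT.
rewrite (vol_cell ndT i0) ler_pdivrMr ?ltr0n ?fact_gt0// mulrC; apply: det_le => i j.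
rewrite mxE; apply: le_trans (enorm_entry _ _) _.
by apply: enorm_le_diam; apply: hull_vertex; exact: nth_enum_in.
Qed.

(** The matrix of the barycentric gradients, whose entries are at most sigma
    / h, is the inverse transpose of the matrix of the edges. *)
Lemma vol_ge : 0 <= sigma -> h ^+ d <= (d`!%:R) ^+ 2 * sigma ^+ d * vol p T.
Proof.
move=> s0; have /set0Pn[i0 _] := cell_neq0 ndT.
have h0 := diam_cell_gt0.
have D : `|\det (dual_edges T i0)| <= d`!%:R * (sigma / h) ^+ d.
  apply: det_le => i j; rewrite mxE; apply: le_trans (enorm_entry _ _) _.
  by apply: bgrad_le_div => //; exact: nth_enum_in.
have : `|\det (edges (corner T i0))| * `|\det (dual_edges T i0)| = 1.
  by rewrite -normrM det_edges_dual// normr1.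
have F0 : 0 < d`!%:R :> R by rewrite ltr0n fact_gt0.
have -> : `|\det (edges (corner T i0))| = d`!%:R * vol p T.
  by rewrite (vol_cell ndT i0) mulrC divfK// gt_eqF.
move=> E; have : 1 <= d`!%:R * vol p T * (d`!%:R * (sigma / h) ^+ d).
  rewrite -[X in X <= _]E; apply: ler_wpM2l => //; apply: mulr_ge0; [exact: ler0n|exact: vol_ge0].
rewrite expr_div_n => H; have := ler_wpM2r (ltW (exprn_gt0 d h0)) H.
rewrite mul1r => /le_trans; apply; rewrite le_eqVlt; apply/orP; left; apply/eqP.
by field; rewrite expf_neq0 // gt_eqF.
Qed.

Lemma vol_face_le k : k \in T -> 0 <= sigma ->
  vol p (T :\ k)%SET * h <= d%:R * sigma * vol p T.
Proof.
move=> kT s0; rewrite vol_face//.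
have := ler_wpM2l (mulr_ge0 (ler0n R d) (vol_ge0 p T)) (bgrad_le kT s0).
by rewrite mulrA [X in _ <= X -> _]mulrAC.
Qed.

Lemma vol_face_ge k : k \in T -> d%:R * vol p T <= vol p (T :\ k)%SET * h.
Proof.
move=> kT; rewrite vol_face//.
have := ler_wpM2l (mulr_ge0 (ler0n R d) (vol_ge0 p T)) (bgrad_diam_ge1 kT).
by rewrite mulr1 [X in _ <= X -> _]mulrA.
Qed.

(** An edge joining vertex i to another vertex is at least as long as the
   altitude of vertex i. *)
Lemma edge_ge i j : i \in T -> j \in T -> i != j -> 0 <= sigma ->
  h <= sigma * enorm (p i - p j).
Proof.
move=> iT jT ij s0.
have : 1 <= enorm (bgrad T i) * enorm (p i - p j).
  apply: le_trans (dot_le _ _); apply: le_trans (ler_norm _).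
  by rewrite -baryB !bary_vertex// eqxx (negbTE ij) subr0.
move=> k1; have := ler_wpM2l (ltW diam_cell_gt0) k1; rewrite mulr1 => /le_trans; apply.
by rewrite mulrA [h * _]mulrC ler_wpM2r ?enorm_ge0// bgrad_le.
Qed.

End CellSize.

End CellMeasure.

(** * Convex polytopes *)

Section ConvexDomain.
Context {R : realType} {d : nat}.
Implicit Types (x y z g : 'rV[R]_d) (E : set 'rV[R]_d).

Lemma continuous_bigsum (T : topologicalType) (V : normedModType R) (I : Type)
    (r : seq I) (F : I -> T -> V) :
  (forall i, continuous (F i)) -> continuous (fun t : T => \sum_(i <- r) F i t).
Proof.
move=> cF; elim: r => [|i r IH].
  by under eq_fun do rewrite big_nil; exact: cst_continuous.
under eq_fun do rewrite big_cons.
by move=> x; apply: (@continuousD _ _ _ (F i)); [exact: cF | exact: IH].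
Qed.

Lemma dot_continuous g : continuous (fun x => dot g x).
Proof.
apply: continuous_bigsum => i x.
apply: (@continuousM _ _ (fun x => g 0 i) (fun x : 'rV[R]_d => x 0 i)).
  exact: cst_continuous.
exact: coord_continuous.
Qed.

Lemma affine_continuous f : affine f -> continuous (f : 'rV[R]_d -> R).
Proof.
move=> [b [c fE]]; have -> : f = (fun x => dot b x + c) by exact/funext.
move=> x; apply: (@continuousD _ _ _ (dot b)); first exact: dot_continuous.
exact: cst_continuous.
Qed.

Lemma quadratic_continuous q : quadratic q -> continuous (q : 'rV[R]_d -> R).
Proof.
move=> [Q [b [c qE]]].
have -> : q = (fun x => dot (x *m Q) x + (dot b x + c)) by apply/funext => x; rewrite qE addrA.
move=> x; apply: (@continuousD _ _ _ (fun x => dot (x *m Q) x)); last first.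
  by apply: affine_continuous; exists b, c.
move: x; apply: continuous_bigsum => i x.
apply: (@continuousM _ _ (fun x => (x *m Q) 0 i) (fun x : 'rV[R]_d => x 0 i)).
  have -> : (fun y : 'rV[R]_d => (y *m Q) 0 i) = (fun y => dot (\row_j Q j i) y).
    by apply/funext => y; rewrite mxE /dot; apply: eq_bigr => j _; rewrite mxE mulrC.
  exact: dot_continuous.
exact: coord_continuous.
Qed.

Lemma hull_convex n (p : 'I_n -> 'rV[R]_d) A x y (t : R) : hull p A x -> hull p A y ->
  0 <= t <= 1 -> hull p A (t *: x + (1 - t) *: y).
Proof.
move=> /hull_ptP[l [l0 lA l1] ->] /hull_ptP[m [m0 mA m1] ->] /andP[t0 t1].
apply/hull_ptP; exists (fun i => t * l i + (1 - t) * m i).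
  split=> [i|i iA|].
  - by rewrite addr_ge0 // mulr_ge0 // subr_ge0.
  - by rewrite lA// mA// !mulr0 addr0.
  - by rewrite big_split -!mulr_sumr l1 m1 /= !mulr1 addrC subrK.
rewrite /pt !scaler_sumr -big_split; apply: eq_bigr => i _ /=.
by rewrite !scalerA -scalerDl.
Qed.

(** The hull is a continuous image of the compact set of barycentric
    coordinates. *)
Lemma hull_closed n (p : 'I_n -> 'rV[R]_d) A : closed (hull p A).
Proof.
apply: compact_closed; first exact: norm_hausdorff.
pose S := [set l : 'rV[R]_n | in_simplex A (fun i => l 0 i)].
have -> : hull p A = (fun l => pt p (fun i => l 0 i)) @` S.
  apply/seteqP; split=> x.
    move=> /hull_ptP[l lA ->]; exists (\row_i l i).
      by rewrite /S /=; have -> : (fun i => (\row_i l i) 0 i) = l by apply/funext => i; rewrite mxE.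
    by congr pt; apply/funext => i; rewrite mxE.
  by move=> [l lS <-]; apply: hull_pt.
apply: continuous_compact.
  apply: continuous_subspaceT; apply: continuous_bigsum => i x.
  apply: (@continuousZr_tmp _ _ _ (fun l : 'rV[R]_n => l 0 i)).
  exact: coord_continuous.
apply: bounded_closed_compact.
  exists 1; split=> [//|M M1 l [l0 _ l1]].
  apply: le_trans (ltW M1); rewrite [leLHS]/Num.Def.normr /= mx_normrE.
  apply: bigmax_le => // -[i j] _ /=; rewrite ord1 ger0_norm// -l1.
  by rewrite (bigD1 j)//= lerDl sumr_ge0.
have -> : S = (\bigcap_(i in [set: 'I_n]) [set l : 'rV[R]_n | 0 <= l 0 i]) `&`
   ((\bigcap_(i in [set i : 'I_n | i \notin A]) [set l : 'rV[R]_n | l 0 i = 0]) `&`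
    [set l | \sum_i l 0 i = 1]).
  apply/seteqP; split=> l; first (move=> [l0 lA l1]; split; [|split]).
  - by move=> i _; exact: l0.
  - by move=> i iA; exact: lA.
  - exact: l1.
  move=> [l0 [lA l1]]; split; [move=> i; exact: l0|move=> i iA; exact: lA|exact: l1].
apply: closedI; first apply: closed_bigI => i _.
  apply: (@preimage_closed _ _ (fun l : 'rV[R]_n => l 0 i) [set t : R | 0 <= t]).
    by move=> x _; exact: coord_continuous.
  exact: closed_ge.
apply: closedI; first apply: closed_bigI => i _.
  apply: (@preimage_closed _ _ (fun l : 'rV[R]_n => l 0 i) [set t : R | t = 0]).
    by move=> x _; exact: coord_continuous.
  exact: closed_eq.
apply: (@preimage_closed _ _ (fun l : 'rV[R]_n => \sum_i l 0 i) [set t : R | t = 1]).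
  by move=> x _; apply: continuous_bigsum => i; exact: coord_continuous.
exact: closed_eq.
Qed.

Context (Omega : set 'rV[R]_d) (hOmega : convex_polytope_domain Omega).

Lemma domain_open : open Omega.
Proof. by have [_ [n [p ->]]] := hOmega; exact: open_interior. Qed.

Lemma closure_domain_hull n (p : 'I_n -> 'rV[R]_d) :
  Omega = interior (hull p [set: 'I_n]%SET) -> closure Omega `<=` hull p [set: 'I_n]%SET.
Proof.
move=> ->; apply: subset_trans (closure_subset (@interior_subset _ _)) _.
by rewrite -(closure_id _).1//; exact: hull_closed.
Qed.

Lemma domain_bounded : exists2 B : R, 0 < B & forall x, closure Omega x -> enorm x <= B.
Proof.
have [_ [n [p E]]] := hOmega; exists (1 + \sum_i enorm (p i)).
  by rewrite ltr_pwDl// sumr_ge0// => i _; exact: enorm_ge0.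
move=> x /(closure_domain_hull E) Cx; apply: le_trans (hull_bounded Cx) _.
by rewrite lerDr.
Qed.

Lemma interior_closure_domain : interior (closure Omega) `<=` Omega.
Proof.
have [_ [n [p E]]] := hOmega; rewrite [X in _ `<=` X]E.
by apply: interiorS; exact: closure_domain_hull.
Qed.

(** The image of a neighbourhood of x under the homothety of centre y that sends
   x to the point below is a neighbourhood of that point inside the hull. *)
Lemma domain_segment x y (t : R) : Omega x -> closure Omega y -> 0 < t <= 1 ->
  Omega (t *: x + (1 - t) *: y).
Proof.
have [_ [n [p E]]] := hOmega; move=> + /(closure_domain_hull E) Cy /andP[t0 t1].
rewrite E => Cx; set z := t *: x + _.
have zx : {for z, continuous (fun z' : 'rV[R]_d => x + t^-1 *: (z' - z))}.
  apply: (@continuousD _ _ _ (fun=> x)); first exact: cst_continuous.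
  apply: (@continuousZl_tmp _ _ _ (fun z' : 'rV[R]_d => z' - z)).
  by apply: (@continuousB _ _ _ id); [move=> ? | exact: cst_continuous].
have C' : interior (hull p [set: 'I_n]%SET) (x + t^-1 *: (z - z)) by rewrite subrr scaler0 addr0.
have H : nbhs z ((fun z' : 'rV[R]_d => x + t^-1 *: (z' - z)) @^-1` hull p [set: 'I_n]%SET).
  exact: zx C'.
apply: (@filterS _ (nbhs z) _ _ _ _ H) => z' Cx'.
have -> : z' = t *: (x + t^-1 *: (z' - z)) + (1 - t) *: y.
  rewrite scalerDr scalerA mulfV ?gt_eqF// scale1r addrAC -/z addrC subrK//.
by apply: hull_convex => //; rewrite (ltW t0).
Qed.

End ConvexDomain.

(** * Cells, faces and normals of a triangulation *)

Section MeshGeometry.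
Context {R : realType} {d' : nat} {Omega : set 'rV[R]_d'.+1}.
Local Notation d := d'.+1.
Variable Th : triangulation Omega.
Local Notation simplex := {set 'I_(nvert Th)}.
Local Notation p := (vertex (t := Th)).
Local Notation adjacent := (Defs.adjacent (Th := Th)).
Implicit Types (A T e : simplex) (x : 'rV[R]_d).

Lemma cell_full T : T \in cells Th -> full_cell p T.
Proof. by move=> TTh; split; [exact: card_cell | exact: cell_nondegenerate]. Qed.

Lemma integral_onE A f : A != finset.set0 ->
  integral_on A f = meas A * smean A (fun l => f (pt p l)).
Proof. by move=> A0; rewrite /integral_on simplex_int_smean. Qed.

Lemma cell_in_closure T x : T \in cells Th -> geom T x -> closure Omega x.
Proof. by move=> TTh Tx; rewrite (cells_cover Th); exists T. Qed.

(** By conformity a common point is in the hull of the common vertices, where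
    it has the same coordinates with respect to both cells. *)
Lemma common_coord T T' x i : T \in cells Th -> T' \in cells Th ->
  geom T x -> geom T' x -> bary p T i x = bary p T' i x.
Proof.
move=> TTh TTh' Tx Tx'.
have : hull p (T :&: T')%SET x by rewrite -(conforming TTh TTh').
move=> /hull_ptP[l [l0 lT l1] ->].
rewrite !bary_pt//; try exact: cell_full.
  by move=> j jT; apply: lT; rewrite inE (negbTE jT) andbF.
by move=> j jT; apply: lT; rewrite inE (negbTE jT).
Qed.

Lemma common_support T T' x i : T \in cells Th -> T' \in cells Th ->
  geom T x -> geom T' x -> bary p T i x != 0 -> i \in T'.
Proof.
move=> TTh TTh' Tx Tx'; rewrite (common_coord i TTh TTh' Tx Tx'); apply: contraR => iT.
by rewrite bary_out//; exact: cell_full.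
Qed.

Lemma faceP e : e \in faces Th -> exists T k,
  [/\ T \in cells Th, k \in T & e = (T :\ k)%SET].
Proof.
rewrite inE => /andP[/eqP ed /set0Pn[T]]; rewrite inE => /andP[TTh eT].
have : (0 < #|T :\: e|)%N by rewrite cardsD (finset.setIidPr eT) ed (card_cell TTh) subSnn.
rewrite card_gt0 => /set0Pn[k]; rewrite inE => /andP[ke kT].
exists T, k; split=> //; apply/eqP; rewrite eqEcard; apply/andP; split.
  by apply/fintype.subsetP => i ie; rewrite !inE (fintype.subsetP eT)// andbT; apply: contraNneq ke => <-.
by rewrite (card_face (cell_full TTh) kT) ed.
Qed.

Lemma face_opposite T e : T \in cells Th -> e \in faces Th -> e \subset T ->
  exists2 k, k \in T & e = (T :\ k)%SET.
Proof.
move=> TTh; rewrite inE => /andP[/eqP ed _] eT.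
have : (0 < #|T :\: e|)%N by rewrite cardsD (finset.setIidPr eT) ed (card_cell TTh) subSnn.
rewrite card_gt0 => /set0Pn[k]; rewrite inE => /andP[ke kT].
exists k => //; apply/eqP; rewrite eqEcard; apply/andP; split.
  by apply/fintype.subsetP => i ie; rewrite !inE (fintype.subsetP eT)// andbT; apply: contraNneq ke => <-.
by rewrite (card_face (cell_full TTh) kT) ed.
Qed.

Lemma opposite_face T k : T \in cells Th -> k \in T -> (T :\ k)%SET \in faces Th.
Proof.
move=> TTh kT; rewrite inE (card_face (cell_full TTh) kT) eqxx /=.
by apply/set0Pn; exists T; rewrite inE TTh subD1set.
Qed.

Lemma face_neq_set0 e : e \in faces Th -> e != finset.set0.
Proof. by rewrite inE => /andP[/eqP ed _]; rewrite -card_gt0 ed. Qed.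

Lemma sum_opposite_faces T (F : simplex -> R) : T \in cells Th ->
  \sum_(k in T) F (T :\ k)%SET = \sum_(e in faces Th | e \subset T) F e.
Proof.
move=> TTh.
have inj : {in T &, injective (fun k => (T :\ k)%SET)}.
  move=> i j iT jT E; apply/eqP; apply: contraT => ij.
  have : i \in (T :\ j)%SET by rewrite !inE ij iT.
  by rewrite -E !inE eqxx.
rewrite -(big_imset F inj) /=; apply: eq_bigl => e; apply/imsetP/andP => [[k kT ->]|[ef eT]].
  by split; [exact: opposite_face | exact: subD1set].
by have [k kT ->] := face_opposite TTh ef eT; exists k.
Qed.

Lemma sum_cells_faces (F : simplex -> simplex -> R) :
  \sum_(T in cells Th) \sum_(k in T) F T (T :\ k)%SET =
  \sum_(e in faces Th) \sum_(T in adjacent e) F T e.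
Proof.
transitivity (\sum_(T in cells Th) \sum_(e in faces Th | e \subset T) F T e).
  by apply: eq_bigr => T TTh; exact: sum_opposite_faces.
rewrite (exchange_big_dep (mem (faces Th))) /=; last by move=> T e _ /andP[].
by apply: eq_bigr => e ef; apply: eq_bigl => T; rewrite ef /= [RHS]inE.
Qed.

Definition normal_spec T e (n : 'rV[R]_d) : Prop :=
  [/\ enorm n = 1,
    forall i j, i \in e -> j \in e -> dot n (p i - p j) = 0
  & forall i k, i \in e -> k \in T :\: e -> 0 < dot n (p i - p k)].

(** A vector orthogonal to the face is determined by its product with an edge
   leaving the face, so that the outward unit normal can only be the normalized
   opposite of the gradient of the barycentric coordinate. *)
Lemma normal_spec_unique T k n : T \in cells Th -> k \in T ->
  normal_spec T (T :\ k)%SET n -> n = - (enorm (bgrad p T k))^-1 *: bgrad p T k.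
Proof.
move=> TTh kT [n1 n0 npos]; have fT := cell_full TTh.
have [j jT jk] := other_vertex fT k.
have je : j \in (T :\ k)%SET by rewrite !inE jk.
pose a := dot n (p j - p k).
have a0 : 0 < a by apply: npos => //; rewrite !inE eqxx /=.
have E : n = - a *: bgrad p T k.
  apply/subr0_eq; apply: dot_eq_all => v; rewrite dotBl dotZl.
  rewrite -[X in dot n X](bgrad_vertices fT v) dot_sumr.
  have -> : \sum_i dot n (dot (bgrad p T i) v *: p i) =
     \sum_i (dot (bgrad p T i) v * dot n (p j) - (i == k)%:R * (dot (bgrad p T i) v * a)).
    apply: eq_bigr => i _; rewrite dotZr.
    have [iT|iT] := boolP (i \in T); last by rewrite bgrad_out// dot0l !mul0r mulr0 subr0.
    case: (eqVneq i k) => [->|ik]; first by rewrite /a dotBr mulr1n; ring.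
    rewrite mul0r subr0; congr (_ * _); apply/eqP; rewrite -subr_eq0 -dotBr; apply/eqP.
    by apply: n0; rewrite // !inE ik iT.
  rewrite sumrB -mulr_suml -dot_suml sum_bgrad// dot0l mul0r sub0r.
  rewrite (bigD1 k)//= eqxx mul1r big1 => [|i /negbTE ->]; last by rewrite mul0r.
  ring.
have : `|- a| * enorm (bgrad p T k) = 1 by rewrite -enormZ -E.
rewrite normrN gtr0_norm// => aE; rewrite {1}E; congr (- _ *: _).
have g0 : enorm (bgrad p T k) != 0.
  by apply/eqP => g0; move: aE; rewrite g0 mulr0 => /esym/eqP; rewrite oner_eq0.
by apply: (mulIf g0); rewrite aE mulVf.
Qed.

Lemma normal_exists T k : T \in cells Th -> k \in T ->
  normal_spec T (T :\ k)%SET (- (enorm (bgrad p T k))^-1 *: bgrad p T k).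
Proof.
move=> TTh kT; have fT := cell_full TTh.
have g0 : 0 < enorm (bgrad p T k).
  rewrite lt_def enorm_ge0 andbT; apply/eqP => g0.
  by have := bgrad_diam_ge1 fT kT; rewrite g0 mul0r ler10.
split=> [|i j|i j].
- by rewrite enormZ normrN gtr0_norm ?invr_gt0// mulVf// gt_eqF.
- rewrite !inE => /andP[ik iT] /andP[jk jT].
  by rewrite dotZl -baryB !bary_vertex// eq_sym (negbTE ik) eq_sym (negbTE jk) subrr mulr0.
- rewrite !inE => /andP[ik iT] /andP[+ jT]; rewrite jT andbT negbK => /eqP ->.
  rewrite dotZl -baryB !bary_vertex// eqxx eq_sym (negbTE ik) sub0r mulrN1 opprK.
  by rewrite invr_gt0.
Qed.

Lemma outward_normalE T k : T \in cells Th -> k \in T ->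
  outward_normal T (T :\ k)%SET = - (enorm (bgrad p T k))^-1 *: bgrad p T k.
Proof.
move=> TTh kT; apply: normal_spec_unique => //.
exact: (xgetI _ (normal_exists TTh kT)).
Qed.

Lemma outward_normalP T e : T \in cells Th -> e \in faces Th -> e \subset T ->
  normal_spec T e (outward_normal T e).
Proof.
move=> TTh ef eT; have [k kT ->] := face_opposite TTh ef eT.
by rewrite outward_normalE//; exact: normal_exists.
Qed.

(** The face of outward normal n carries the weight that the divergence
    theorem gives to the barycentric gradient. *)
Lemma meas_normal T k : T \in cells Th -> k \in T ->
  meas (T :\ k)%SET *: outward_normal T (T :\ k)%SET =
  - (d%:R * meas T) *: bgrad p T k.
Proof.
move=> TTh kT; have fT := cell_full TTh.
have g0 : enorm (bgrad p T k) != 0.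
  apply/eqP => g0.
  by have := bgrad_diam_ge1 fT kT; rewrite g0 mul0r ler10.
rewrite outward_normalE// scalerA; congr (_ *: _).
have -> : meas (T :\ k)%SET = d%:R * meas T * enorm (bgrad p T k) by exact: vol_face.
by rewrite mulrN mulfK.
Qed.

Lemma barycenter_coord A : A != finset.set0 ->
  in_simplex A (fun i => (i \in A)%:R / #|A|%:R : R).
Proof.
move=> A0; have A1 : #|A|%:R != 0 :> R by rewrite pnatr_eq0 cards_eq0.
split=> [i|i /negbTE ->|]; first by rewrite divr_ge0 ?ler0n.
  by rewrite mul0r.
rewrite -mulr_suml -[X in X / _](_ : #|A|%:R = _) ?divff//.
by rewrite -sum1_card natr_sum big_mkcond; apply: eq_bigr => i _; case: (i \in A).
Qed.

(** Two different cells sharing a face lie on opposite sides of it: otherwise a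
   point slightly off the barycenter of the face towards the vertex k' of the
   second cell would belong to both cells, but not to their common face. *)
Lemma opposite_side T T' k k' : T \in cells Th -> T' \in cells Th -> T != T' ->
  k \in T -> k' \in T' -> (T :\ k)%SET = (T' :\ k')%SET -> bary p T k (p k') < 0.
Proof.
move=> TTh TTh' TT' kT kT' E; set e := (T :\ k)%SET in E.
have fT := cell_full TTh; have fT' := cell_full TTh'.
have eT : e \subset T by exact: subD1set.
have eT' : e \subset T' by rewrite E; exact: subD1set.
have I : (T :&: T')%SET = e.
  apply/eqP; rewrite eq_sym eqEcard finset.subsetI eT eT' /= (card_face fT kT).
  rewrite -ltnS -(card_cell TTh); apply: proper_card; rewrite finset.properEneq finset.subsetIl andbT.
  apply: contraNneq TT' => TI; rewrite eqEcard (card_cell TTh) (card_cell TTh') leqnn andbT.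
  by apply/finset.setIidPl.
rewrite ltNge; apply/negP => pos.
have e0 := face_neq0 fT kT; rewrite -/e in e0.
have ec : (0 < #|e|)%N by rewrite card_gt0.
pose b : 'I_(nvert Th) -> R := fun i => (i \in e)%:R / #|e|%:R.
have be : in_simplex e b by exact: barycenter_coord.
(* The step t towards p k' is so small that the coordinates on e stay nonnegative. *)
pose M : R := 1 + \sum_(i in e) `|bary p T i (p k')| * #|e|%:R.
have M1 : 1 <= M.
  by rewrite /M lerDl sumr_ge0// => i _; rewrite mulr_ge0// ler0n.
pose t : R := (1 + M)^-1.
have t0 : 0 < t by rewrite invr_gt0; lra.
have t1 : t <= 1 by rewrite invf_le1; lra.
pose y := t *: p k' + (1 - t) *: pt p b.
have bT i : bary p T i y = t * bary p T i (p k') + (1 - t) * b i.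
  have -> : b i = bary p T i (pt p b).
    rewrite bary_pt//; last by have [] := be.
    by have [_ h _] := be; move=> j jT; apply: h; apply: contra jT; exact: fintype.subsetP.
  by rewrite /bary /y dotDr !dotZr; ring.
have Ty : geom T y.
  apply/(hullP fT) => i; rewrite bT.
  have [iT|iT] := boolP (i \in T); last first.
    by rewrite bary_out// mulr0 add0r mulr_ge0 ?subr_ge0// divr_ge0 ?ler0n.
  case: (eqVneq i k) => [->|ik].
    apply: addr_ge0; first by rewrite mulr_ge0 ?(ltW t0).
    by rewrite mulr_ge0 ?subr_ge0// divr_ge0 ?ler0n.
  have ie : i \in e by rewrite !inE ik.
  rewrite /b ie mul1r.
  have hM : `|bary p T i (p k')| * #|e|%:R <= M.
    rewrite /M (bigD1 i)//= addrCA lerDl; apply: addr_ge0 => //.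
    by apply: sumr_ge0 => j _; apply: mulr_ge0; rewrite ?ler0n.
  have E1 : 1 - t = t * M by rewrite /t; field; rewrite gt_eqF// addr_gt0// (lt_le_trans ltr01 M1).
  have c0 : 0 < #|e|%:R :> R by rewrite ltr0n.
  rewrite E1 -mulrA -mulrDr mulr_ge0// ?(ltW t0)//.
  rewrite -(pmulr_lge0 _ c0) mulrDl divfK ?gt_eqF//.
  have := ler_norm (- (bary p T i (p k') * #|e|%:R)).
  by rewrite normrN normrM (gtr0_norm c0); lra.
have Ty' : geom T' y.
  apply: hull_convex; [exact: hull_vertex | | by rewrite (ltW t0)].
  by apply: hull_pt; exact: in_simplexS be.
have : hull p (T :&: T')%SET y by rewrite -(conforming TTh TTh').
rewrite I => /hull_ptP[l [_ le l1] yE].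
have : bary p T' k' y = 0.
  rewrite yE bary_pt//; first by apply: le; rewrite E !inE eqxx.
  by move=> j jT'; apply: le; apply: contra jT'; exact: fintype.subsetP.
have : bary p T' k' (pt p b) = 0.
  have [_ h b1] := be; rewrite bary_pt//; first by apply: h; rewrite E !inE eqxx.
  by move=> j jT'; apply: h; apply: contra jT'; exact: fintype.subsetP.
move=> h1 h2; have : bary p T' k' y = t * bary p T' k' (p k') + (1 - t) * bary p T' k' (pt p b).
  by rewrite /bary /y dotDr !dotZr; ring.
by rewrite h2 h1 bary_vertex// eqxx mulr1n; lra.
Qed.

Lemma opposite_normal T T' e : T \in cells Th -> T' \in cells Th -> T != T' ->
  e \in faces Th -> e \subset T -> e \subset T' ->
  outward_normal T' e = - outward_normal T e.
Proof.
move=> TTh TTh' TT' ef eT eT'.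
have [k kT E] := face_opposite TTh ef eT; have [k' kT' E'] := face_opposite TTh' ef eT'.
have fT := cell_full TTh.
have [n1 n0 _] := outward_normalP TTh ef eT.
rewrite {1}E' [LHS]outward_normalE//; apply/esym; apply: normal_spec_unique => //.
rewrite -E'; split=> [|i j ie je|i j ie].
- by rewrite enormN.
- by rewrite dotNl n0// oppr0.
- rewrite {1}E' !inE => /andP[+ jT']; rewrite jT' andbT negbK => /eqP ->.
  rewrite dotNl E outward_normalE// dotZl -baryB.
  have := opposite_side TTh TTh' TT' kT kT' (etrans (esym E) E').
  have -> : bary p T k (p i) = 0.
    by move: ie; rewrite E !inE => /andP[ik iT]; rewrite bary_vertex// eq_sym (negbTE ik).
  have g0 : 0 < enorm (bgrad p T k).
    rewrite lt_def enorm_ge0 andbT; apply/eqP => g0.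
    by have := bgrad_diam_ge1 fT kT; rewrite g0 mul0r ler10.
  move=> neg; rewrite sub0r mulNr mulrN !opprK -mulrN mulr_gt0// ?invr_gt0//; lra.
Qed.

Lemma adjacentP T e : reflect (T \in cells Th /\ e \subset T) (T \in adjacent e).
Proof. by rewrite inE; exact: andP. Qed.

(** The outward normals of three cells sharing a face would be pairwise
    opposite. *)
Lemma card_adjacent_le2 e : e \in faces Th -> (#|adjacent e| <= 2)%N.
Proof.
move=> ef; rewrite leqNgt; apply/negP => /card_gt2P[T1 [T2 [T3 [[a1 a2 a3] [n12 n23 n31]]]]].
move: a1 a2 a3 => /adjacentP[c1 s1] /adjacentP[c2 s2] /adjacentP[c3 s3].
have h2 := opposite_normal c1 c2 n12 ef s1 s2.
have h3 := opposite_normal c2 c3 n23 ef s2 s3.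
have h1 := opposite_normal c3 c1 n31 ef s3 s1.
have [n1 _ _] := outward_normalP c1 ef s1.
have : outward_normal T1 e = 0.
  move: h1; rewrite h3 h2 opprK => h1.
  have /eqP : 2%:R *: outward_normal T1 e = 0 by rewrite scaler_nat mulr2n {1}h1 addNr.
  by rewrite scaler_eq0 pnatr_eq0 => /eqP.
by move=> h0; move: n1; rewrite h0 enorm0 => /esym/eqP; rewrite oner_eq0.
Qed.

Lemma cell_minus_adjacent e : e \in faces Th -> cell_minus e \in adjacent e.
Proof.
rewrite inE => /andP[_ /set0Pn[T Te]]; rewrite /cell_minus; case: pickP => //=.
by move/(_ T); rewrite Te.
Qed.

Lemma interior_face e : e \in interior_faces Th -> e \in faces Th.
Proof. by rewrite inE => /andP[]. Qed.

Lemma cell_plus_adjacent e : e \in interior_faces Th ->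
  cell_plus e \in adjacent e /\ cell_plus e != cell_minus e.
Proof.
move=> eI; have em := cell_minus_adjacent (interior_face eI).
move: eI; rewrite inE => /andP[_ /eqP e2]; rewrite /cell_plus; case: pickP => [T|e0].
  by rewrite !inE => /andP[TM ?]; split.
have := cardsD1 (cell_minus e) (adjacent e); rewrite em e2.
by rewrite (_ : #|_ :\ _| = 0%N)//; apply/eqP; rewrite cards_eq0; apply/eqP/setP => T; rewrite e0 inE.
Qed.

Lemma sum_adjacent_interior e (F : simplex -> R) : e \in interior_faces Th ->
  \sum_(T in adjacent e) F T = F (cell_minus e) + F (cell_plus e).
Proof.
move=> eI; have em := cell_minus_adjacent (interior_face eI).
have [ep pm] := cell_plus_adjacent eI.
rewrite (bigD1 (cell_minus e))//= (bigD1 (cell_plus e)) ?ep//= big1 ?addr0//.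
move=> T /andP[/andP[Te Tm] Tp]; exfalso.
have : (2 < #|adjacent e|)%N.
  apply/card_gt2P; exists T, (cell_minus e), (cell_plus e); split=> //; split=> //.
    by rewrite eq_sym.
  by rewrite eq_sym.
by rewrite ltnNge card_adjacent_le2// interior_face.
Qed.

Lemma adjacent_interior T e : e \in interior_faces Th -> T \in adjacent e ->
  T = cell_minus e \/ T = cell_plus e.
Proof.
move=> eI Te; have := sum_adjacent_interior (fun T' => (T' == T)%:R) eI.
rewrite (bigD1 T)//= eqxx big1 ?addr0 => [|T' /andP[_ /negbTE ->]//].
do 2 (case: eqVneq => [->|_]; first by auto).
by rewrite addr0 => /eqP; rewrite oner_eq0.
Qed.

Lemma sum_adjacent_boundary e (F : simplex -> R) : e \in faces Th ->
  e \notin interior_faces Th -> \sum_(T in adjacent e) F T = F (cell_minus e).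
Proof.
move=> ef eI; have em := cell_minus_adjacent ef.
have c1 : #|adjacent e| = 1%N.
  have := card_adjacent_le2 ef; have : (0 < #|adjacent e|)%N by rewrite card_gt0; apply/set0Pn; exists (cell_minus e).
  by move: eI; rewrite inE ef /=; case: #|_| => [|[|[|]]].
have /cards1P[T0 T0E] := introT eqP c1.
by move: em; rewrite T0E inE big_set1 => /eqP ->.
Qed.

Lemma normal_plus e : e \in interior_faces Th ->
  outward_normal (cell_plus e) e = - face_normal e.
Proof.
move=> eI; have ef := interior_face eI.
have /adjacentP[mTh em] := cell_minus_adjacent ef.
have [/adjacentP[pTh ep] pm] := cell_plus_adjacent eI.
by apply: opposite_normal => //; rewrite eq_sym.
Qed.

Lemma enorm_face_normal e : e \in faces Th -> enorm (face_normal e) = 1.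
Proof.
move=> ef; have /adjacentP[mTh em] := cell_minus_adjacent ef.
by have [] := outward_normalP mTh ef em.
Qed.

End MeshGeometry.

(** * Quadratic polynomials on one cell *)

Section CellCalculus.
Context {R : realType} {n d : nat} (p : 'I_n -> 'rV[R]_d).
Implicit Types (l : 'I_n -> R) (F : ('I_n -> R) -> R) (G : ('I_n -> R) -> 'rV[R]_d).

(** G is the gradient in R^d of a function given in barycentric coordinates:
   the coordinate i moves the point in the direction of vertex i. *)
Definition has_grad F G : Prop := pder F (fun i l => dot (G l) (p i)).

Lemma eq_has_grad F G F' G' : F =1 F' -> G =1 G' -> has_grad F G -> has_grad F' G'.
Proof. by move=> FF GG; apply: eq_pder => // k l; rewrite GG. Qed.

Lemma has_grad_polyf F G : has_grad F G -> polyf F.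
Proof. exact: pder_polyf. Qed.

Lemma has_grad_cst c : has_grad (fun=> c) (fun=> 0).
Proof. by apply: eq_pder (pder_cst c) => // k l; rewrite dot0l. Qed.

Lemma has_gradD F G F' G' : has_grad F G -> has_grad F' G' ->
  has_grad (fun l => F l + F' l) (fun l => G l + G' l).
Proof. by move=> h h'; apply: eq_pder (pderD h h') => // k l; rewrite dotDl. Qed.

Lemma has_gradM F G F' G' : has_grad F G -> has_grad F' G' ->
  has_grad (fun l => F l * F' l) (fun l => F' l *: G l + F l *: G' l).
Proof.
by move=> h h'; apply: eq_pder (pderM h h') => // k l; rewrite dotDl !dotZl mulrC.
Qed.

Lemma has_grad_sum (I : Type) (s : seq I) (H : I -> ('I_n -> R) -> R) D :
  (forall i : I, has_grad (H i) (D i)) ->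
  has_grad (fun l => \sum_(i <- s) H i l) (fun l => \sum_(i <- s) D i l).
Proof. by move=> h; apply: eq_pder (pder_sum s h) => // k l; rewrite dot_suml. Qed.

Lemma has_grad_affine b c : has_grad (fun l => dot b (pt p l) + c) (fun=> b).
Proof.
apply: eq_has_grad (has_gradD (_ : has_grad (fun l => dot b (pt p l)) (fun=> b))
  (has_grad_cst c)) => [//|l|]; first by rewrite addr0.
have := pder_sum (index_enum _) (fun i => pderZ (dot b (p i)) (pder_coord (R := R) i)).
apply: eq_pder => [l|k l].
  by rewrite /pt dot_sumr; apply: eq_bigr => i _; rewrite dotZr mulrC.
rewrite (bigD1 k)//= eqxx mulr1 big1 ?addr0// => i /negbTE ik.
by rewrite eq_sym ik mulr0.
Qed.

Lemma has_grad_quadratic q : quadratic q ->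
  has_grad (fun l => q (pt p l)) (fun l => grad q (pt p l)).
Proof.
move=> [Q [b [c qE]]].
pose col k : 'rV[R]_d := \row_j Q j k.
have colE x k : (x *m Q) 0 k = dot (col k) x.
  by rewrite mxE /dot; apply: eq_bigr => j _; rewrite mxE mulrC.
have h k := has_gradM (has_grad_affine (col k) 0) (has_grad_affine (delta_mx 0 k) 0).
apply: eq_has_grad (has_gradD (has_grad_sum (index_enum _) h) (has_grad_affine b c)) => l.
  rewrite qE -addrA; congr (_ + _); rewrite [RHS]/dot; apply: eq_bigr => k _.
  by rewrite !addr0 colE [X in _ * X]dotC dot_delta.
rewrite (grad_formula qE); congr (_ + _); set x := pt p l.
apply/rowP => i; rewrite summxE mulmxDr [RHS]mxE.
under eq_bigr do rewrite !addr0 2!mxE [X in _ + X]mxE mxE.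
rewrite big_split /= [LHS]addrC; congr (_ + _).
  rewrite colE (bigD1 i)//= mxE !eqxx mulr1 big1 ?addr0// => k ki.
  by rewrite mxE eqxx eq_sym (negbTE ki) mulr0.
rewrite mxE; apply: eq_bigr => k _.
by rewrite dotC dot_delta !mxE.
Qed.

Lemma has_grad_grad_comp q k : quadratic q ->
  has_grad (fun l => grad q (pt p l) 0 k) (fun=> row k (hess q 0)).
Proof.
move=> /[dup] qq [Q [b [c qE]]].
have hE := hess_formula qE 0.
apply: eq_has_grad (has_grad_affine (row k (hess q 0)) (b 0 k)) => // l.
rewrite (grad_formula qE) mxE hE; congr (_ + _).
rewrite mxE /dot; apply: eq_bigr => j _; rewrite !mxE addrC; ring.
Qed.

Lemma polyf_affine f : affine f -> polyf (fun l => f (pt p l)).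
Proof.
move=> [b [c fE]]; have -> : (fun l => f (pt p l)) = (fun l => dot b (pt p l) + c).
  by apply/funext => l; rewrite fE.
exact: has_grad_polyf (has_grad_affine b c).
Qed.

Lemma polyf_quadratic q : quadratic q -> polyf (fun l => q (pt p l)).
Proof. by move=> /has_grad_quadratic/has_grad_polyf. Qed.

Lemma polyf_grad_dot q q' : quadratic q -> quadratic q' ->
  polyf (fun l => dot (grad q (pt p l)) (grad q' (pt p l))).
Proof.
move=> qq qq'; apply: polyf_sum => i; apply: polyfM.
  exact: has_grad_polyf (has_grad_grad_comp i qq).
exact: has_grad_polyf (has_grad_grad_comp i qq').
Qed.

Section Cell.
Variables (T : {set 'I_n}) (fT : full_cell p T).

Lemma smean_coord2 i j : i \in T -> j \in T ->
  smean T (fun l => l i * l j) = (1 + (i == j)%:R) / (d.+1 * d.+2)%:R :> R.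
Proof.
move=> iT jT; have Td : #|T| = d.+1 by have [] := fT.
have T0 : T != finset.set0 by rewrite -card_gt0 Td.
pose a k := ((k == i) + (k == j))%N.
transitivity (smean T (fun l => \sum_(m <- [:: tt]) 1 * \prod_k l k ^+ a k) : R).
  congr smean; apply/funext => l; rewrite big_seq1 mul1r.
  under eq_bigr do rewrite exprD.
  rewrite big_split /= (bigD1 i)//= eqxx expr1 big1 ?mulr1 => [|k /negbTE ->//].
  by congr (_ * _); rewrite (bigD1 j)//= eqxx expr1 big1 ?mulr1// => k /negbTE ->.
rewrite smean_monomials// big_seq1 mul1r /dirichlet Td /= ifT; last first.
  apply/forallP => k; have [//|kT] /= := boolP (k \in T); rewrite /a addn_eq0.
  by rewrite !eqb0; apply/andP; split; apply: contraNneq kT => ->.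
have -> : (\sum_k a k = 2)%N.
  rewrite big_split /= (bigD1 i)//= eqxx big1 => [|k /negbTE ->//].
  by rewrite (bigD1 j)//= eqxx big1 => [|k /negbTE ->//].
have -> : (\prod_k (a k)`! = (i == j).+1)%N.
  rewrite (bigD1 i)//= {1}/a eqxx; case: (eqVneq i j) => ij.
    by rewrite big1// => k /negbTE ki; rewrite /a -ij ki.
  by rewrite big1// => k /negbTE ki; rewrite /a ki; case: (k == j).
rewrite addnC addn2 !factS !natrM -natr1 [X in _ = X / _]addrC; field.
by rewrite factr_neq0 !gt_eqF//= ltr_pwDl ?ler0n.
Qed.

(** The mass matrix of the vertex basis is (I + 1 1^T) / ((d+1)(d+2)), and
    1 1^T is positive semidefinite. *)
Lemma vertex_values_le f : affine f ->
  \sum_(i in T) f (p i) ^+ 2 <= (d.+1 * d.+2)%:R * smean T (fun l => f (pt p l) ^+ 2).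
Proof.
move=> [b [c fE]]; have Td : #|T| = d.+1 by have [] := fT.
have T0 : T != finset.set0 by rewrite -card_gt0 Td.
have fl l : in_simplex T l -> f (pt p l) = \sum_(i in T) l i * f (p i).
  move=> [_ lT l1]; rewrite fE /pt dot_sumr -[c]mul1r -l1 mulr_suml -big_split /=.
  rewrite (bigID (mem T)) /= [X in _ + X]big1 ?addr0 => [|i iT]; last first.
    by rewrite lT// scale0r dot0r mul0r addr0.
  by apply: eq_bigr => i _; rewrite dotZr -mulrDr fE.
rewrite (@eq_smean _ _ _ _ (fun l => \sum_i \sum_j
   ((i \in T)%:R * (j \in T)%:R * f (p i) * f (p j)) * (l i * l j)))//; last first.
  move=> l lT; rewrite fl// big_mkcond expr2 mulr_suml; apply: eq_bigr => i _.
  rewrite mulr_sumr; apply: eq_bigr => j _.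
  by case: (i \in T); case: (j \in T); rewrite /= ?(mul0r, mulr0, mul1r)//; ring.
have pc (i j : 'I_n) : polyf (fun l => l i * l j : R).
  by apply: polyfM; apply: pder_polyf; exact: pder_coord.
rewrite smean_sum// => [|i]; last by apply: polyf_sum => j; apply: polyfZ.
have E i : smean T (fun l => \sum_j ((i \in T)%:R * (j \in T)%:R * f (p i) * f (p j)) * (l i * l j))
  = \sum_j ((i \in T)%:R * (j \in T)%:R * f (p i) * f (p j)) * ((1 + (i == j)%:R) / (d.+1 * d.+2)%:R).
  rewrite smean_sum// => [|j]; last exact: polyfZ.
  apply: eq_bigr => j _; rewrite smeanZ//.
  have [iT|iT] := boolP (i \in T); last by rewrite !mul0r.
  have [jT|jT] := boolP (j \in T); last by rewrite !(mulr0, mul0r).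
  by rewrite smean_coord2.
rewrite (eq_bigr _ (fun i _ => E i)) => {E}.
have N0 : (d.+1 * d.+2)%:R != 0 :> R by rewrite pnatr_eq0 muln_eq0.
have -> : \sum_i \sum_j ((i \in T)%:R * (j \in T)%:R * f (p i) * f (p j)) *
     ((1 + (i == j)%:R) / (d.+1 * d.+2)%:R) =
   ((\sum_i (i \in T)%:R * f (p i)) ^+ 2 + \sum_i ((i \in T)%:R * f (p i)) ^+ 2) / (d.+1 * d.+2)%:R.
  rewrite mulrDl expr2 mulr_suml !mulr_suml -big_split /=; apply: eq_bigr => i _.
  rewrite mulr_sumr.
  have -> : ((i \in T)%:R * f (p i)) ^+ 2 / (d.+1 * d.+2)%:R =
     \sum_j (i == j)%:R * (((i \in T)%:R * f (p i)) * ((j \in T)%:R * f (p j)) / (d.+1 * d.+2)%:R).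
    rewrite (bigD1 i)//= eqxx mul1r big1 ?addr0 ?expr2// => j /negbTE ji.
    by rewrite eq_sym ji mul0r.
  by rewrite mulr_suml -big_split /=; apply: eq_bigr => j _; ring.
rewrite mulrC divfK//.
have -> : \sum_(i in T) f (p i) ^+ 2 = \sum_i ((i \in T)%:R * f (p i)) ^+ 2.
  rewrite big_mkcond; apply: eq_bigr => i _.
  by case: (i \in T); rewrite ?mul1r// mul0r expr0n.
by rewrite lerDr sqr_ge0.
Qed.

(** The gradient of a quadratic is affine, so that its values at the vertices
    both bound it on the cell and are bounded by its mean square. *)
Definition grad_sup q : R := Num.sqrt (\sum_(i in T) dot (grad q (p i)) (grad q (p i))).

Lemma grad_sup_sqr q :
  grad_sup q ^+ 2 = \sum_(i in T) dot (grad q (p i)) (grad q (p i)).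
Proof. by rewrite sqr_sqrtr// sumr_ge0// => i _; exact: dotxx_ge0. Qed.

Lemma grad_sup_ge0 q : 0 <= grad_sup q.
Proof. exact: sqrtr_ge0. Qed.

Lemma grad_sup_le q : quadratic q ->
  grad_sup q ^+ 2 <= (d.+1 * d.+2)%:R *
    smean T (fun l => dot (grad q (pt p l)) (grad q (pt p l))).
Proof.
move=> qq; have Td : #|T| = d.+1 by have [] := fT.
have T0 : T != finset.set0 by rewrite -card_gt0 Td.
rewrite grad_sup_sqr /dot exchange_big /=.
rewrite (@smean_sum _ _ T _ _ (fun k l => grad q (pt p l) 0 k * grad q (pt p l) 0 k))//; last first.
  by move=> k; apply: polyfM; exact: has_grad_polyf (has_grad_grad_comp k qq).
rewrite mulr_sumr; apply: ler_sum => k _.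
exact: (vertex_values_le (quadratic_grad_comp k qq)).
Qed.

Lemma grad_le_sup q x : quadratic q -> hull p T x -> enorm (grad q x) <= grad_sup q.
Proof.
move=> qq Tx.
have -> : grad q x = \sum_(i in T) bary p T i x *: grad q (p i).
  have E i : grad q (p i) = grad q x + (p i - x) *m hess q 0 by exact: grad_shift.
  under eq_bigr do rewrite E scalerDr.
  rewrite big_split /= -scaler_suml.
  have -> : \sum_(i in T) bary p T i x = 1.
    rewrite -(sum_bary fT x) [RHS](bigID (mem T)) /= [X in _ = _ + X]big1 ?addr0//.
    by move=> i iT; rewrite bary_out.
  under eq_bigr do rewrite scalemxAl.
  rewrite -mulmx_suml.
  have -> : \sum_(i in T) bary p T i x *: (p i - x) = 0.
    rewrite big_mkcond /=.
    transitivity (\sum_i (bary p T i x *: p i - bary p T i x *: x)).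
      apply: eq_bigr => i _; case: ifPn => iT; rewrite ?scalerBr//.
      by rewrite bary_out// !scale0r subrr.
    rewrite sumrB -scaler_suml sum_bary// scale1r.
    by have := pt_bary fT x; rewrite /pt => ->; rewrite subrr.
  by rewrite mul0mx addr0 scale1r.
apply: le_trans (enorm_sum _ _ _) _.
have b0 i : 0 <= bary p T i x by move: i; exact/(hullP fT).
apply: (@le_trans _ _ (\sum_(i in T) bary p T i x * grad_sup q)).
  apply: ler_sum => i iT; rewrite enormZ ger0_norm//; apply: ler_wpM2l => //.
  rewrite -(@ler_pXn2r _ 2) ?nnegrE ?enorm_ge0 ?grad_sup_ge0// enorm_sqr grad_sup_sqr.
  by rewrite (bigD1 i)//= lerDl sumr_ge0// => j _; exact: dotxx_ge0.
rewrite -mulr_suml ler_piMl ?grad_sup_ge0// -(sum_bary fT x).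
by rewrite [leRHS](bigID (mem T)) /= lerDl sumr_ge0.
Qed.

Lemma quadratic_lipschitz q x y : quadratic q -> hull p T x -> hull p T y ->
  `|q x - q y| <= grad_sup q * diam (hull p T).
Proof.
move=> qq Tx Ty; rewrite (quadratic_midpoint _ _ qq); apply: le_trans (dot_le _ _) _.
apply: ler_pM; rewrite ?enorm_ge0 ?enorm_le_diam//.
apply: grad_le_sup => //.
have -> : 2^-1 *: (y + x) = 2^-1 *: y + (1 - 2^-1) *: x.
  by rewrite scalerDr; congr (_ + _ *: _); lra.
by apply: hull_convex => //; apply/andP; split; lra.
Qed.

Lemma sqr_value_le q x y : quadratic q -> hull p T x -> hull p T y ->
  q x ^+ 2 <= 2 * q y ^+ 2 + 2 * (grad_sup q * diam (hull p T)) ^+ 2.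
Proof.
move=> qq Tx Ty; have -> : q x = q y + (q x - q y) by ring.
apply: le_trans (sqrD_le _ _) _; rewrite lerD2l ler_pM2l//.
exact/sqr_le_of_norm/quadratic_lipschitz.
Qed.

(** A value of a quadratic is controlled by its mean square, at the price of the
   oscillation of the polynomial over the cell. *)
Lemma sqr_value_le_mean q x : quadratic q -> hull p T x ->
  q x ^+ 2 <= 2 * smean T (fun l => q (pt p l) ^+ 2) +
    2 * (grad_sup q * diam (hull p T)) ^+ 2.
Proof.
move=> qq Tx; have Td : #|T| = d.+1 by have [] := fT.
have T0 : T != finset.set0 by rewrite -card_gt0 Td.
have pq2 : polyf (fun l => q (pt p l) ^+ 2) by apply: polyfX; exact: polyf_quadratic.
rewrite -[X in 2 * X + _]mul1r -(smean_cst (2 * (grad_sup q * diam (hull p T)) ^+ 2) T0) mul1r.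
rewrite -smean_lin//; last exact: polyf_cst.
rewrite -[leLHS](smean_cst _ T0); apply: ler_smean => //; first exact: polyf_cst.
  by apply: polyfD; [exact: polyfZ | exact: polyf_cst].
by move=> l lT; apply: sqr_value_le => //; exact: hull_pt.
Qed.

End Cell.

End CellCalculus.

(** * Green's formulas on the mesh *)

Section Green.
Context {R : realType} {d' : nat} {Omega : set 'rV[R]_d'.+1}.
Local Notation d := d'.+1.
Variables (hOmega : convex_polytope_domain Omega) (Th : triangulation Omega).
Local Notation simplex := {set 'I_(nvert Th)}.
Local Notation p := (vertex (t := Th)).
Local Notation adjacent := (Defs.adjacent (Th := Th)).
Implicit Types (A T e : simplex) (x : 'rV[R]_d) (v : 'rV[R]_d -> R) (l : 'I_(nvert Th) -> R).

Lemma cell_set0 T : T \in cells Th -> T != finset.set0.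
Proof. by move=> /cell_full/cell_neq0. Qed.

Lemma meas_ge0 e : 0 <= meas e.
Proof. exact: vol_ge0. Qed.

Lemma meas_cell_gt0 T : T \in cells Th -> 0 < meas T.
Proof. by move=> TTh; exact: vol_cell_gt0 (cell_full TTh). Qed.

(** Each component of the field is differentiated along one axis, where the
    weights u_i of the divergence theorem in barycentric coordinates are the
    entries of the barycentric gradients. *)
Lemma divergence_cell T (F : 'I_d -> ('I_(nvert Th) -> R) -> R) G : T \in cells Th ->
  (forall k, has_grad p (F k) (G k)) ->
  meas T * smean T (fun l => \sum_k G k l 0 k) =
  \sum_(i in T) meas (T :\ i)%SET *
    smean (T :\ i)%SET (fun l => \sum_k F k l * outward_normal T (T :\ i)%SET 0 k).
Proof.
move=> TTh FG; have fT := cell_full TTh; have T0 := cell_set0 TTh.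
have gE (w : 'rV[R]_d) k : \sum_i bgrad p T i 0 k * dot w (p i) = w 0 k.
  rewrite -[RHS]dot_delta -(bgrad_vertices fT (delta_mx 0 k)) dot_sumr.
  by apply: eq_bigr => i _; rewrite dotZr dot_delta.
transitivity (\sum_k meas T * smean T (fun l => \sum_i bgrad p T i 0 k * dot (G k l) (p i))).
  rewrite -mulr_sumr -smean_sum//.
    congr (_ * smean _ _); apply/funext => l; apply: eq_bigr => k _.
    by rewrite gE.
  move=> k; apply: polyf_sum => i; apply: polyfZ.
  exact: (pder_polyf_der i (FG k)).
have step k : meas T * smean T (fun l => \sum_i bgrad p T i 0 k * dot (G k l) (p i)) =
    \sum_(i in T) (meas (T :\ i)%SET *: outward_normal T (T :\ i)%SET) 0 k * smean (T :\ i)%SET (F k).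
  rewrite (smean_divergence (d := d) (card_full_cell fT) _ (FG k) (u := fun i => bgrad p T i 0 k))//.
  - rewrite mulrCA !mulr_sumr; apply: eq_bigr => i iT.
    by rewrite meas_normal// mxE; ring.
  - by move=> i iT; rewrite bgrad_out// mxE.
  - by have := sum_bgrad fT => /rowP/(_ k); rewrite summxE mxE.
rewrite (eq_bigr _ (fun k _ => step k)) exchange_big /=; apply: eq_bigr => i iT.
have f0 := face_neq0 fT iT.
under eq_bigr do rewrite mxE -mulrA.
rewrite -mulr_sumr smean_sum//; last first.
  move=> k; apply: polyfM; last exact: polyf_cst.
  exact: has_grad_polyf (FG k).
congr (_ * _); apply: eq_bigr => k _.
rewrite -smeanZ//; last exact: has_grad_polyf (FG k).
by congr smean; apply/funext => l; rewrite mulrC.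
Qed.

(** A face with a single adjacent cell lies on the boundary: the points just
   behind an interior point of the face would be covered by another cell, which
   would then contain the whole face. *)
Lemma boundary_face e x : e \in faces Th -> e \notin interior_faces Th ->
  geom e x -> ~ Omega x.
Proof.
move=> ef eI ex Ox; have e0 := face_neq_set0 ef.
have /adjacentP[TTh eT] := cell_minus_adjacent ef.
set T := cell_minus e in TTh eT; have fT := cell_full TTh.
have [k kT E] := face_opposite TTh ef eT.
pose b : 'I_(nvert Th) -> R := fun i => (i \in e)%:R / #|e|%:R.
have be : in_simplex e b by exact: barycenter_coord.
have c0 : 0 < #|e|%:R :> R by rewrite ltr0n card_gt0.
have [r r0 hr] := @interior_line _ _ Omega x (pt p b - x) ((domain_open hOmega) _ Ox).
pose s : R := Num.min (r / 2) 1.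
have s0 : 0 < s by rewrite lt_min divr_gt0//= ltr01.
have s1 : s <= 1 by rewrite ge_min lexx orbT.
have sr : `|s| < r.
  rewrite gtr0_norm// gt_min; apply/orP; left.
  by rewrite ltr_pdivrMr// ltr_pMr// ltr1n.
pose y := x + s *: (pt p b - x).
have Oy : Omega y by exact: hr.
have [l le xE] := (hull_ptP p e x).1 ex.
pose m i := s * b i + (1 - s) * l i.
have yE : y = pt p m.
  rewrite /y xE /m /pt scalerBr addrCA -[X in _ + (X - _)]scale1r -scalerBl.
  by rewrite !scaler_sumr -big_split; apply: eq_bigr => i _; rewrite scalerDl !scalerA.
have [l0 lout l1] := le; have [b0 bout b1] := be.
have mout j : j \notin T -> m j = 0.
  move=> jT; have je : j \notin e by apply: contra jT; exact: fintype.subsetP.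
  by rewrite /m lout// bout// !mulr0 addr0.
have m1 : \sum_i m i = 1 by rewrite big_split -!mulr_sumr l1 b1 /=; ring.
have ym i : bary p T i y = m i by rewrite yE bary_pt.
have mpos i : i \in e -> 0 < m i.
  move=> ie; apply: ltr_wpDr; first by rewrite mulr_ge0// subr_ge0.
  by rewrite mulr_gt0// /b ie divr_gt0.
have yk : bary p T k y = 0.
  by rewrite ym /m lout ?bout ?mulr0 ?addr0// E !inE eqxx.
have Ty : geom T y.
  apply/(hullP fT) => i; rewrite ym; have [ie|ie] := boolP (i \in e); first exact/ltW/mpos.
  by rewrite /m lout// bout// !mulr0 addr0.
pose U := \bigcup_(T' in [set` (cells Th :\ T)%SET]) geom T'.
have cU : closed U.
  apply: closed_bigcup; first exact: finite_finset.
  by move=> T' _; exact: hull_closed.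
have Uy : U y.
  apply: contrapT => nU.
  have [r1 r10 h1] := @interior_line _ _ (~` U) y (- bgrad p T k) ((closed_openC cU) _ nU).
  have [r2 r20 h2] := @interior_line _ _ Omega y (- bgrad p T k) ((domain_open hOmega) _ Oy).
  pose t : R := Num.min r1 r2 / 2.
  have m0 : 0 < Num.min r1 r2 by rewrite lt_min r10.
  have t0 : 0 < t by rewrite divr_gt0.
  have tm : t < Num.min r1 r2 by rewrite ltr_pdivrMr// ltr_pMr// ltr1n.
  have [t1 t2] : `|t| < r1 /\ `|t| < r2.
    by move: tm; rewrite gtr0_norm// lt_min => /andP[].
  have : closure Omega (y + t *: - bgrad p T k) by apply: subset_closure; exact: h2.
  rewrite (cells_cover Th) => -[T' /= T'Th T'y].
  have [TE|TT'] := eqVneq T' T.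
    move: T'y; rewrite TE => /(hullP fT)/(_ k).
    rewrite baryD yk add0r scalerN dotNr dotZr oppr_ge0 pmulr_rle0//.
    have g0 := bgrad_diam_ge1 fT kT.
    rewrite le_eqVlt ltNge dotxx_ge0 orbF dotxx_eq0 => /eqP h.
    by move: g0; rewrite h enorm0 mul0r ler10.
  apply: (h1 _ t1); exists T' => //=.
  by rewrite !inE TT'.
have [T' /=] := Uy; rewrite !inE => /andP[TT' T'Th] T'y.
have eT' : e \subset T'.
  apply/fintype.subsetP => i ie; apply: (common_support TTh T'Th Ty T'y).
  by rewrite ym gt_eqF// mpos.
have := sum_adjacent_boundary (fun T0 => (T0 == T')%:R : R) ef eI.
rewrite (bigD1 T') /=; last by apply/adjacentP.
rewrite eqxx -/T [in RHS]eq_sym (negbTE TT') big1 => [|T0 /andP[_ /negbTE ->]//].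
by rewrite addr0 => /eqP; rewrite oner_eq0.
Qed.

Section Function.
Variables (v : 'rV[R]_d -> R) (vV : v \in fe_space Th).

Lemma pieceE T x : T \in cells Th -> geom T x -> piece v T x = v x.
Proof. by move=> TTh Tx; have [_ ->] := piece_spec vV TTh. Qed.

Lemma piece_quadratic T : T \in cells Th -> quadratic (piece v T).
Proof. by move=> TTh; have [] := piece_spec vV TTh. Qed.

Lemma fe_boundary e x : e \in faces Th -> e \notin interior_faces Th ->
  geom e x -> v x = 0.
Proof.
move=> ef eI ex; have [_ + _] := (fe_spaceP Th v).1 vV; apply.
exact: boundary_face ex.
Qed.

Lemma face_piece T e l : T \in cells Th -> e \subset T -> in_simplex e l ->
  piece v T (pt p l) = v (pt p l).
Proof.
by move=> TTh eT le; apply: pieceE => //; apply: hull_pt; exact: in_simplexS le.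
Qed.

Definition cell_L2 T : R := meas T * smean T (fun l => piece v T (pt p l) ^+ 2).
Definition cell_H1 T : R := meas T * smean T (fun l =>
  dot (grad (piece v T) (pt p l)) (grad (piece v T) (pt p l))).
Definition cell_lap T : R := laplacian (piece v T).
Definition normal_jump e l : R := dot (grad_jump v e (pt p l)) (face_normal e).
Definition face_jump2 e : R := meas e * smean e (fun l => normal_jump e l ^+ 2).

Lemma cell_L2_ge0 T : T \in cells Th -> 0 <= cell_L2 T.
Proof.
move=> TTh; rewrite mulr_ge0 ?meas_ge0//; apply: smean_ge0; first exact: cell_set0.
by move=> l _; exact: sqr_ge0.
Qed.

Lemma cell_H1_ge0 T : T \in cells Th -> 0 <= cell_H1 T.
Proof.
move=> TTh; rewrite mulr_ge0 ?meas_ge0//; apply: smean_ge0; first exact: cell_set0.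
by move=> l _; exact: dotxx_ge0.
Qed.

Lemma face_jump2_ge0 e : e \in faces Th -> 0 <= face_jump2 e.
Proof.
move=> ef; rewrite mulr_ge0 ?meas_ge0//; apply: smean_ge0; first exact: face_neq_set0.
by move=> l _; exact: sqr_ge0.
Qed.

Lemma polyf_normal_jump e : e \in interior_faces Th -> polyf (normal_jump e).
Proof. by move=> eI; exact: (@polyf_affine _ _ _ p _ (grad_jump_affine (face_normal e) vV eI)). Qed.

Lemma normal_jumpE e l : normal_jump e l =
  dot (grad (piece v (cell_plus e)) (pt p l)) (face_normal e) -
  dot (grad (piece v (cell_minus e)) (pt p l)) (face_normal e).
Proof. by rewrite /normal_jump /grad_jump dotBl. Qed.

(** The flux of x_0 v^2 through a face has opposite values seen from both sides,
   since v is continuous, and vanishes on the boundary. *)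
Lemma green_first_coord :
  \sum_(T in cells Th) meas T * smean T (fun l => piece v T (pt p l) ^+ 2 +
    2 * (pt p l 0 0 * piece v T (pt p l) * grad (piece v T) (pt p l) 0 0)) = 0.
Proof.
pose F T (k : 'I_d) l : R := if k == 0 then pt p l 0 0 * (piece v T (pt p l) * piece v T (pt p l)) else 0.
pose G T (k : 'I_d) l : 'rV[R]_d := if k == 0 then
   (piece v T (pt p l) * piece v T (pt p l)) *: delta_mx 0 0 + pt p l 0 0 *:
     (piece v T (pt p l) *: grad (piece v T) (pt p l) + piece v T (pt p l) *: grad (piece v T) (pt p l))
   else 0.
have FG T k : T \in cells Th -> has_grad p (F T k) (G T k).
  move=> TTh; rewrite /F /G; case: eqP => _; last exact: has_grad_cst.
  have hq := has_grad_quadratic p (piece_quadratic TTh).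
  apply: has_gradM (has_gradM hq hq).
  apply: eq_has_grad (has_grad_affine p (delta_mx 0 0) 0) => // l.
  by rewrite addr0 dotC dot_delta.
transitivity (\sum_(T in cells Th) \sum_(i in T) meas (T :\ i)%SET *
    smean (T :\ i)%SET (fun l => \sum_k F T k l * outward_normal T (T :\ i)%SET 0 k)).
  apply: eq_bigr => T TTh; rewrite -(divergence_cell TTh (fun k => FG T k TTh)).
  congr (_ * smean _ _); apply/funext => l.
  rewrite (bigD1 0)//= big1 ?addr0 => [|k /negbTE k0]; last by rewrite /G k0 mxE.
  by rewrite /G eqxx !mxE eqxx /=; ring.
rewrite (sum_cells_faces (fun T e => meas e * smean e (fun l => \sum_k F T k l * outward_normal T e 0 k))).
apply: big1 => e ef; have e0 := face_neq_set0 ef.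
pose W n l : R := pt p l 0 0 * (v (pt p l) * v (pt p l)) * n.
have E T : T \in adjacent e -> smean e (fun l => \sum_k F T k l * outward_normal T e 0 k) =
    smean e (W (outward_normal T e 0 0)).
  move=> /adjacentP[TTh eT]; apply: eq_smean => // l le.
  rewrite (bigD1 0)//= big1 ?addr0 => [|k /negbTE k0]; last by rewrite /F k0 mul0r.
  by rewrite /F eqxx (face_piece TTh eT le).
have [eI|eI] := boolP (e \in interior_faces Th); last first.
  rewrite sum_adjacent_boundary// E ?cell_minus_adjacent//.
  rewrite (@eq_smean _ _ _ _ (fun=> 0))// ?smean_cst ?mulr0// => l le.
  by rewrite /W (fe_boundary ef eI) ?mulr0 ?mul0r//; exact: hull_pt.
rewrite sum_adjacent_interior// !E ?cell_minus_adjacent//; last by have [] := cell_plus_adjacent eI.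
rewrite normal_plus// -mulrDr mxE.
have /adjacentP[mTh em] := cell_minus_adjacent ef.
pose X l : R := pt p l 0 0 * (piece v (cell_minus e) (pt p l) * piece v (cell_minus e) (pt p l)).
have pX : polyf X.
  have := FG _ 0 mTh; rewrite /F /= => /has_grad_polyf; exact.
have WX n : smean e (W n) = n * smean e X.
  rewrite -smeanZ//; apply: eq_smean => // l le.
  by rewrite /W /X (face_piece mTh em le) mulrC.
by rewrite !WX mulNr -/(face_normal e) addrC addNr mulr0.
Qed.

(** Green's formula for v grad v: the interior faces only see the jumps. *)
Lemma green_energy :
  \sum_(T in cells Th) (cell_H1 T + meas T * smean T (fun l => cell_lap T * piece v T (pt p l))) =
  - \sum_(e in interior_faces Th)
      meas e * smean e (fun l => piece v (cell_minus e) (pt p l) * normal_jump e l).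
Proof.
pose q T := piece v T.
have hg T k (TTh : T \in cells Th) := has_gradM (has_grad_quadratic p (piece_quadratic TTh))
   (has_grad_grad_comp p k (piece_quadratic TTh)).
have pq T : T \in cells Th -> polyf (fun l => q T (pt p l)).
  by move=> TTh; apply: polyf_quadratic; exact: piece_quadratic.
transitivity (\sum_(T in cells Th) \sum_(i in T) meas (T :\ i)%SET *
    smean (T :\ i)%SET (fun l => \sum_k (q T (pt p l) * grad (q T) (pt p l) 0 k) *
       outward_normal T (T :\ i)%SET 0 k)).
  apply: eq_bigr => T TTh; have T0 := cell_set0 TTh; have qq := piece_quadratic TTh.
  rewrite -(divergence_cell TTh (fun k => hg T k TTh)) /cell_H1 -mulrDr -smeanD//.
  - congr (_ * smean _ _); apply/funext => l.
    rewrite /dot /cell_lap /laplacian /mxtrace mulr_suml -big_split /=.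
    by apply: eq_bigr => k _; move: (grad _ _) (hess _ _) => g H; rewrite !mxE; ring.
  - exact: polyf_grad_dot.
  - by apply: polyfZ; exact: pq.
rewrite (sum_cells_faces (fun T e => meas e * smean e (fun l => \sum_k (q T (pt p l) *
   grad (q T) (pt p l) 0 k) * outward_normal T e 0 k))).
rewrite (bigID (mem (interior_faces Th))) /= [X in _ + X]big1 ?addr0; last first.
  move=> e /andP[ef eI]; rewrite sum_adjacent_boundary//; have e0 := face_neq_set0 ef.
  have /adjacentP[mTh em] := cell_minus_adjacent ef.
  rewrite (@eq_smean _ _ _ _ (fun=> 0))// ?smean_cst ?mulr0// => l le.
  rewrite big1// => k _; rewrite /q (face_piece mTh em le) (fe_boundary ef eI) ?mul0r//.
  exact: hull_pt.
rewrite -sumrN; rewrite (eq_bigl (mem (interior_faces Th))); last first.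
  by move=> e; rewrite /=; case eI: (e \in interior_faces Th); rewrite ?andbF// interior_face.
apply: eq_bigr => e eI; have ef := interior_face eI; have e0 := face_neq_set0 ef.
have /adjacentP[mTh em] := cell_minus_adjacent ef.
have [/adjacentP[pTh ep] _] := cell_plus_adjacent eI.
rewrite sum_adjacent_interior// normal_plus// -/(face_normal e) -mulrDr -mulrN; congr (_ * _).
rewrite -smeanD//; last 2 first.
- by apply: polyf_sum => k; apply: polyfM; [exact: has_grad_polyf (hg _ k mTh) | exact: polyf_cst].
- by apply: polyf_sum => k; apply: polyfM; [exact: has_grad_polyf (hg _ k pTh) | exact: polyf_cst].
rewrite -mulN1r -smeanZ//; last by apply: polyfM; [exact: pq | exact: polyf_normal_jump].
apply: eq_smean => // l le.
rewrite normal_jumpE /dot /q (face_piece mTh em le) (face_piece pTh ep le).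
rewrite -sumrB mulr_sumr mulr_sumr -big_split /=; apply: eq_bigr => k _.
by rewrite [(- face_normal e) 0 k]mxE; ring.
Qed.

(** The weak Laplacian differs from the Laplacian by half of the jumps, because
   on a face the mean gradient differs by half of the jump from the gradient of
   either side. *)
Lemma weak_laplacian_lap T : T \in cells Th ->
  meas T * (weak_laplacian v T - cell_lap T) =
  2^-1 * \sum_(e in interior_faces Th | e \subset T) meas e * smean e (normal_jump e).
Proof.
move=> TTh; have T0 := cell_set0 TTh; have qq := piece_quadratic TTh.
have m0 : meas T != 0 by rewrite gt_eqF// meas_cell_gt0.
have lapE : meas T * cell_lap T = \sum_(e in faces Th | e \subset T) meas e *
    smean e (fun l => dot (grad (piece v T) (pt p l)) (outward_normal T e)).
  rewrite -(sum_opposite_faces (fun e => meas e *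
    smean e (fun l => dot (grad (piece v T) (pt p l)) (outward_normal T e))) TTh).
  rewrite -[LHS](_ : meas T * smean T (fun=> cell_lap T) = _); last by rewrite smean_cst.
  rewrite -(divergence_cell TTh (fun k => has_grad_grad_comp p k qq)).
  congr (_ * smean _ _); apply/funext => l.
  by rewrite /cell_lap /laplacian /mxtrace; apply: eq_bigr => k _; rewrite [RHS]mxE.
rewrite mulrBr {1}/weak_laplacian mulVKf// lapE -sumrB.
rewrite (bigID (mem (interior_faces Th))) /= [X in _ + X]big1 ?addr0; last first.
  move=> e /andP[/andP[ef eT] eI]; rewrite integral_onE ?face_neq_set0//.
  apply/eqP; rewrite subr_eq0 /grad_avg (negbTE eI) /grad_on; apply/eqP.
  have := sum_adjacent_boundary (fun T0 => (T0 == T)%:R : R) ef eI.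
  rewrite (bigD1 T) /=; last by apply/adjacentP.
  rewrite eqxx big1 ?addr0 => [|T' /andP[_ /negbTE ->]//].
  by case: eqP => [->//|_ /eqP]; rewrite oner_eq0.
rewrite mulr_sumr; apply: eq_big => [e|e /andP[/andP[ef eT] eI]].
  by case eI: (e \in interior_faces Th); rewrite ?andbF ?andbT// interior_face.
have e0 := face_neq_set0 ef.
have /adjacentP[mTh em] := cell_minus_adjacent ef.
have [/adjacentP[pTh ep] _] := cell_plus_adjacent eI.
rewrite integral_onE// -mulrBr mulrCA; congr (_ * _).
have pg T' w : T' \in cells Th -> polyf (fun l => dot (grad (piece v T') (pt p l)) w).
  move=> TTh'; apply: (@polyf_affine _ _ _ p (fun x => dot (grad (piece v T') x) w)).
  by apply: grad_quadratic; exact: piece_quadratic.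
rewrite -(smeanZ _ e0 (polyf_normal_jump eI)).
have pa : polyf (fun l => dot (grad_avg v e (pt p l)) (outward_normal T e)).
  apply: (@polyf_affine _ _ _ p (fun x => dot (grad_avg v e x) (outward_normal T e))).
  exact: grad_avg_affine.
rewrite -mulN1r addrC -(smean_lin _ e0 (pg T _ TTh) pa).
congr smean; apply/funext => l; rewrite normal_jumpE /grad_avg eI /grad_on dotZl dotDl.
have [->|->] := adjacent_interior eI (introT (adjacentP T e) (conj TTh eT)).
  by rewrite -/(face_normal e); field.
by rewrite normal_plus// !dotNr; field.
Qed.

End Function.

End Green.

(** * The mesh-dependent norm *)

Section MeshNorm.
Context {R : realType} {d' : nat} {Omega : set 'rV[R]_d'.+1}.
Local Notation d := d'.+1.
Variables (hOmega : convex_polytope_domain Omega) (Th : triangulation Omega).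
Variables (sigma B : R) (hd : (0 < d')%N) (hsigma : 0 < sigma) (hB : 0 < B).
Hypothesis regular : shape_regular Th sigma.
Hypothesis bounded : forall x, closure Omega x -> enorm x <= B.
Local Notation simplex := {set 'I_(nvert Th)}.
Local Notation p := (vertex (t := Th)).
Local Notation adjacent := (Defs.adjacent (Th := Th)).
Local Notation h T := (diam (geom (Th := Th) T)).
Implicit Types (A T e : simplex) (x : 'rV[R]_d) (v : 'rV[R]_d -> R) (l : 'I_(nvert Th) -> R).

Lemma h_gt0 T : T \in cells Th -> 0 < h T.
Proof. by move=> TTh; exact: diam_cell_gt0 (cell_full TTh). Qed.

Lemma h_le T : T \in cells Th -> h T <= 2 * B.
Proof.
move=> TTh; apply: ge_sup.
  have /set0Pn[k kT] := cell_set0 TTh.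
  by exists (enorm (p k - p k)), (p k); [exact: hull_vertex | exists (p k); [exact: hull_vertex|]].
move=> _ [x Tx [y Ty <-]]; apply: le_trans (enormD _ _) _; rewrite enormN.
have := bounded (cell_in_closure TTh Tx); have := bounded (cell_in_closure TTh Ty); lra.
Qed.

Lemma powR_root (a x : R) : 0 <= a -> 0 <= x ->
  (a * x ^+ d') `^ (d'%:R^-1) = a `^ (d'%:R^-1) * x.
Proof.
move=> a0 x0; rewrite powRM ?exprn_ge0//; congr (_ * _).
by rewrite -powR_mulrn// -powRrM mulfV ?powRr1// pnatr_eq0 -lt0n.
Qed.

(** The measure of a face is of the order of h^(d-1), so that its (d-1)-th
    root h_e is of the order of h; face_low and face_up are the constants of
    this equivalence. *)
Definition face_low : R := (d%:R / (d`!%:R ^+ 2 * sigma ^+ d)) `^ (d'%:R^-1).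
Definition face_up : R := (d%:R * sigma) `^ (d'%:R^-1).

Lemma face_low_gt0 : 0 < face_low.
Proof. by rewrite powR_gt0 // divr_gt0 ?mulr_gt0 ?exprn_gt0 ?ltr0n ?fact_gt0. Qed.

Lemma face_up_gt0 : 0 < face_up.
Proof. by rewrite powR_gt0 // mulr_gt0 ?ltr0n. Qed.

Lemma face_diam_ge T k : T \in cells Th -> k \in T ->
  face_low * h T <= face_diam (T :\ k)%SET.
Proof.
move=> TTh kT; have fT := cell_full TTh; have h0 := h_gt0 TTh.
have a0 : 0 < d`!%:R ^+ 2 * sigma ^+ d by rewrite mulr_gt0 ?exprn_gt0 ?ltr0n ?fact_gt0.
rewrite /face_low -powR_root ?(ltW h0)//; last by rewrite divr_ge0 ?ltW ?ltr0n.
rewrite /face_diam /=; apply: ge0_ler_powR; rewrite ?nnegrE ?invr_ge0 ?ler0n ?meas_ge0//.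
  by rewrite mulr_ge0 ?divr_ge0 ?exprn_ge0 ?(ltW a0) ?(ltW h0) ?ler0n.
rewrite -(ler_pM2r h0) -mulrA -exprSr.
apply: le_trans (vol_face_ge fT kT).
have := vol_ge fT (regular TTh) (ltW hsigma); rewrite -/(geom T) => H.
rewrite mulrAC -[_ * _ / _]mulrA ler_wpM2l ?ler0n// ler_pdivrMr//.
by rewrite [leRHS]mulrC.
Qed.

Lemma face_diam_le T k : T \in cells Th -> k \in T ->
  face_diam (T :\ k)%SET <= face_up * h T.
Proof.
move=> TTh kT; have fT := cell_full TTh; have h0 := h_gt0 TTh.
rewrite /face_up -powR_root ?(ltW h0)//; last by rewrite mulr_ge0 ?ler0n ?(ltW hsigma).
rewrite /face_diam /=; apply: ge0_ler_powR; rewrite ?nnegrE ?invr_ge0 ?ler0n ?meas_ge0//.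
  by rewrite !mulr_ge0 ?exprn_ge0 ?(ltW hsigma) ?(ltW h0) ?ler0n.
rewrite -(ler_pM2r h0) -[leRHS]mulrA -exprSr.
apply: le_trans (vol_face_le fT (regular TTh) kT (ltW hsigma)) _.
by rewrite ler_wpM2l ?mulr_ge0 ?ler0n ?(ltW hsigma)//; exact: vol_le.
Qed.

Lemma face_diam_gt0 e : e \in faces Th -> 0 < face_diam e.
Proof.
move=> /faceP[T [k [TTh kT ->]]]; apply: lt_le_trans (face_diam_ge TTh kT).
by rewrite mulr_gt0 ?face_low_gt0 ?h_gt0.
Qed.

Lemma meas_face_diam T e : T \in cells Th -> e \in faces Th -> e \subset T ->
  meas e * face_diam e <= face_up * d%:R * sigma * meas T.
Proof.
move=> TTh ef eT; have [k kT ->] := face_opposite TTh ef eT.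
have fT := cell_full TTh.
apply: le_trans (ler_wpM2l (meas_ge0 _) (face_diam_le TTh kT)) _.
have := ler_wpM2l (ltW face_up_gt0) (vol_face_le fT (regular TTh) kT (ltW hsigma)).
by rewrite mulrCA !mulrA.
Qed.

Lemma meas_face_inv_diam T e : T \in cells Th -> e \in faces Th -> e \subset T ->
  (face_diam e)^-1 * meas e <= d%:R * sigma / face_low * (meas T / h T ^+ 2).
Proof.
move=> TTh ef eT; have [k kT E] := face_opposite TTh ef eT.
have fT := cell_full TTh; have h0 := h_gt0 TTh; have f0 := face_diam_gt0 ef.
have l0 := face_low_gt0.
have H1 : (face_diam e)^-1 <= (face_low * h T)^-1.
  by rewrite lef_pV2 ?posrE ?mulr_gt0// E face_diam_ge.
have H2 : meas e <= d%:R * sigma * meas T / h T.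
  by rewrite ler_pdivlMr// E; exact: (vol_face_le fT (regular TTh) kT (ltW hsigma)).
apply: le_trans (ler_pM _ _ H1 H2) _; rewrite ?meas_ge0 ?invr_ge0 ?(ltW f0)//.
by rewrite le_eqVlt; apply/orP; left; apply/eqP; field; rewrite !gt_eqF.
Qed.

(** Every cell has d+1 faces. *)
Lemma sum_interior_cells (F : simplex -> R) : (forall T, T \in cells Th -> 0 <= F T) ->
  \sum_(e in interior_faces Th) (F (cell_minus e) + F (cell_plus e)) <=
  d.+1%:R * \sum_(T in cells Th) F T.
Proof.
move=> F0.
have -> : d.+1%:R * \sum_(T in cells Th) F T = \sum_(e in faces Th) \sum_(T in adjacent e) F T.
  rewrite -(sum_cells_faces (fun T _ => F T)) mulr_sumr; apply: eq_bigr => T TTh.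
  by rewrite sumr_const (card_cell TTh) mulr_natl.
rewrite [leRHS](bigID (mem (interior_faces Th))) /= -[leLHS]addr0; apply: lerD; last first.
  by apply: sumr_ge0 => e _; apply: sumr_ge0 => T /adjacentP[TTh _]; exact: F0.
rewrite [leRHS](eq_bigl (mem (interior_faces Th))); last first.
  by move=> e; rewrite /=; case eI: (e \in interior_faces Th); rewrite ?andbF// interior_face.
by apply: ler_sum => e eI; rewrite sum_adjacent_interior.
Qed.

Lemma sum_interior_adjacent (F : simplex -> R) : (forall T, T \in cells Th -> 0 <= F T) ->
  \sum_(e in interior_faces Th) F (cell_minus e) <= d.+1%:R * \sum_(T in cells Th) F T.
Proof.
move=> F0; apply: le_trans (sum_interior_cells F0); apply: ler_sum => e eI.
by rewrite lerDl F0//; have [/adjacentP[]] := cell_plus_adjacent eI.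
Qed.

Section Function.
Variables (v : 'rV[R]_d -> R) (vV : v \in fe_space Th).

Definition lap_energy : R := \sum_(T in cells Th) meas T * cell_lap v T ^+ 2.
Definition jump_energy : R :=
  \sum_(e in interior_faces Th) (face_diam e)^-1 * face_jump2 v e.
(** The square of a norm in which the weak Laplacian is replaced by the
    elementwise Laplacian. Each of its terms depends on one cell, or on the
    two cells of one face, which makes it easy to localize. *)
Definition mesh_norm2 : R := lap_energy + jump_energy.
Definition L2_norm2 : R := \sum_(T in cells Th) cell_L2 v T.
Definition H1_norm2 : R := \sum_(T in cells Th) cell_H1 v T.

Lemma lap_energy_ge0 : 0 <= lap_energy.
Proof. by apply: sumr_ge0 => T _; rewrite mulr_ge0 ?meas_ge0 ?sqr_ge0. Qed.

Lemma face_term_ge0 e : e \in interior_faces Th -> 0 <= (face_diam e)^-1 * face_jump2 v e.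
Proof.
move=> eI; have ef := interior_face eI.
by rewrite mulr_ge0 ?invr_ge0 ?(ltW (face_diam_gt0 ef)) ?face_jump2_ge0.
Qed.

Lemma jump_energy_ge0 : 0 <= jump_energy.
Proof. by apply: sumr_ge0 => e; exact: face_term_ge0. Qed.

Lemma mesh_norm2_ge0 : 0 <= mesh_norm2.
Proof. by rewrite addr_ge0 ?lap_energy_ge0 ?jump_energy_ge0. Qed.

Lemma L2_norm2_ge0 : 0 <= L2_norm2.
Proof. by apply: sumr_ge0 => T; exact: cell_L2_ge0. Qed.

Lemma H1_norm2_ge0 : 0 <= H1_norm2.
Proof. by apply: sumr_ge0 => T; exact: cell_H1_ge0. Qed.

Lemma polyf_piece T : T \in cells Th -> polyf (fun l => piece v T (pt p l)).
Proof. by move=> TTh; apply: polyf_quadratic; exact: piece_quadratic. Qed.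

Lemma polyf_piece_grad T k : T \in cells Th -> polyf (fun l => grad (piece v T) (pt p l) 0 k).
Proof. by move=> TTh; exact: has_grad_polyf (has_grad_grad_comp p k (piece_quadratic vV TTh)). Qed.

Lemma cell_grad_sup T : T \in cells Th ->
  meas T * grad_sup p T (piece v T) ^+ 2 <= (d.+1 * d.+2)%:R * cell_H1 v T.
Proof.
move=> TTh; rewrite /cell_H1 [leRHS]mulrCA ler_wpM2l ?meas_ge0//.
exact: (grad_sup_le (cell_full TTh) (piece_quadratic vV TTh)).
Qed.

(** The divergence of x_0 v^2 in the direction of the first axis gives
   |v|^2 = - 2 (v, x_0 d_0 v). *)
Lemma poincare : L2_norm2 <= 4 * B ^+ 2 * H1_norm2.
Proof.
have := green_first_coord hOmega vV.
suff : 2^-1 * L2_norm2 - 2 * B ^+ 2 * H1_norm2 <=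
  \sum_(T in cells Th) meas T * smean T (fun l => piece v T (pt p l) ^+ 2 +
    2 * (pt p l 0 0 * piece v T (pt p l) * grad (piece v T) (pt p l) 0 0)).
  by move=> + E; rewrite E; lra.
rewrite /L2_norm2 /H1_norm2 !mulr_sumr -sumrB; apply: ler_sum => T TTh.
have T0 := cell_set0 TTh; have qq := piece_quadratic vV TTh.
have pq := polyf_piece TTh; have pq2 := polyfX 2 pq.
have pg := polyf_grad_dot p qq qq.
have E : smean T (fun l => 2^-1 * piece v T (pt p l) ^+ 2 +
     - (2 * B ^+ 2) * dot (grad (piece v T) (pt p l)) (grad (piece v T) (pt p l))) =
   2^-1 * smean T (fun l => piece v T (pt p l) ^+ 2) + - (2 * B ^+ 2) *
     smean T (fun l => dot (grad (piece v T) (pt p l)) (grad (piece v T) (pt p l))).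
  by rewrite smean_lin ?smeanZ//; exact: polyfZ.
rewrite /cell_L2 /cell_H1.
have -> a b c : 2^-1 * (a * b) - 2 * B ^+ 2 * (a * c) = a * (2^-1 * b + - (2 * B ^+ 2) * c) by ring.
rewrite -E ler_wpM2l ?meas_ge0//; apply: ler_smean => //.
- by apply: polyfD; apply: polyfZ.
- apply: polyfD => //; apply: polyfZ; apply: polyfM; last exact: polyf_piece_grad.
  apply: polyfM => //.
  apply: has_grad_polyf (eq_has_grad _ _ (has_grad_affine p (delta_mx 0 0) 0)) => // l.
  by rewrite addr0 dotC dot_delta.
move=> l lT; have xB := bounded (cell_in_closure TTh (hull_pt p lT)).
set x := pt p l in xB *; set g := grad _ _; set q := piece v T x.
have x2 : x 0 0 ^+ 2 <= B ^+ 2 by apply/sqr_le_of_norm/(le_trans (enorm_entry _ _)).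
have g2 : g 0 0 ^+ 2 <= dot g g.
  by rewrite -enorm_sqr; apply/sqr_le_of_norm/enorm_entry.
have xg : x 0 0 ^+ 2 * g 0 0 ^+ 2 <= B ^+ 2 * dot g g by apply: ler_pM; rewrite ?sqr_ge0.
have := sqr_ge0 (q + 2 * (x 0 0 * g 0 0)).
set a := x 0 0 in xg *; set b := g 0 0 in xg *; set D := dot g g in xg *.
rewrite sqrrD; nra.
Qed.

Definition trace_const : R :=
  face_up * d%:R * sigma * (2 + 8 * B ^+ 2 * (d.+1 * d.+2)%:R).

Lemma trace_const_ge0 : 0 <= trace_const.
Proof.
rewrite !mulr_ge0 ?(ltW face_up_gt0) ?ler0n ?(ltW hsigma)//.
apply: addr_ge0 => //; apply: mulr_ge0; last exact: ler0n.
by apply: mulr_ge0 => //; exact: sqr_ge0.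
Qed.

(** The values on the face are controlled by those inside the cell up to the
    oscillation h |grad v|, and h is at most 2 B. *)
Lemma trace_le T e : T \in cells Th -> e \in faces Th -> e \subset T ->
  face_diam e * (meas e * smean e (fun l => piece v T (pt p l) ^+ 2)) <=
  trace_const * (cell_L2 v T + cell_H1 v T).
Proof.
move=> TTh ef eT; have T0 := cell_set0 TTh; have e0 := face_neq_set0 ef.
have fT := cell_full TTh; have qq := piece_quadratic vV TTh.
have pq := polyf_piece TTh; have pq2 := polyfX 2 pq.
set S := 2 * smean T (fun l => piece v T (pt p l) ^+ 2) +
    2 * (grad_sup p T (piece v T) * h T) ^+ 2.
have H1 : smean e (fun l => piece v T (pt p l) ^+ 2) <= S.
  rewrite -[S](smean_cst S e0); apply: ler_smean => //; first exact: polyf_cst.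
  move=> l le; apply: (sqr_value_le_mean fT) => //.
  by apply: hull_pt; exact: in_simplexS le.
have S0 : 0 <= S.
  apply: addr_ge0; apply: mulr_ge0 => //; last exact: sqr_ge0.
  by apply: smean_ge0 => // l _; exact: sqr_ge0.
have c0 : 0 <= face_up * d%:R * sigma.
  by rewrite !mulr_ge0 ?(ltW face_up_gt0) ?ler0n ?(ltW hsigma).
rewrite mulrA [face_diam e * _]mulrC.
apply: le_trans (ler_pM _ _ (meas_face_diam TTh ef eT) H1) _.
- by rewrite mulr_ge0 ?meas_ge0 ?(ltW (face_diam_gt0 ef)).
- by apply: smean_ge0 => // l _; exact: sqr_ge0.
rewrite -[leLHS]mulrA /trace_const -[leRHS]mulrA; apply: ler_wpM2l => //.
have L0 := cell_L2_ge0 v TTh; have G0 := cell_H1_ge0 v TTh.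
have D0 : 0 <= (d.+1 * d.+2)%:R :> R by rewrite ler0n.
have h2 : h T ^+ 2 <= 4 * B ^+ 2.
  have -> : 4 * B ^+ 2 = (2 * B) ^+ 2 by ring.
  by rewrite ler_pXn2r ?nnegrE ?h_le ?(ltW (h_gt0 TTh))// mulr_ge0 ?(ltW hB).
have H2 : meas T * (grad_sup p T (piece v T) * h T) ^+ 2 <=
    4 * B ^+ 2 * ((d.+1 * d.+2)%:R * cell_H1 v T).
  have -> : meas T * (grad_sup p T (piece v T) * h T) ^+ 2 =
    meas T * grad_sup p T (piece v T) ^+ 2 * h T ^+ 2 by ring.
  rewrite [leRHS]mulrC; apply: ler_pM => //.
  - by apply: mulr_ge0; [exact: meas_ge0 | exact: sqr_ge0].
  - exact: sqr_ge0.
  - exact: cell_grad_sup.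
have -> : meas T * S = 2 * cell_L2 v T + 2 * (meas T * (grad_sup p T (piece v T) * h T) ^+ 2).
  by rewrite /S /cell_L2; ring.
have P1 : 0 <= 8 * B ^+ 2 * (d.+1 * d.+2)%:R * cell_L2 v T.
  by apply: mulr_ge0 => //; apply: mulr_ge0 => //; apply: mulr_ge0 => //; exact: sqr_ge0.
move: (cell_L2 v T) (cell_H1 v T) (B ^+ 2) ((d.+1 * d.+2)%:R : R) (meas T * _) L0 G0 H2 P1.
move=> L G b D X L0 G0 H2 P1.
have -> : (2 + 8 * b * D) * (L + G) = 2 * L + 2 * G + 8 * b * D * L + 2 * (4 * b * (D * G)) by ring.
lra.
Qed.

Lemma young (a b eps : R) : 0 < eps ->
  - (a * b) <= eps / 2 * a ^+ 2 + (2 * eps)^-1 * b ^+ 2.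
Proof.
move=> e0; rewrite -subr_ge0.
have -> : eps / 2 * a ^+ 2 + (2 * eps)^-1 * b ^+ 2 - - (a * b) =
   (2 * eps)^-1 * (eps * a + b) ^+ 2 by field; rewrite gt_eqF.
by rewrite mulr_ge0 ?sqr_ge0// invr_ge0 mulr_ge0 ?ltW.
Qed.

Lemma smean_young A F G (eps : R) : A != finset.set0 -> polyf F -> polyf G -> 0 < eps ->
  - smean A (fun l : 'I_(nvert Th) -> R => F l * G l) <=
  eps / 2 * smean A (fun l => F l ^+ 2) + (2 * eps)^-1 * smean A (fun l => G l ^+ 2).
Proof.
move=> A0 pF pG e0; have pF2 := polyfX 2 pF; have pG2 := polyfX 2 pG.
have pFG := polyfM pF pG.
have E : eps / 2 * smean A (fun l => F l ^+ 2) + (2 * eps)^-1 * smean A (fun l => G l ^+ 2) =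
    smean A (fun l => eps / 2 * F l ^+ 2 + (2 * eps)^-1 * G l ^+ 2).
  by rewrite smean_lin ?smeanZ//; exact: polyfZ.
rewrite E -mulN1r -(smeanZ _ A0 pFG).
apply: ler_smean => //; first exact: polyfZ.
  by apply: polyfD; exact: polyfZ.
by move=> l _; rewrite mulN1r; exact: young.
Qed.

Definition energy_const : R :=
  4 * B ^+ 2 + d.+1%:R * trace_const * (1 + 4 * B ^+ 2).

Lemma energy_const_gt0 : 0 < energy_const.
Proof.
rewrite ltr_pwDl ?mulr_gt0 ?exprn_gt0//.
apply: mulr_ge0; first by apply: mulr_ge0; [exact: ler0n | exact: trace_const_ge0].
by apply: addr_ge0 => //; apply: mulr_ge0 => //; exact: sqr_ge0.
Qed.

(** The norm of the gradient is bounded by the mesh norm, by Green's formula and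
   Young's inequality; the parameter is chosen to absorb half of the left-hand
   side. *)
Lemma energy : H1_norm2 <= energy_const * mesh_norm2.
Proof.
have M0 := energy_const_gt0; set M := energy_const in M0 *.
(* Young's parameter 1 / M leaves half of the gradient norm on the right. *)
have eps0 : 0 < M^-1 by rewrite invr_gt0.
have T1 T : T \in cells Th ->
    - (meas T * smean T (fun l => cell_lap v T * piece v T (pt p l))) <=
    M^-1 / 2 * cell_L2 v T + (2 * M^-1)^-1 * (meas T * cell_lap v T ^+ 2).
  move=> TTh; have T0 := cell_set0 TTh; have pq := polyf_piece TTh.
  have := smean_young T0 pq (polyf_cst (cell_lap v T)) eps0.
  rewrite (smean_cst (cell_lap v T ^+ 2) T0) => H.
  have := ler_wpM2l (meas_ge0 T) H; rewrite mulrN.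
  under [X in smean T X]eq_fun do rewrite mulrC.
  by rewrite /cell_L2 mulrDr [X in _ <= X + _ -> _]mulrCA [X in _ <= _ + X -> _]mulrCA.
have T2 e : e \in interior_faces Th ->
    - (meas e * smean e (fun l => piece v (cell_minus e) (pt p l) * normal_jump v e l)) <=
    M^-1 / 2 * (trace_const * (cell_L2 v (cell_minus e) + cell_H1 v (cell_minus e))) +
    (2 * M^-1)^-1 * ((face_diam e)^-1 * face_jump2 v e).
  move=> eI; have ef := interior_face eI; have e0 := face_neq_set0 ef.
  have /adjacentP[mTh em] := cell_minus_adjacent ef.
  have f0 := face_diam_gt0 ef.
  have := smean_young e0 (polyf_piece mTh) (polyf_normal_jump vV eI) (mulr_gt0 eps0 f0).
  move=> /(ler_wpM2l (meas_ge0 e)); rewrite mulrN => H; apply: le_trans H _.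
  rewrite mulrDr; apply: lerD.
    apply: le_trans (ler_wpM2l _ (trace_le mTh ef em)); last by rewrite divr_ge0 ?ltW.
    by rewrite le_eqVlt; apply/orP; left; apply/eqP; ring.
  by rewrite /face_jump2 le_eqVlt; apply/orP; left; apply/eqP; field; rewrite !gt_eqF.
have G := green_energy hOmega vV.
rewrite big_split /= in G.
have S1 := ler_sum (index_enum _) T1.
have S2 := ler_sum (index_enum _) T2.
rewrite sumrN big_split /= -!mulr_sumr in S1.
rewrite sumrN big_split /= -!mulr_sumr in S2.
rewrite -/L2_norm2 -/lap_energy in S1; rewrite -/jump_energy in S2.
have S3 := @sum_interior_adjacent (fun T => cell_L2 v T + cell_H1 v T)
  (fun T TTh => addr_ge0 (cell_L2_ge0 v TTh) (cell_H1_ge0 v TTh)).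
rewrite [X in _ <= _ * X]big_split /= -/L2_norm2 -/H1_norm2 in S3.
have P := poincare.
have E : H1_norm2 <= M^-1 / 2 * (L2_norm2 + trace_const * (d.+1%:R * (L2_norm2 + H1_norm2))) +
    (2 * M^-1)^-1 * mesh_norm2.
  have S4 : M^-1 / 2 * (trace_const * \sum_(e in interior_faces Th)
      (cell_L2 v (cell_minus e) + cell_H1 v (cell_minus e))) <=
      M^-1 / 2 * (trace_const * (d.+1%:R * (L2_norm2 + H1_norm2))).
    by rewrite ler_wpM2l ?divr_ge0 ?(ltW eps0)// ler_wpM2l ?trace_const_ge0.
  by rewrite /mesh_norm2; move: G S1 S2 S4; rewrite -/H1_norm2; lra.
have K : L2_norm2 + trace_const * (d.+1%:R * (L2_norm2 + H1_norm2)) <= M * H1_norm2.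
  have t0 : 0 <= trace_const * d.+1%:R by rewrite mulr_ge0 ?trace_const_ge0 ?ler0n.
  have := ler_wpM2l t0 P; rewrite /M /energy_const; move: P.
  move: (B ^+ 2) (trace_const) (d.+1%:R : R) => b t D; nra.
have := ler_wpM2l (ltW (divr_gt0 eps0 (ltr0Sn _ 1))) K.
have -> : M^-1 / 2 * (M * H1_norm2) = H1_norm2 / 2 by field; rewrite gt_eqF.
have E2 : (2 * M^-1)^-1 * mesh_norm2 = M * mesh_norm2 / 2 by field; rewrite gt_eqF.
by move: E; rewrite E2; lra.
Qed.

Lemma norms_le : L2_norm2 + H1_norm2 <= (1 + 4 * B ^+ 2) * energy_const * mesh_norm2.
Proof.
have := energy; have := poincare; move=> P E.
have b0 : 0 <= 1 + 4 * B ^+ 2 by rewrite addr_ge0// mulr_ge0 ?sqr_ge0.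
have := ler_wpM2l b0 E; rewrite mulrA; move: P; lra.
Qed.

Lemma mesh_norm2_eq0 : mesh_norm2 = 0 -> v = 0.
Proof.
move=> N0; have := norms_le; rewrite N0 mulr0 => LH.
have L0 : L2_norm2 = 0.
  by apply/eqP; rewrite eq_le L2_norm2_ge0 andbT; have := H1_norm2_ge0; move: LH; lra.
have G0 : H1_norm2 = 0.
  by apply/eqP; rewrite eq_le H1_norm2_ge0 andbT; have := L2_norm2_ge0; move: LH; lra.
apply/funext => x; apply: contrapT => vx.
have Ox : Omega x.
  by apply: contrapT => nO; apply: vx; have [_ + _] := (fe_spaceP Th v).1 vV; apply.
have : closure Omega x by exact: subset_closure.
rewrite (cells_cover Th) => -[T /= TTh Tx]; apply: vx.
have psum0 (F : simplex -> R) : (forall T, T \in cells Th -> 0 <= F T) ->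
    \sum_(T in cells Th) F T = 0 -> F T = 0.
  move=> F0 /eqP; rewrite psumr_eq0// => /allP/(_ T); rewrite mem_index_enum.
  by move=> /(_ isT); rewrite TTh /= => /eqP.
have m0 := meas_cell_gt0 TTh; have T0 := cell_set0 TTh.
have LT := psum0 _ (fun T => @cell_L2_ge0 _ _ _ Th v T) L0.
have GT := psum0 _ (fun T => @cell_H1_ge0 _ _ _ Th v T) G0.
have qq := piece_quadratic vV TTh; have fT := cell_full TTh.
have g0 : grad_sup p T (piece v T) = 0.
  apply/eqP; rewrite -sqrf_eq0 eq_le sqr_ge0 andbT.
  by have := cell_grad_sup TTh; rewrite GT mulr0 pmulr_rle0.
have := sqr_value_le_mean fT qq Tx; rewrite g0 mul0r expr0n mulr0 addr0.
have /eqP := LT; rewrite /cell_L2 mulf_eq0 gt_eqF //= => /eqP ->.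
rewrite mulr0 => q2; rewrite -(pieceE vV TTh Tx); apply/eqP.
by rewrite -sqrf_eq0 eq_le q2 sqr_ge0.
Qed.

(** * Comparison with the discrete forms *)

Definition lap_const : R := d.+1%:R * (face_up * d%:R * sigma).

Lemma lap_const_ge0 : 0 <= lap_const.
Proof. by rewrite !mulr_ge0 ?(ltW face_up_gt0) ?ler0n ?(ltW hsigma). Qed.

Lemma card_faces_of T : T \in cells Th ->
  (#|[pred e in interior_faces Th | e \subset T]| <= d.+1)%N.
Proof.
move=> TTh; rewrite -(card_cell TTh).
have <- : #|((fun k => (T :\ k)%SET) @: T)%SET| = #|T|.
  apply: card_in_imset => i j iT jT E; apply/eqP; apply: contraT => ij.
  have : i \in (T :\ j)%SET by rewrite !inE ij iT.
  by rewrite -E !inE eqxx.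
apply: subset_leq_card; apply/fintype.subsetP => e; rewrite inE => /andP[eI eT].
have [k kT ->] := face_opposite TTh (interior_face eI) eT.
by apply/imsetP; exists k.
Qed.

(** The error is a sum of mean jumps over at most d+1 faces, to which
    Cauchy-Schwarz and Jensen apply. *)
Lemma weak_laplacian_error T : T \in cells Th ->
  meas T * (weak_laplacian v T - cell_lap v T) ^+ 2 <=
  lap_const * \sum_(e in interior_faces Th | e \subset T) (face_diam e)^-1 * face_jump2 v e.
Proof.
move=> TTh; have m0 := meas_cell_gt0 TTh.
set D := weak_laplacian v T - _.
rewrite -(ler_pM2l m0) mulrA -expr2 -exprMn (weak_laplacian_lap vV TTh).
rewrite exprMn.
apply: le_trans (_ : _ <= 1 * (d.+1%:R * \sum_(e in interior_faces Th | e \subset T)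
    (meas e * smean e (normal_jump v e)) ^+ 2)) _.
  apply: ler_pM; rewrite ?sqr_ge0//; first by rewrite expr2; lra.
  exact: (sqr_sum_le_nat _ (card_faces_of TTh)).
set X := \sum_(e in interior_faces Th | e \subset T) (face_diam e)^-1 * face_jump2 v e.
have -> : meas T * (lap_const * X) = d.+1%:R * (face_up * d%:R * sigma * meas T * X).
  by rewrite /lap_const; ring.
rewrite mul1r; apply: ler_wpM2l; first exact: ler0n.
rewrite /X mulr_sumr; apply: ler_sum => e /andP[eI eT].
have ef := interior_face eI; have e0 := face_neq_set0 ef; have f0 := face_diam_gt0 ef.
have J := sqr_smean_le e0 (polyf_normal_jump vV eI).
have H := meas_face_diam TTh ef eT.
rewrite exprMn /face_jump2; set j2 := smean e (fun l => normal_jump v e l ^+ 2) in J *.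
have j0 : 0 <= j2 by apply: le_trans J; exact: sqr_ge0.
apply: le_trans (ler_wpM2l (sqr_ge0 _) J) _.
have : meas e * face_diam e * (meas e * (face_diam e)^-1 * j2) <=
   face_up * d%:R * sigma * meas T * (meas e * (face_diam e)^-1 * j2).
  apply: ler_wpM2r => //; apply: mulr_ge0 => //.
  by apply: mulr_ge0; [exact: meas_ge0 | rewrite invr_ge0 ltW].
have -> : meas e * face_diam e * (meas e * (face_diam e)^-1 * j2) = meas e ^+ 2 * j2.
  by field; rewrite gt_eqF.
move=> /le_trans; apply; rewrite le_eqVlt; apply/orP; left; apply/eqP; ring.
Qed.

Lemma sum_cells_interior (F : simplex -> R) :
  \sum_(T in cells Th) \sum_(e in interior_faces Th | e \subset T) F e =
  2 * \sum_(e in interior_faces Th) F e.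
Proof.
rewrite (exchange_big_dep (mem (interior_faces Th))) /=; last by move=> T e _ /andP[].
rewrite mulr_sumr; apply: eq_bigr => e eI.
have := sum_adjacent_interior (fun=> F e) eI; rewrite mulr_natl mulr2n => <-.
by apply: eq_bigl => T; rewrite eI /= [RHS]inE.
Qed.

Lemma broken_formE (S F : {set simplex}) : S \subset cells Th -> F \subset interior_faces Th ->
  broken_form S F v v = \sum_(T in S) meas T * weak_laplacian v T ^+ 2 +
    4^-1 * \sum_(e in F) (face_diam e)^-1 * face_jump2 v e.
Proof.
move=> SC FI; rewrite /broken_form; congr (_ + _ * _); apply: eq_bigr.
  move=> T /(fintype.subsetP SC) TTh; rewrite integral_onE ?cell_set0//.
  by rewrite smean_cst ?cell_set0.
move=> e /(fintype.subsetP FI) eI.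
by rewrite integral_onE ?(face_neq_set0 (interior_face eI)).
Qed.

(** The two Laplacians differ by the jumps on the faces of the cell, and
    every interior face is counted twice. *)
Lemma broken_form_le (S F : {set simplex}) : S \subset cells Th -> F \subset interior_faces Th ->
  broken_form S F v v <= (3 + 4 * lap_const) * mesh_norm2.
Proof.
move=> SC FI; rewrite broken_formE//.
have H1 : \sum_(T in S) meas T * weak_laplacian v T ^+ 2 <=
    2 * lap_energy + 4 * lap_const * jump_energy.
  apply: (@le_trans _ _ (\sum_(T in cells Th) meas T * weak_laplacian v T ^+ 2)).
    rewrite [leRHS](bigID (mem S)) /= -[leLHS]addr0; apply: lerD.
      rewrite le_eqVlt; apply/orP; left; apply/eqP; apply: eq_bigl => T.
      by case TS: (T \in S); rewrite ?andbF// (fintype.subsetP SC).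
    by apply: sumr_ge0 => T _; rewrite mulr_ge0 ?meas_ge0 ?sqr_ge0.
  apply: (@le_trans _ _ (\sum_(T in cells Th) (2 * (meas T * cell_lap v T ^+ 2) +
     2 * (lap_const * \sum_(e in interior_faces Th | e \subset T)
       (face_diam e)^-1 * face_jump2 v e)))).
    apply: ler_sum => T TTh; have E := weak_laplacian_error TTh.
    have := sqrD_le (cell_lap v T) (weak_laplacian v T - cell_lap v T).
    rewrite addrC subrK => /(ler_wpM2l (meas_ge0 T)) H; apply: le_trans H _.
    by move: E; set a := cell_lap v T ^+ 2; set b := (_ - _) ^+ 2; lra.
  rewrite big_split /= -!mulr_sumr sum_cells_interior -/jump_energy -/lap_energy.
  by rewrite le_eqVlt; apply/orP; left; apply/eqP; ring.
have H2 : \sum_(e in F) (face_diam e)^-1 * face_jump2 v e <= jump_energy.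
  rewrite /jump_energy [leRHS](bigID (mem F)) /= -[leLHS]addr0; apply: lerD.
    rewrite le_eqVlt; apply/orP; left; apply/eqP; apply: eq_bigl => e.
    by case eF: (e \in F); rewrite ?andbF// (fintype.subsetP FI).
  by apply: sumr_ge0 => e /andP[eI _]; exact: face_term_ge0.
have := lap_energy_ge0; have := jump_energy_ge0; have := lap_const_ge0.
rewrite /mesh_norm2; move: lap_energy jump_energy lap_const H1 H2 => a j c H1 H2 c0 j0 a0.
have : 0 <= c * a by rewrite mulr_ge0.
by move: H1 H2; set X := \sum_(T in S) _; set Y := \sum_(e in F) _; lra.
Qed.

(** The jump on an interior face outside F vanishes, because neither of its
    cells is in S. *)
Lemma mesh_norm2_le (S F : {set simplex}) : S \subset cells Th -> F \subset interior_faces Th ->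
  (forall T e, T \in S -> e \in interior_faces Th -> e \subset T -> e \in F) ->
  (forall T, T \in cells Th -> T \notin S -> piece v T = 0) ->
  mesh_norm2 <= (6 + 16 * lap_const) * broken_form S F v v.
Proof.
move=> SC FI SF S0; rewrite broken_formE//.
have lap0 T : T \in cells Th -> T \notin S -> cell_lap v T = 0.
  move=> TTh TS; rewrite /cell_lap S0//.
  rewrite (@laplacian_formula _ _ 0 0 0 0) ?mxtrace0 ?mulr0// => x.
  by rewrite mulmx0 !dot0l !addr0.
have jump0 e : e \in interior_faces Th -> e \notin F -> face_jump2 v e = 0.
  move=> eI eF; have ef := interior_face eI; have e0 := face_neq_set0 ef.
  have /adjacentP[mTh em] := cell_minus_adjacent ef.
  have [/adjacentP[pTh ep] _] := cell_plus_adjacent eI.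
  have mS : cell_minus e \notin S by apply: contra eF => mS; exact: SF mS eI em.
  have pS : cell_plus e \notin S by apply: contra eF => pS; exact: SF pS eI ep.
  rewrite /face_jump2 (@eq_smean _ _ _ _ (fun=> 0))// ?smean_cst ?mulr0// => l _.
  by rewrite normal_jumpE !S0// subrr expr0n.
have JE : jump_energy = \sum_(e in F) (face_diam e)^-1 * face_jump2 v e.
  rewrite /jump_energy (bigID (mem F)) /= [X in _ + X]big1 ?addr0 => [|e /andP[eI eF]].
    apply: eq_bigl => e; case eF: (e \in F); rewrite ?andbF//.
    by rewrite (fintype.subsetP FI).
  by rewrite jump0 ?mulr0.
have LE : lap_energy <= \sum_(T in S) (2 * (meas T * weak_laplacian v T ^+ 2)) +
   4 * lap_const * jump_energy.
  have -> : lap_energy = \sum_(T in S) meas T * cell_lap v T ^+ 2.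
    rewrite /lap_energy (bigID (mem S)) /= [X in _ + X]big1 ?addr0 => [|T /andP[TTh TS]].
      apply: eq_bigl => T; case TS: (T \in S); rewrite ?andbF//.
      by rewrite (fintype.subsetP SC).
    by rewrite lap0// expr0n mulr0.
  have -> : 4 * lap_const * jump_energy = 2 * (lap_const * \sum_(T in cells Th)
      \sum_(e in interior_faces Th | e \subset T) (face_diam e)^-1 * face_jump2 v e).
    by rewrite sum_cells_interior -/jump_energy; ring.
  apply: (@le_trans _ _ (\sum_(T in S) (2 * (meas T * weak_laplacian v T ^+ 2)) +
     \sum_(T in S) 2 * (lap_const * \sum_(e in interior_faces Th | e \subset T)
       (face_diam e)^-1 * face_jump2 v e))).
    rewrite -big_split /=; apply: ler_sum => T TS; have TTh := fintype.subsetP SC _ TS.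
    have E := weak_laplacian_error TTh.
    have := sqrD_le (weak_laplacian v T) (cell_lap v T - weak_laplacian v T).
    have -> : weak_laplacian v T + (cell_lap v T - weak_laplacian v T) = cell_lap v T by ring.
    rewrite -(sqrrN (_ - _)) opprB => /(ler_wpM2l (meas_ge0 T)) H.
    apply: le_trans H _.
    by move: E; set a := weak_laplacian v T ^+ 2; set b := (_ - _) ^+ 2; lra.
  rewrite lerD2l -!mulr_sumr; apply: ler_wpM2l => //; apply: ler_wpM2l; first exact: lap_const_ge0.
  rewrite [leRHS](bigID (mem S)) /= -[leLHS]addr0; apply: lerD.
    rewrite le_eqVlt; apply/orP; left; apply/eqP; apply: eq_bigl => T.
    by case TS: (T \in S); rewrite ?andbF// (fintype.subsetP SC).
  by apply: sumr_ge0 => T _; apply: sumr_ge0 => e /andP[eI _]; exact: face_term_ge0.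
have W0 : 0 <= \sum_(T in S) meas T * weak_laplacian v T ^+ 2.
  by apply: sumr_ge0 => T _; rewrite mulr_ge0 ?meas_ge0 ?sqr_ge0.
have := jump_energy_ge0; have := lap_const_ge0.
rewrite /mesh_norm2 -JE; rewrite -mulr_sumr in LE.
move: LE W0; set W := \sum_(T in S) _; move: lap_energy jump_energy lap_const.
move=> a j c H W0 c0 j0.
have : 0 <= c * W by rewrite mulr_ge0.
have : 0 <= c * j by rewrite mulr_ge0.
lra.
Qed.

End Function.
End MeshNorm.

(** * Quadratic Lagrange interpolation *)

Section QuadraticSums.
Context {R : realType} {d : nat}.
Implicit Types (q : 'rV[R]_d -> R) (x u w : 'rV[R]_d).

Lemma mulmx_outer x u w : x *m (u^T *m w) = dot x u *: w.
Proof.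
rewrite mulmxA.
have -> : x *m u^T = (dot x u)%:M.
  rewrite [LHS]mx11_scalar /dot mxE; congr (_%:M).
  by apply: eq_bigr => k _; rewrite !mxE.
by rewrite mul_scalar_mx.
Qed.

Lemma quadraticZD a q q' : quadratic q -> quadratic q' ->
  quadratic (fun x => a * q x + q' x).
Proof. exact: quadratic_lin. Qed.

Lemma quadratic_sum (I : Type) (r : seq I) (a : I -> R) (F : I -> 'rV[R]_d -> R) :
  (forall i, quadratic (F i)) -> quadratic (fun x => \sum_(i <- r) a i * F i x).
Proof.
move=> qF; elim: r => [|i r IH].
  by under eq_fun do rewrite big_nil; exact: affine_quadratic (affine_cst 0).
by under eq_fun do rewrite big_cons; exact: quadraticZD.
Qed.

Lemma grad_cst c x : grad (fun=> c) x = 0 :> 'rV[R]_d.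
Proof.
rewrite (@grad_formula _ _ _ 0 0 c) ?addr0 => [|y]; last by rewrite mulmx0 !dot0l !add0r.
by rewrite trmx0 addr0 mulmx0.
Qed.

Lemma laplacian_cst c : laplacian (fun _ : 'rV[R]_d => c) = 0.
Proof.
rewrite (@laplacian_formula _ _ _ 0 0 c) ?mxtrace0 ?mulr0// => y.
by rewrite mulmx0 !dot0l !add0r.
Qed.

Lemma grad_sum (I : Type) (r : seq I) (a : I -> R) (F : I -> 'rV[R]_d -> R) x :
  (forall i, quadratic (F i)) ->
  grad (fun y => \sum_(i <- r) a i * F i y) x = \sum_(i <- r) a i *: grad (F i) x.
Proof.
move=> qF; elim: r => [|i r IH].
  by under eq_fun do rewrite big_nil; rewrite grad_cst big_nil.
under eq_fun do rewrite big_cons; rewrite big_cons -IH.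
exact: (grad_lin (a i) x (qF i) (quadratic_sum r a qF)).
Qed.

Lemma laplacian_sum (I : Type) (r : seq I) (a : I -> R) (F : I -> 'rV[R]_d -> R) :
  (forall i, quadratic (F i)) ->
  laplacian (fun y => \sum_(i <- r) a i * F i y) = \sum_(i <- r) a i * laplacian (F i).
Proof.
move=> qF; elim: r => [|i r IH].
  by under eq_fun do rewrite big_nil; rewrite laplacian_cst big_nil.
under eq_fun do rewrite big_cons; rewrite big_cons -IH.
exact: (laplacian_lin (a i) (qF i) (quadratic_sum r a qF)).
Qed.

Lemma affine_prod_formula u w (a b : R) x :
  (dot u x + a) * (dot w x + b) =
  dot (x *m (u^T *m w)) x + dot (b *: u + a *: w) x + a * b.
Proof. by rewrite mulmx_outer dotDl !dotZl (dotC x u); ring. Qed.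

Lemma grad_affine_prod u w (a b : R) x :
  grad (fun y => (dot u y + a) * (dot w y + b)) x =
  (dot u x + a) *: w + (dot w x + b) *: u.
Proof.
rewrite (grad_formula (affine_prod_formula u w a b)) trmx_mul trmxK.
rewrite mulmxDr !mulmx_outer (dotC x u) (dotC x w) !scalerDl.
by rewrite [b *: u + _]addrC addrACA.
Qed.

Lemma laplacian_affine_prod u w (a b : R) :
  laplacian (fun y => (dot u y + a) * (dot w y + b)) = 2 * dot u w.
Proof.
rewrite (laplacian_formula (affine_prod_formula u w a b)) mxtrace_mulC.
congr (2 * _); rewrite /mxtrace big_ord1 mxE; apply: eq_bigr => k _.
by rewrite mxE mulrC.
Qed.

Lemma grad_affine u a x : grad (fun y => dot u y + a) x = u :> 'rV[R]_d.
Proof.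
rewrite (@grad_formula _ _ _ 0 u a) => [|y]; first by rewrite trmx0 addr0 mulmx0 add0r.
by rewrite mulmx0 dot0l add0r.
Qed.

Lemma laplacian_affine u a : laplacian (fun y : 'rV[R]_d => dot u y + a) = 0.
Proof.
rewrite (@laplacian_formula _ _ _ 0 u a) ?mxtrace0 ?mulr0// => y.
by rewrite mulmx0 dot0l add0r.
Qed.

End QuadraticSums.

Section CellInterpolation.
Context {R : realType} {n d : nat} (p : 'I_n -> 'rV[R]_d).
Implicit Types (T : {set 'I_n}) (g : 'rV[R]_d -> R) (x : 'rV[R]_d).
Local Notation bgrad := (bgrad p).
Local Notation bary := (bary p).

Definition node (i j : 'I_n) : 'rV[R]_d := 2^-1 *: (p i + p j).

Lemma node_diag i : node i i = p i.
Proof.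
rewrite /node scalerDr -scalerDl; have -> : 2^-1 + 2^-1 = 1 :> R by field.
exact: scale1r.
Qed.

(** The Lagrange interpolant at the vertices and the edge midpoints. The usual
   basis b_i (2 b_i - 1), 4 b_i b_j is summed over ordered pairs, the vertex i
   being the midpoint of i and i. *)
Definition interp T g x : R :=
  2 * (\sum_i \sum_j g (node i j) * (bary T i x * bary T j x)) -
  \sum_i g (p i) * bary T i x.

Definition interp_pairs T g x : R :=
  \sum_(m : 'I_n * 'I_n) (2 * g (node m.1 m.2)) * (bary T m.1 x * bary T m.2 x).

Lemma interpE T g : interp T g =
  (fun x => (-1) * (\sum_i g (p i) * bary T i x) + interp_pairs T g x).
Proof.
apply/funext => x; rewrite /interp mulN1r addrC; congr (_ + _).
rewrite /interp_pairs -(pair_bigA _ (fun i j => (2 * g (node i j)) * (bary T i x * bary T j x))) /=.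
rewrite mulr_sumr; apply: eq_bigr => i _; rewrite mulr_sumr.
by apply: eq_bigr => j _; rewrite mulrA.
Qed.

Lemma affine_bary T i : affine (bary T i).
Proof. by exists (bgrad T i), ((bary_data p T).2 i). Qed.

Lemma quadratic_linear_part T g : quadratic (fun x => \sum_i g (p i) * bary T i x).
Proof. by apply: quadratic_sum => i; exact/affine_quadratic/affine_bary. Qed.

Lemma quadratic_interp_pairs T g : quadratic (interp_pairs T g).
Proof. by apply: quadratic_sum => m; apply: affineM; exact: affine_bary. Qed.

Lemma quadratic_interp T g : quadratic (interp T g).
Proof.
rewrite interpE; apply: quadraticZD; first exact: quadratic_linear_part.
exact: quadratic_interp_pairs.
Qed.

Lemma grad_interp T g x : grad (interp T g) x =
  \sum_(m : 'I_n * 'I_n) (2 * g (node m.1 m.2)) *: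
     (bary T m.1 x *: bgrad T m.2 + bary T m.2 x *: bgrad T m.1) -
  \sum_i g (p i) *: bgrad T i.
Proof.
rewrite interpE.
rewrite (grad_lin (-1) x (quadratic_linear_part T g) (quadratic_interp_pairs T g)).
rewrite scaleN1r addrC; congr (_ - _).
  rewrite grad_sum => [|m]; last by apply: affineM; exact: affine_bary.
  by apply: eq_bigr => m _; rewrite /bary grad_affine_prod.
rewrite grad_sum => [|i]; last exact/affine_quadratic/affine_bary.
by apply: eq_bigr => i _; rewrite /bary grad_affine.
Qed.

Lemma laplacian_interp T g : laplacian (interp T g) =
  \sum_(m : 'I_n * 'I_n) (4 * g (node m.1 m.2)) * dot (bgrad T m.1) (bgrad T m.2).
Proof.
rewrite interpE.
rewrite (laplacian_lin (-1) (quadratic_linear_part T g) (quadratic_interp_pairs T g)).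
rewrite laplacian_sum => [|i]; last exact/affine_quadratic/affine_bary.
rewrite big1 ?mulr0 ?add0r => [|i _]; last by rewrite /bary laplacian_affine mulr0.
rewrite laplacian_sum => [|m]; last by apply: affineM; exact: affine_bary.
by apply: eq_bigr => m _; rewrite /bary laplacian_affine_prod; ring.
Qed.

Lemma eq_interp T g g' : (forall i j, g (node i j) = g' (node i j)) ->
  interp T g = interp T g'.
Proof.
move=> gg; apply/funext => x; rewrite /interp; congr (2 * _ - _).
  by apply: eq_bigr => i _; apply: eq_bigr => j _; rewrite gg.
by apply: eq_bigr => i _; rewrite -node_diag gg.
Qed.

Lemma interpD T g g' x : interp T (fun y => g y + g' y) x = interp T g x + interp T g' x.
Proof.
rewrite /interp; under eq_bigr do under eq_bigr do rewrite mulrDl.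
under eq_bigr do rewrite big_split.
under [X in _ - X]eq_bigr do rewrite mulrDl.
by rewrite !big_split /=; ring.
Qed.

Lemma interp_sum (J : Type) (r : seq J) T (g : J -> 'rV[R]_d -> R) x :
  interp T (fun y => \sum_(j <- r) g j y) x = \sum_(j <- r) interp T (g j) x.
Proof.
elim: r => [|j r IH].
  under eq_fun do rewrite big_nil; rewrite big_nil /interp.
  rewrite big1 => [|i _]; last by rewrite big1// => k _; rewrite mul0r.
  by rewrite big1 ?mulr0 ?subrr// => i _; rewrite mul0r.
under eq_fun do rewrite big_cons.
by rewrite interpD IH big_cons.
Qed.

Lemma interp0 T g x :
  (forall i j, bary T i x != 0 -> bary T j x != 0 -> g (node i j) = 0) -> interp T g x = 0.
Proof.
move=> g0; rewrite /interp big1 => [|i _].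
  rewrite mulr0 sub0r big1 ?oppr0// => i _; have [->|bi] := eqVneq (bary T i x) 0.
    by rewrite mulr0.
  by rewrite -node_diag g0// mul0r.
apply: big1 => j _; have [->|bi] := eqVneq (bary T i x) 0; first by rewrite mul0r mulr0.
have [->|bj] := eqVneq (bary T j x) 0; first by rewrite !mulr0.
by rewrite g0// mul0r.
Qed.

Section Cell.
Variables (T : {set 'I_n}) (fT : full_cell p T).

Lemma node_in i j : i \in T -> j \in T -> hull p T (node i j).
Proof.
move=> iT jT; have -> : node i j = 2^-1 *: p i + (1 - 2^-1) *: p j.
  by rewrite /node scalerDr; congr (_ + _ *: _); lra.
by apply: hull_convex; [exact: hull_vertex | exact: hull_vertex | apply/andP; split; lra].
Qed.

Lemma dot_bary u x : \sum_i bary T i x * dot u (p i) = dot u x.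
Proof.
rewrite -[in RHS](pt_bary fT x) /pt dot_sumr.
by apply: eq_bigr => i _; rewrite dotZr.
Qed.

(** Expanding q at the midpoint of i and j, the terms depending on one vertex
    only cancel against the vertex sum, and the mixed terms add up to q(x). *)
Lemma interp_quadratic q : quadratic q -> interp T q =1 q.
Proof.
move=> [Q [b [c qE]]] x.
have Qb u : \sum_i bary T i x * dot (p i *m Q) u = dot (x *m Q) u.
  under eq_bigr do rewrite (dot_mulmxC Q).
  by rewrite dot_bary (dot_mulmxC Q).
have Qu u : \sum_i bary T i x * dot (u *m Q) (p i) = dot (u *m Q) x by rewrite dot_bary.
pose S := \sum_i bary T i x * dot (p i *m Q) (p i).
have s1 := sum_bary fT x.
have sc k : \sum_j bary T j x * k = k by rewrite -mulr_suml s1 mul1r.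
have sk k (F : 'I_n -> R) : \sum_j bary T j x * (k * F j) = k * \sum_j bary T j x * F j.
  by rewrite mulr_sumr; apply: eq_bigr => j _; rewrite mulrCA.
have inner i : \sum_j q (node i j) * (bary T i x * bary T j x) = bary T i x *
   (4^-1 * dot (p i *m Q) (p i) + 4^-1 * dot (p i *m Q) x + 4^-1 * dot (x *m Q) (p i) +
    4^-1 * S + 2^-1 * dot b (p i) + 2^-1 * dot b x + c).
  transitivity (bary T i x * \sum_j bary T j x *
     (4^-1 * dot (p i *m Q) (p i) + 4^-1 * dot (p i *m Q) (p j) + 4^-1 * dot (p j *m Q) (p i) +
      4^-1 * dot (p j *m Q) (p j) + 2^-1 * dot b (p i) + 2^-1 * dot b (p j) + c)).
    rewrite mulr_sumr; apply: eq_bigr => j _; rewrite qE /node -scalemxAl mulmxDl.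
    by rewrite !(dotZl, dotZr, dotDl, dotDr); field.
  congr (_ * _); under eq_bigr do rewrite !mulrDr.
  by rewrite !big_split /= !sc !sk Qu Qb dot_bary.
rewrite /interp (eq_bigr _ (fun i _ => inner i)).
have -> : \sum_i bary T i x * (4^-1 * dot (p i *m Q) (p i) + 4^-1 * dot (p i *m Q) x +
    4^-1 * dot (x *m Q) (p i) + 4^-1 * S + 2^-1 * dot b (p i) + 2^-1 * dot b x + c) =
   4^-1 * S + 4^-1 * dot (x *m Q) x + 4^-1 * dot (x *m Q) x + 4^-1 * S +
   2^-1 * dot b x + 2^-1 * dot b x + c.
  under eq_bigr do rewrite !mulrDr.
  by rewrite !big_split /= !sc !sk Qu Qb dot_bary.
have -> : \sum_i q (p i) * bary T i x = S + dot b x + c.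
  under eq_bigr do rewrite qE mulrC !mulrDr.
  by rewrite !big_split /= sc dot_bary.
by rewrite qE; field.
Qed.

Variables (M gamma : R) (M0 : 0 <= M).
Hypothesis gammaP : forall i, i \in T -> enorm (bgrad T i) <= gamma.

Lemma sum_cell_le (I : finType) (P : pred I) (a : I -> 'rV[R]_d) (K : R) (m : nat) :
  (forall i, ~~ P i -> a i = 0) -> (forall i, P i -> enorm (a i) <= K) ->
  (#|P| <= m)%N -> 0 <= K -> enorm (\sum_i a i) <= m%:R * K.
Proof.
move=> aP aK Pm K0; apply: le_trans (enorm_sum _ _ _) _.
rewrite (bigID P) /= [X in _ + X]big1 ?addr0 => [|i /aP ->]; last exact: enorm0.
apply: le_trans (ler_sum _ aK) _; rewrite sumr_const -[K *+ _]mulr_natl.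
by apply: ler_wpM2r => //; rewrite ler_nat.
Qed.

Lemma card_pairs : #|[pred m : 'I_n * 'I_n | (m.1 \in T) && (m.2 \in T)]| = (d.+1 * d.+1)%N.
Proof.
have [Td _] := fT; rewrite -{1}Td -{1}Td -cardX; apply: eq_card => m.
by rewrite !inE.
Qed.

Lemma bary_le1 x i : hull p T x -> bary T i x <= 1.
Proof.
move=> /(hullP fT) b0; rewrite -(sum_bary fT x) (bigD1 i)//= lerDl.
by apply: sumr_ge0 => j _.
Qed.

Lemma gamma_ge0 : 0 <= gamma.
Proof.
have [Td _] := fT; have /set0Pn[k kT] : T != finset.set0 by rewrite -card_gt0 Td.
by apply: le_trans (gammaP kT); exact: enorm_ge0.
Qed.

(** An inverse estimate: only the (d+1)^2 pairs of vertices of T contribute. *)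
Lemma grad_interp_le g x : (forall i j, i \in T -> j \in T -> `|g (node i j)| <= M) ->
  hull p T x -> enorm (grad (interp T g) x) <= 5 * (d.+1 * d.+1)%:R * (M * gamma).
Proof.
move=> gM Tx; have g0 := gamma_ge0; have Mg : 0 <= M * gamma by rewrite mulr_ge0.
have b0 i : 0 <= bary T i x by move: i; exact/(hullP fT).
rewrite grad_interp; apply: le_trans (enormD _ _) _; rewrite enormN.
have H1 : enorm (\sum_(m : 'I_n * 'I_n) (2 * g (node m.1 m.2)) *:
     (bary T m.1 x *: bgrad T m.2 + bary T m.2 x *: bgrad T m.1)) <=
    (d.+1 * d.+1)%:R * (4 * (M * gamma)).
  apply: (@sum_cell_le _ [pred m : 'I_n * 'I_n | (m.1 \in T) && (m.2 \in T)]).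
  - move=> [i j] /=; rewrite negb_and => /orP[iT|jT].
      by rewrite (bary_out fT x iT) (bgrad_out fT iT) scale0r scaler0 addr0 scaler0.
    by rewrite (bary_out fT x jT) (bgrad_out fT jT) scale0r scaler0 addr0 scaler0.
  - move=> [i j] /= /andP[iT jT]; rewrite enormZ normrM (ger0_norm (ler0n R 2)).
    have -> : 4 * (M * gamma) = 2 * M * (2 * gamma) by ring.
    apply: ler_pM; rewrite ?mulr_ge0 ?enorm_ge0//.
      by rewrite ler_pM2l// gM.
    apply: le_trans (enormD _ _) _; rewrite !enormZ !ger0_norm//.
    have : bary T i x * enorm (bgrad T j) <= 1 * gamma.
      by apply: ler_pM; rewrite ?enorm_ge0 ?bary_le1 ?gammaP.
    have : bary T j x * enorm (bgrad T i) <= 1 * gamma.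
      by apply: ler_pM; rewrite ?enorm_ge0 ?bary_le1 ?gammaP.
    lra.
  - by rewrite card_pairs.
  - by rewrite mulr_ge0.
have H2 : enorm (\sum_i g (p i) *: bgrad T i) <= d.+1%:R * (M * gamma).
  apply: (@sum_cell_le _ (mem T)) => //.
  - by move=> i iT; rewrite bgrad_out// scaler0.
  - move=> i iT; rewrite enormZ; apply: ler_pM; rewrite ?enorm_ge0//.
      by rewrite -node_diag gM.
    exact: gammaP.
  - by have [-> _] := fT.
have H3 : d.+1%:R * (M * gamma) <= (d.+1 * d.+1)%:R * (M * gamma).
  by apply: ler_wpM2r => //; rewrite ler_nat leq_pmulr.
apply: le_trans (lerD H1 (le_trans H2 H3)) _; lra.
Qed.

Lemma laplacian_interp_le g : (forall i j, i \in T -> j \in T -> `|g (node i j)| <= M) ->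
  `|laplacian (interp T g)| <= 4 * (d.+1 * d.+1)%:R * (M * gamma ^+ 2).
Proof.
move=> gM; have g0 := gamma_ge0; rewrite laplacian_interp.
apply: le_trans (ler_norm_sum _ _ _) _.
rewrite (bigID [pred m : 'I_n * 'I_n | (m.1 \in T) && (m.2 \in T)]) /=.
rewrite [X in _ + X]big1 ?addr0; last first.
  move=> [i j] /=; rewrite negb_and => /orP[iT|jT].
    by rewrite (bgrad_out fT iT) dot0l mulr0 normr0.
  by rewrite (bgrad_out fT jT) dot0r mulr0 normr0.
apply: (@le_trans _ _ (\sum_(m : 'I_n * 'I_n | (m.1 \in T) && (m.2 \in T)) 4 * (M * gamma ^+ 2))).
  apply: ler_sum => -[i j] /= /andP[iT jT].
  rewrite normrM normrM (ger0_norm (ler0n R 4)) [leRHS]mulrA.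
  apply: ler_pM; rewrite ?mulr_ge0//; first by rewrite ler_pM2l// gM.
  apply: le_trans (dot_le _ _) _; rewrite expr2.
  by apply: ler_pM; rewrite ?enorm_ge0 ?gammaP.
rewrite sumr_const -[X in _ <= X]mulrA [4 * _]mulrC mulrCA [in leRHS]mulrC mulrA.
have <- := card_pairs; rewrite -mulr_natl le_eqVlt; apply/orP; left; apply/eqP.
have -> : #|[pred m : 'I_n * 'I_n | (m.1 \in T) && (m.2 \in T)]| =
  #|[pred m : 'I_n * 'I_n | (m.1 \in T) && (m.2 \in T)]| by [].
ring.
Qed.

End Cell.
End CellInterpolation.

(** * The interpolant as a finite element function *)

Section MeshInterpolation.
Context {R : realType} {d' : nat} {Omega : set 'rV[R]_d'.+1}.
Local Notation d := d'.+1.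
Variables (hOmega : convex_polytope_domain Omega) (Th : triangulation Omega).
Local Notation simplex := {set 'I_(nvert Th)}.
Local Notation p := (vertex (t := Th)).
Local Notation node := (node p).
Implicit Types (A T e : simplex) (x : 'rV[R]_d) (g : 'rV[R]_d -> R).

(** The value does not depend on the cell that is picked, by conformity. *)
Definition interpolate g x : R :=
  if [pick T in cells Th | `[< geom T x >]] is Some T then interp p T g x else 0.

Lemma interpolateE T g x : T \in cells Th -> geom T x -> interpolate g x = interp p T g x.
Proof.
move=> TTh Tx; rewrite /interpolate; case: pickP => [T' /andP[T'Th /asboolP T'x]|/(_ T)].
  rewrite /interp; congr (2 * _ - _); apply: eq_bigr => i _; last first.
    by rewrite (common_coord i T'Th TTh T'x Tx).
  by apply: eq_bigr => j _; rewrite !(common_coord _ T'Th TTh T'x Tx).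
by rewrite TTh /=; case: asboolP.
Qed.

Lemma interpolate_out g x : (forall T, T \in cells Th -> ~ geom T x) -> interpolate g x = 0.
Proof.
by move=> h; rewrite /interpolate; case: pickP => // T /andP[TTh /asboolP /h]; case/(_ TTh).
Qed.

(** If an edge midpoint m of the smallest face containing x lies in Omega, so
   does x, which is a strict convex combination of m and a point of the cell. *)
Lemma node_boundary T x i j : T \in cells Th -> geom T x ->
  bary p T i x != 0 -> bary p T j x != 0 -> ~ Omega x -> ~ Omega (node i j).
Proof.
move=> TTh Tx bi bj nO Om; apply: nO; have fT := cell_full TTh.
have b0 k : 0 <= bary p T k x by move: k; exact/(hullP fT).
have iT : i \in T by apply: contraR bi => iT; rewrite (bary_out fT x iT).
have jT : j \in T by apply: contraR bj => jT; rewrite (bary_out fT x jT).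
(* The node has coordinate 1/2 at i and at j, or 1 at i = j: subtracting t times
   the node leaves nonnegative coordinates. *)
pose t : R := Num.min (bary p T i x) (bary p T j x) / 2.
have m0 : 0 < Num.min (bary p T i x) (bary p T j x) by rewrite lt_min !lt_def bi bj !b0.
have m1 : Num.min (bary p T i x) (bary p T j x) <= 1 by rewrite ge_min bary_le1.
have t0 : 0 < t by rewrite divr_gt0.
have t1 : t < 1 by rewrite ltr_pdivrMr// mul1r (le_lt_trans m1)// ltr1n.
pose l k : R := (bary p T k x - t * (2^-1 * ((k == i)%:R + (k == j)%:R))) / (1 - t).
have t1' : 0 < 1 - t by rewrite subr_gt0.
have nE : node i j = \sum_k (2^-1 * ((k == i)%:R + (k == j)%:R)) *: p k.
  under eq_bigr do rewrite mulrDr scalerDl.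
  rewrite big_split /= (bigD1 i)//= [X in _ + X](bigD1 j)//= !eqxx !mulr1.
  rewrite big1 ?addr0 => [|k /negbTE ->]; last by rewrite mulr0 scale0r.
  rewrite big1 ?addr0 => [|k /negbTE ->]; last by rewrite mulr0 scale0r.
  by rewrite /node scalerDr.
have S1 a : \sum_k (k == a)%:R = 1 :> R.
  by rewrite (bigD1 a)//= eqxx big1 ?addr0// => k /negbTE ->.
have yT : geom T (pt p l).
  apply: hull_pt; split=> [k|k kT|].
  - rewrite divr_ge0 ?(ltW t1')// subr_ge0.
    have h1 : (k == i)%:R * t <= bary p T k x / 2.
      case: eqP => [->|_]; last by rewrite mul0r divr_ge0.
      by rewrite mul1r /t ler_pM2r ?invr_gt0// ge_min lexx.
    have h2 : (k == j)%:R * t <= bary p T k x / 2.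
      case: eqP => [->|_]; last by rewrite mul0r divr_ge0.
      by rewrite mul1r /t ler_pM2r ?invr_gt0// ge_min lexx orbT.
    by move: (b0 k) h1 h2; move: ((k == i)%:R : R) ((k == j)%:R : R) => u w; lra.
  - rewrite /l; have -> : (k == i) = false by apply: contraNF kT => /eqP ->.
    have -> : (k == j) = false by apply: contraNF kT => /eqP ->.
    by rewrite (bary_out fT x kT) addr0 !mulr0 subrr mul0r.
  - rewrite /l -mulr_suml sumrB (sum_bary fT) -!mulr_sumr big_split /=.
    by rewrite !S1; field; rewrite gt_eqF.
have -> : x = t *: node i j + (1 - t) *: pt p l.
  rewrite nE /pt !scaler_sumr -big_split /=.
  rewrite -[LHS](pt_bary fT) /pt; apply: eq_bigr => k _.
  rewrite !scalerA -scalerDl /l; congr (_ *: _).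
  by field; rewrite gt_eqF.
apply: domain_segment => //; first exact: cell_in_closure yT.
by rewrite t0 ltW.
Qed.

Lemma continuous_closed_cover (I : finType) (C : I -> set 'rV[R]_d) f (k : I -> 'rV[R]_d -> R) :
  (forall i, closed (C i)) -> (forall i, continuous (k i)) ->
  (forall x, exists i, C i x) -> (forall i x, C i x -> f x = k i x) -> continuous f.
Proof.
move=> cC ck cov fk x V Vx.
have : \forall y \near x, forall i, C i y -> V (k i y).
  apply: (@filter_forall _ I (fun i y => C i y -> V (k i y)) (nbhs x) _).
  move=> i; have [Cx|Cx] := pselect (C i x).
    have : nbhs x (k i @^-1` V) by apply: ck; rewrite -fk.
    by apply: (@filterS _ (nbhs x)) => y ? _.
  have : nbhs x (~` C i) by apply: (closed_openC (cC i)).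
  by apply: (@filterS _ (nbhs x)) => y ? ?.
by apply: (@filterS _ (nbhs x)) => y H; have [i Ci] := cov y; rewrite /= (fk i)//; exact: H.
Qed.

Lemma interpolate_fe g : (forall x, ~ Omega x -> g x = 0) -> interpolate g \in fe_space Th.
Proof.
move=> g0; have out x : ~ Omega x -> interpolate g x = 0.
  move=> nO; have [[T [TTh Tx]]|h] := pselect (exists T, T \in cells Th /\ geom T x).
    rewrite (interpolateE g TTh Tx); apply: interp0 => i j bi bj.
    by apply: g0; exact: (node_boundary TTh Tx bi bj nO).
  by apply: interpolate_out => T TTh Tx; apply: h; exists T.
apply/fe_spaceP; split=> //; last first.
  by move=> T TTh; exists (interp p T g); [exact: quadratic_interp | move=> x; exact: interpolateE].
pose C (o : option simplex) := if o is Some T then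
   (if T \in cells Th then geom T else set0) else ~` Omega.
pose k (o : option simplex) := if o is Some T then interp p T g else fun=> 0.
apply: (@continuous_closed_cover _ C _ k).
- move=> [T|] /=; last by apply: open_closedC; exact: domain_open.
  by case: ifP => _; [exact: hull_closed | exact: closed0].
- move=> [T|] /=; last exact: cst_continuous.
  by apply: quadratic_continuous; exact: quadratic_interp.
- move=> x; have [Ox|nO] := pselect (Omega x); last by exists None.
  have : closure Omega x by exact: subset_closure.
  by rewrite (cells_cover Th) => -[T /= TTh Tx]; exists (Some T); rewrite /= TTh.
- move=> [T|] x /=; last exact: out.
  by case: ifP => // TTh; exact: interpolateE.
Qed.

Lemma piece_eq v T q : v \in fe_space Th -> T \in cells Th -> quadratic q ->
  (forall x, geom T x -> v x = q x) -> piece v T = q.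
Proof.
move=> vV TTh qq vq; have [pq pE] := piece_spec vV TTh.
apply: (quadratic_eq (cell_nondegenerate TTh)) => // x Tx.
by rewrite -pE// vq.
Qed.

Lemma piece_interpolate g T : (forall x, ~ Omega x -> g x = 0) -> T \in cells Th ->
  piece (interpolate g) T = interp p T g.
Proof.
move=> g0 TTh; apply: piece_eq => //; first exact: interpolate_fe.
  exact: quadratic_interp.
by move=> x; exact: interpolateE.
Qed.

(** * Cells inside and outside a subdomain *)

Definition open_cell T : set 'rV[R]_d := [set x | forall i, i \in T -> 0 < bary p T i x].

(** A fixed interior point of the cell: it tells whether the cell is inside a
    subdomain, and serves as the centre of Taylor expansions. *)
Definition cell_point T : 'rV[R]_d := xget 0 (interior (geom T)).

Lemma cell_point_interior T : T \in cells Th -> interior (geom T) (cell_point T).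
Proof. by move=> TTh; have [x Tx] := cell_nondegenerate TTh; exact: (xgetI _ Tx). Qed.

Lemma cell_point_in T : T \in cells Th -> geom T (cell_point T).
Proof. by move=> /cell_point_interior; exact: interior_subset. Qed.

Lemma cell_point_open T : T \in cells Th -> open_cell T (cell_point T).
Proof.
move=> TTh i iT; have fT := cell_full TTh.
have [r r0 hr] := interior_line (- bgrad p T i) (cell_point_interior TTh).
have r2 : `|r / 2| < r by rewrite gtr0_norm ?divr_gt0// ltr_pdivrMr// ltr_pMr// ltr1n.
have /(hullP fT)/(_ i) := hr _ r2; rewrite baryD scalerN dotNr dotZr subr_ge0.
apply: lt_le_trans; rewrite mulr_gt0 ?divr_gt0// lt_def dotxx_ge0 andbT dotxx_eq0.
apply/eqP => g0; have := bgrad_diam_ge1 fT iT.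
by rewrite g0 enorm0 mul0r ler10.
Qed.

Lemma cell_point_domain T : T \in cells Th -> Omega (cell_point T).
Proof.
move=> TTh; apply: (interior_closure_domain hOmega).
by apply: interiorS (cell_point_interior TTh) => x; exact: cell_in_closure.
Qed.

Lemma segment_to_cell_point T x (t : R) : T \in cells Th -> geom T x -> 0 < t <= 1 ->
  open_cell T (x + t *: (cell_point T - x)).
Proof.
move=> TTh Tx /andP[t0 t1] i iT; have fT := cell_full TTh.
have -> : bary p T i (x + t *: (cell_point T - x)) =
    (1 - t) * bary p T i x + t * bary p T i (cell_point T).
  by rewrite baryD dotZr -baryB; ring.
apply: ltr_wpDl; first by rewrite mulr_ge0 ?subr_ge0//; move: i iT => i _; move: i; exact/(hullP fT).
by rewrite mulr_gt0// cell_point_open.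
Qed.

Lemma face_disjoint_open_cell T e x : T \in cells Th -> e \in faces Th -> geom e x ->
  ~ open_cell T x.
Proof.
move=> TTh ef ex Ox; have fT := cell_full TTh.
have /adjacentP[T'Th eT'] := cell_minus_adjacent ef; set T' := cell_minus e in T'Th eT'.
have Tx : geom T x.
  apply/(hullP fT) => i; have [iT|iT] := boolP (i \in T); first exact/ltW/Ox.
  by rewrite bary_out.
have T'x : geom T' x by exact: hullS ex.
have [l [l0 le l1] xE] := (hull_ptP p e x).1 ex.
have : T \subset e.
  apply/fintype.subsetP => i iT; apply: contraT => ie.
  have := Ox i iT; rewrite (common_coord i TTh T'Th Tx T'x) xE.
  rewrite (bary_pt (cell_full T'Th))//; first by rewrite le// ltxx.
  by move=> j jT'; apply: le; apply: contra jT'; exact: fintype.subsetP.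
by move=> /subset_leq_card; move: ef; rewrite inE (card_cell TTh) => /andP[/eqP -> _]; rewrite ltnn.
Qed.

Section Subdomain.
Variables (G : set 'rV[R]_d) (oG : open G) (F : {set simplex}) (Ffaces : F \subset faces Th).
Hypothesis frontierG : frontier G = \bigcup_(e in [set` F]) geom e.

(** The open cell is convex and avoids the frontier of G, which is made of faces. *)
Lemma open_cell_connected T x y : T \in cells Th -> open_cell T x -> open_cell T y ->
  G x -> G y.
Proof.
move=> TTh Tx Ty Gx; pose phi (t : R) := x + t *: (y - x).
have cphi : continuous phi.
  move=> t; rewrite /phi; apply: (@continuousD _ _ _ (fun=> x) (fun t : R => t *: (y - x))).
    exact: cst_continuous.
  by apply: (@continuousZr_tmp _ _ _ id); move=> ?.
have phiT t : 0 <= t <= 1 -> open_cell T (phi t).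
  move=> /andP[t0 t1] i iT.
  have -> : bary p T i (phi t) = (1 - t) * bary p T i x + t * bary p T i y.
    by rewrite /phi baryD dotZr -baryB; ring.
  have := Tx i iT; have := Ty i iT; move: t0; rewrite le_eqVlt => /predU1P[<-|t0] yi xi.
    by rewrite mul0r addr0 subr0 mul1r.
  by apply: ltr_wpDl; [rewrite mulr_ge0 ?subr_ge0// ltW | rewrite mulr_gt0].
have clG z : open_cell T z -> closure G z -> G z.
  move=> Tz cz; apply: contrapT => nG.
  have : frontier G z by split=> //; rewrite /= (interior_id _).1.
  rewrite frontierG => -[e /= eF ez].
  by case: (face_disjoint_open_cell TTh (fintype.subsetP Ffaces _ eF) ez Tz).
have := @segment_connected R 0 1 (`[0, 1]%classic `&` phi @^-1` G).
have <- : phi 1 = y by rewrite /phi scale1r addrC subrK.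
move=> E; suff : (`[0, 1]%classic `&` phi @^-1` G) 1 by case.
rewrite E /=; first by rewrite in_itv /= lexx ler01.
- by exists 0; split; [rewrite /= in_itv /= lexx ler01 | rewrite /= /phi scale0r addr0].
- exists (phi @^-1` G) => //; apply: open_comp => // t _; exact: cphi.
- exists (phi @^-1` closure G); first by apply: preimage_closed; [move=> t _; exact: cphi | exact: closed_closure].
  apply/seteqP; split=> t /= [t01 Gt]; split=> //; first exact: subset_closure.
  by apply: clG => //; apply: phiT; move: t01; rewrite in_itv.
Qed.

Lemma cell_meets T x : T \in cells Th -> geom T x -> G x -> G (cell_point T).
Proof.
move=> TTh Tx Gx; have [r r0 hr] := @interior_line _ _ G x (cell_point T - x) (oG Gx).
pose t : R := Num.min (r / 2) 1.
have t0 : 0 < t by rewrite lt_min divr_gt0//= ltr01.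
have t1 : t <= 1 by rewrite ge_min lexx orbT.
have tr : `|t| < r.
  rewrite gtr0_norm// gt_min; apply/orP; left.
  by rewrite ltr_pdivrMr// ltr_pMr// ltr1n.
apply: (open_cell_connected TTh (segment_to_cell_point TTh Tx _) (cell_point_open TTh) (hr _ tr)).
by rewrite t0.
Qed.

Lemma cell_inside T : T \in cells Th -> G (cell_point T) -> geom T `<=` closure G.
Proof.
move=> TTh Gc x Tx; apply: contrapT => nG.
have onG : open (~` closure G) by apply: closed_openC; exact: closed_closure.
have [r r0 hr] := @interior_line _ _ (~` closure G) x (cell_point T - x) (onG _ nG).
pose t : R := Num.min (r / 2) 1.
have t0 : 0 < t by rewrite lt_min divr_gt0//= ltr01.
have t1 : t <= 1 by rewrite ge_min lexx orbT.
have tr : `|t| < r.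
  rewrite gtr0_norm// gt_min; apply/orP; left.
  by rewrite ltr_pdivrMr// ltr_pMr// ltr1n.
apply: (hr _ tr); apply: subset_closure.
apply: (open_cell_connected TTh (cell_point_open TTh) (segment_to_cell_point TTh Tx _) Gc).
by rewrite t0.
Qed.

(** Suppose that g does not vanish at a node m of the smallest face
    containing x. Then m is in G, the closure of G contains the cell, and x
    is on the frontier of G, hence on a face included in that frontier. This
    face contains m as well, although m is in the open set G. *)
Lemma interpolate_local g x : (forall y, ~ G y -> g y = 0) -> ~ G x -> interpolate g x = 0.
Proof.
move=> g0 nG; have [[T [TTh Tx]]|h] := pselect (exists T, T \in cells Th /\ geom T x); last first.
  by apply: interpolate_out => T TTh Tx; apply: h; exists T.
have fT := cell_full TTh.
rewrite (interpolateE g TTh Tx); apply: interp0 => i j bi bj; apply: g0 => Gm.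
have iT : i \in T by apply: contraR bi => iT; rewrite (bary_out fT x iT).
have jT : j \in T by apply: contraR bj => jT; rewrite (bary_out fT x jT).
have Gc := cell_meets TTh (node_in p iT jT) Gm.
have : frontier G x.
  by split; [exact: cell_inside Tx | rewrite /= (interior_id _).1].
rewrite frontierG => -[e /= eF ex]; have ef := fintype.subsetP Ffaces _ eF.
have /adjacentP[T'Th eT'] := cell_minus_adjacent ef; set T' := cell_minus e in T'Th eT'.
have T'x : geom T' x by exact: hullS ex.
have [l [l0 le l1] xE] := (hull_ptP p e x).1 ex.
have supp k : bary p T k x != 0 -> k \in e.
  apply: contraR => ke; rewrite (common_coord k TTh T'Th Tx T'x) xE.
  rewrite (bary_pt (cell_full T'Th))//; first by rewrite le.
  by move=> m mT'; apply: le; apply: contra mT'; exact: fintype.subsetP.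
have : frontier G (node i j).
  rewrite frontierG; exists e => //.
  have -> : node i j = 2^-1 *: p i + (1 - 2^-1) *: p j.
    by rewrite /node scalerDr; congr (_ + _ *: _); lra.
  by apply: hull_convex; [exact: hull_vertex (supp i bi) | exact: hull_vertex (supp j bj) | apply/andP; split; lra].
by case=> _; rewrite /= (interior_id _).1.
Qed.

Lemma piece_local_eq0 v T : v \in fe_space Th -> (forall x, (Omega `\` G) x -> v x = 0) ->
  T \in cells Th -> ~ G (cell_point T) -> piece v T = 0.
Proof.
move=> vV vG TTh nG; apply: piece_eq => //; first exact: quadratic0.
move=> x Tx; have [Ox|nO] := pselect (Omega x).
  by apply: vG; split=> // Gx; apply: nG; exact: cell_meets Tx Gx.
by have [_ + _] := (fe_spaceP Th v).1 vV; apply.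
Qed.

End Subdomain.

End MeshInterpolation.

(** * Taylor expansion of twice continuously differentiable functions *)

Section Taylor.
Context {R : realType} {d : nat}.
Implicit Types (x y z u v : 'rV[R]_d) (f : 'rV[R]_d -> R) (s t : R).

Lemma is_derive_line f y v s : derivable f (y + s *: v) v ->
  is_derive s 1 (fun t => f (y + t *: v)) ('D_v f (y + s *: v)).
Proof.
have E : (fun h : R => h^-1 *: ((f \o shift (y + s *: v)) (h *: v) - f (y + s *: v))) =
    (fun h : R => h^-1 *: (((fun t => f (y + t *: v)) \o shift s) (h *: (1 : R)) - f (y + s *: v))).
  apply/funext => h; congr (_ *: (f _ - _)) => /=.
  by rewrite scalerDl [h *: (1 : R)]mulr1 addrCA.
by move=> df; apply: DeriveDef; [rewrite /derivable -E | rewrite /derive -E].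
Qed.

Lemma partial_mvt f (k : 'I_d) z (b : R) : (forall x, derivable f x (delta_mx 0 k)) ->
  exists2 s, `|s| <= `|b| &
    f (z + b *: delta_mx 0 k) - f z = b * partial k f (z + s *: delta_mx 0 k).
Proof.
move=> df; pose g t := f (z + t *: delta_mx 0 k).
have dg t : is_derive t 1 g (partial k f (z + t *: delta_mx 0 k)).
  exact: is_derive_line.
have cg (a c : R) : {within `[a, c], continuous g}.
  by apply: derivable_within_continuous => t _; case: (dg t).
have g0 : g 0 = f z by rewrite /g scale0r addr0.
rewrite -g0 -/(g b); have [b0|b0|<-] := ltgtP 0 b.
- have [s] := MVT b0 (fun t _ => dg t) (@cg _ _); rewrite in_itv /= => /andP[s0 sb] ->.
  by exists s; [rewrite !gtr0_norm ?ltW | rewrite subr0 mulrC].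
- have [s] := MVT b0 (fun t _ => dg t) (@cg _ _); rewrite in_itv /= => /andP[sb s0] E.
  exists s; first by rewrite !ltr0_norm ?lerN2 ?ltW.
  by rewrite -opprB E; ring.
- by exists 0; rewrite ?normr0// subrr mul0r.
Qed.

(** The coordinates of the increment are changed one at a time; the mean value
    theorem along one axis and the continuity of the partial derivative bound
    the error of each change. *)
Lemma increment_le f y (r : seq 'I_d) u (eps : R) :
  (forall i x, derivable f x (delta_mx 0 i)) -> (forall i, continuous (partial i f)) ->
  0 < eps -> exists2 rho : R, 0 < rho & forall h, `|h| < rho ->
    `|f (y + h *: \sum_(i <- r) u 0 i *: delta_mx 0 i) - f y
      - h * \sum_(i <- r) u 0 i * partial i f y| <= eps * `|h|.
Proof.
move=> df cf; elim: r eps => [|k r IH] eps e0.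
  exists 1 => // h _; rewrite !big_nil scaler0 addr0 subrr mulr0 subrr normr0.
  by rewrite mulr_ge0// ltW.
have [rho1 r1 H1] := IH (eps / 2) (divr_gt0 e0 (ltr0Sn _ _)).
set w := \sum_(i <- r) _ in H1; set D := \sum_(i <- r) _ in H1.
pose a := u 0 k; pose c : R := eps / (2 * (`|a| + 1)).
have a1 : 0 < `|a| + 1 by rewrite ltr_wpDl.
have c0 : 0 < c by rewrite divr_gt0// mulr_gt0.
have /nbhs_normP [rho2 /= r2 H2] : nbhs y [set z | `|partial k f y - partial k f z| <= c].
  by have /cvgrPdist_le := cf k y; apply.
pose M : R := `|w| + `|a| * `|delta_mx 0 k : 'rV[R]_d| + 1.
have M0 : 0 < M by rewrite ltr_wpDl// addr_ge0// mulr_ge0.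
exists (Num.min rho1 (rho2 / M)) => [|h]; first by rewrite lt_min r1 divr_gt0.
rewrite lt_min => /andP[h1 h2]; rewrite !big_cons -/w -/D -/a.
have [s sle sE] := partial_mvt (y + h *: w) (h * a) (df k).
have -> : f (y + h *: (a *: delta_mx 0 k + w)) - f y - h * (a * partial k f y + D) =
   (f (y + h *: w) - f y - h * D) +
   h * a * (partial k f (y + h *: w + s *: delta_mx 0 k) - partial k f y).
  rewrite mulrBr -sE scalerDr scalerA addrA addrAC; ring.
have zP : `|partial k f y - partial k f (y + h *: w + s *: delta_mx 0 k)| <= c.
  apply: H2; rewrite /= -addrA opprD addrA subrr sub0r normrN.
  apply: le_lt_trans (ler_normD _ _) _; rewrite !normrZ.
  apply: (@le_lt_trans _ _ (`|h| * M)); last by rewrite -ltr_pdivlMr.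
  rewrite /M !mulrDr mulr1 -addrA lerD2l ler_wpDr// mulrA.
  by rewrite ler_wpM2r// -normrM.
apply: le_trans (ler_normD _ _) _; apply: le_trans (lerD (H1 h h1) (lexx _)) _.
rewrite !normrM [`|_ - partial k f y|]distrC.
have : `|a| * c <= eps / 2.
  rewrite /c mulrA ler_pdivrMr ?mulr_gt0//.
  have -> : eps / 2 * (2 * (`|a| + 1)) = `|a| * eps + eps by field.
  by rewrite lerDl ltW.
have := ler_wpM2l (mulr_ge0 (normr_ge0 h) (normr_ge0 a)) zP.
by move=> K1 /(ler_wpM2l (normr_ge0 h)); move: K1; rewrite -!mulrA; lra.
Qed.

Lemma is_derive_grad f y u :
  (forall i x, derivable f x (delta_mx 0 i)) -> (forall i, continuous (partial i f)) ->
  is_derive y u f (dot (grad f y) u).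
Proof.
move=> df cf; have uE : u = \sum_(i <- index_enum 'I_d) u 0 i *: delta_mx 0 i.
  exact: row_sum_delta.
have DE : dot (grad f y) u = \sum_(i <- index_enum 'I_d) u 0 i * partial i f y.
  by apply: eq_bigr => i _; rewrite mxE mulrC.
suff c : h^-1 *: ((f \o shift y) (h *: u) - f y) @[h --> (0:R)^'] --> dot (grad f y) u.
  by apply: DeriveDef; [apply/cvg_ex; eexists; exact: c | exact: cvg_lim].
apply/cvgrPdist_le => eps e0.
have [rho r0 H] := increment_le y (index_enum 'I_d) u df cf e0.
near=> h.
have h0 : h != 0 by near: h; exact: nbhs_dnbhs_neq.
have hr : `|h| < rho by near: h; apply: dnbhs0_lt.
have := H h hr; rewrite -uE -DE /= addrC [h *: u + y]addrC => Hh.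
rewrite -(ler_pM2r (_ : 0 < `|h|)) ?normr_gt0// -normrM.
apply: le_trans Hh; rewrite -normrN le_eqVlt; apply/orP; left; apply/eqP; congr (`|_|).
by rewrite /GRing.scale /=; field.
Unshelve. all: by end_near.
Qed.

Lemma Ck_derivable k f : Ck k.+1 f -> forall i x, derivable f x (delta_mx 0 i).
Proof. by move=> [_ h] i; have [] := h i. Qed.

Lemma Ck_partial k f i : Ck k.+1 f -> Ck k (partial i f).
Proof. by move=> [_ h]; have [] := h i. Qed.

Lemma Ck_continuous k f : Ck k f -> continuous f.
Proof. by case: k => [|k] []. Qed.

(** The derivative along the segment is the product with the gradient, by the
    continuity of the partial derivatives. *)
Lemma segment_mvt k f c x : Ck k.+1 f -> exists2 s, 0 < s < 1 &
  f x - f c = dot (grad f (c + s *: (x - c))) (x - c).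
Proof.
move=> Cf; have df := Ck_derivable Cf.
have cf i : continuous (partial i f) by exact: Ck_continuous (Ck_partial i Cf).
pose g t := f (c + t *: (x - c)).
have dg t : is_derive t 1 g (dot (grad f (c + t *: (x - c))) (x - c)).
  by have [e1 <-] := is_derive_grad (c + t *: (x - c)) (x - c) df cf; exact: is_derive_line.
have cg : {within `[0, 1], continuous g}.
  by apply: derivable_within_continuous => t _; case: (dg t).
have [s] := MVT ltr01 (fun t _ => dg t) cg; rewrite in_itv /= => s01 E.
exists s => //; rewrite subr0 mulr1 in E; rewrite -E /g scale1r scale0r addr0.
by rewrite [c + _]addrC subrK.
Qed.

(** The gradient of a partial derivative is a row of the Hessian, whose norm
    is at most the Frobenius norm of the matrix. *)
Lemma grad_partial_le f i x : enorm (grad (partial i f) x) <= frobenius (hess f x).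
Proof.
rewrite /enorm /frobenius ler_wsqrtr// (bigD1 i)//= /dot.
have -> : \sum_i0 grad (partial i f) x 0 i0 * grad (partial i f) x 0 i0 =
    \sum_j hess f x i j ^+ 2.
  by apply: eq_bigr => j _; rewrite !mxE expr2.
by rewrite lerDl; apply: sumr_ge0 => k _; apply: sumr_ge0 => j _; exact: sqr_ge0.
Qed.

Section Bounds.
Variables (Om : set 'rV[R]_d) (f : 'rV[R]_d -> R) (M1 M2 : R) (c x : 'rV[R]_d).
Hypotheses (smooth_f : smooth f).
Hypothesis segment : forall s, 0 <= s < 1 -> Om (c + s *: (x - c)).
Hypothesis grad_bound : forall y, Om y -> enorm (grad f y) <= M1.
Hypothesis hess_bound : forall y, Om y -> frobenius (hess f y) <= M2.

Lemma taylor0_le : `|f x - f c| <= M1 * enorm (x - c).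
Proof.
have [s /andP[s0 s1] ->] := segment_mvt c x (smooth_f 1).
apply: le_trans (dot_le _ _) _; rewrite ler_wpM2r ?enorm_ge0//.
by apply: grad_bound; apply: segment; rewrite ltW.
Qed.

Lemma taylor1_le : `|f x - f c - dot (grad f c) (x - c)| <= d%:R * M2 * enorm (x - c) ^+ 2.
Proof.
have [s /andP[s0 s1] ->] := segment_mvt c x (smooth_f 1).
set y := c + s *: (x - c); rewrite -dotBl.
have yc : enorm (y - c) <= enorm (x - c).
  by rewrite /y addrAC subrr add0r enormZ gtr0_norm// ler_piMl ?enorm_ge0// ltW.
have M20 : 0 <= M2.
  have := @hess_bound c; rewrite -[c in Om c]addr0 -(scale0r (x - c)) => H.
  by apply: le_trans (H (segment _)); rewrite ?sqrtr_ge0// lexx ltr01.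
have part i : `|partial i f y - partial i f c| <= M2 * enorm (x - c).
  have [t /andP[t0 t1] ->] := segment_mvt c y (Ck_partial i (smooth_f 2)).
  apply: le_trans (dot_le _ _) _; apply: ler_pM; rewrite ?enorm_ge0//.
  apply: le_trans (grad_partial_le _ _ _) (hess_bound _).
  rewrite /y addrAC subrr add0r scalerA; apply: segment.
  by rewrite mulr_ge0 ?ltW//= -(mulr1 1) ltr_pM// ltW.
rewrite /dot; apply: le_trans (ler_norm_sum _ _ _) _.
have -> : d%:R * M2 * enorm (x - c) ^+ 2 = \sum_(i < d) M2 * enorm (x - c) * enorm (x - c).
  by rewrite sumr_const card_ord -mulr_natl; ring.
apply: ler_sum => i _; rewrite normrM; apply: ler_pM => //; last exact: enorm_entry.
have -> : (grad f y - grad f c) 0 i = partial i f y - partial i f c.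
  by rewrite 2!mxE /grad !mxE.
exact: part.
Qed.

End Bounds.
End Taylor.

(** * Localization by a cut-off function *)

Ltac nonneg := repeat first [ assumption | exact: ler0n | exact: ler01 | exact: sqr_ge0
  | apply: ltW; assumption | apply: addr_ge0 | apply: mulr_ge0 ].

Lemma eq_interp_in (R : realType) n d (p : 'I_n -> 'rV[R]_d) (T : {set 'I_n}) g g' :
  full_cell p T -> (forall x, hull p T x -> g x = g' x) -> interp p T g = interp p T g'.
Proof.
move=> fT gg; apply/funext => x.
rewrite (@eq_interp _ _ _ p T g (fun y => g' y + (g y - g' y))); last first.
  by move=> i j; rewrite addrC subrK.
rewrite interpD [X in _ + X]interp0 ?addr0// => i j bi bj.
rewrite gg ?subrr//; apply: node_in.
  by apply: contraR bi => iT; rewrite (bary_out fT x iT).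
by apply: contraR bj => jT; rewrite (bary_out fT x jT).
Qed.

Lemma dot_common_part (R : realType) d (s : R) (W W' V V' K n : 'rV[R]_d) :
  dot W n - dot W' n = s * (dot V n - dot V' n) +
    dot (W - (s *: V + K) - (W' - (s *: V' + K))) n.
Proof. by rewrite !dotBl !dotDl !dotZl; ring. Qed.

Section Localization.
Context {R : realType} {d' : nat} {Omega : set 'rV[R]_d'.+1}.
Local Notation d := d'.+1.
Variables (hOmega : convex_polytope_domain Omega) (Th : triangulation Omega).
Variables (sigma B : R) (hd : (0 < d')%N) (hsigma : 0 < sigma) (hB : 0 < B).
Hypothesis regular : shape_regular Th sigma.
Hypothesis bounded : forall x, closure Omega x -> enorm x <= B.
Local Notation simplex := {set 'I_(nvert Th)}.
Local Notation p := (vertex (t := Th)).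
Local Notation h T := (diam (geom (Th := Th) T)).
Implicit Types (A T e : simplex) (x c : 'rV[R]_d).
Variables (v : 'rV[R]_d -> R) (vV : v \in fe_space Th).

Definition lap_error_const : R := 4 * (d.+1 * d.+1)%:R * ((1 + sigma) ^+ 2 * sigma ^+ 2).
Definition grad_error_const : R := 5 * (d.+1 * d.+1)%:R * ((1 + sigma) ^+ 2 * sigma).
Local Notation cD := ((d.+1 * d.+2)%:R : R).

Section Cutoff.
Variables (f : 'rV[R]_d -> R) (M1 M2 : R) (M1_ge0 : 0 <= M1) (M2_ge0 : 0 <= M2).
Hypothesis smooth_f : smooth f.
Hypothesis f01 : forall x, closure Omega x -> 0 <= f x <= 1.
Hypothesis grad_f : forall x, Omega x -> enorm (grad f x) <= M1.
Hypothesis hess_f : forall x, Omega x -> frobenius (hess f x) <= M2.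
Local Notation w := (interpolate Th (fun x => f x * v x)).

Lemma cutoff_out x : ~ Omega x -> f x * v x = 0.
Proof. by have [_ v0 _] := (fe_spaceP Th v).1 vV => /v0 ->; rewrite mulr0. Qed.

Lemma cutoff_fe : w \in fe_space Th.
Proof. exact: (interpolate_fe hOmega Th cutoff_out). Qed.

Lemma segment_domain c x s : Omega c -> closure Omega x -> 0 <= s < 1 ->
  Omega (c + s *: (x - c)).
Proof.
move=> Oc Cx /andP[s0 s1].
have -> : c + s *: (x - c) = (1 - s) *: c + (1 - (1 - s)) *: x.
  by apply/rowP => i; rewrite !mxE; ring.
by apply: domain_segment; rewrite ?subr_gt0 ?s1// gerBl.
Qed.

(** With L the Taylor polynomial of f at c and q the polynomial of v, the
    product f q is a L + f(c) (q - a) plus a remainder that is quadratically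
    small on T; the polynomial part is reproduced by the interpolation, and an
    inverse estimate bounds the interpolant of the remainder. The term
    a grad f(c) depends on (a, c) only, so that it has no jump across a face
    when both cells use the same a and c. *)
Lemma local_error T c (a ell g : R) (Gb := d%:R * M2 * `|a| + M1 * g) :
  T \in cells Th -> Omega c -> (forall x, geom T x -> enorm (x - c) <= ell) ->
  0 <= g -> (forall x, geom T x -> `|v x - a| <= ell * g) -> ell <= (1 + sigma) * h T ->
  (forall x, geom T x ->
     enorm (grad (piece w T) x - (f c *: grad (piece v T) x + a *: grad f c)) <=
     grad_error_const * (h T * Gb)) /\
  `|cell_lap w T - f c * cell_lap v T| <= lap_error_const * Gb.
Proof.
move=> TTh Oc xc g0 va lh; have fT := cell_full TTh; have h0 := h_gt0 TTh.
have qq := piece_quadratic vV TTh; set q := piece v T in qq *.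
have [x0 Tx0] : exists x, geom T x by exists (cell_point T); exact: cell_point_in.
have l0 : 0 <= ell by apply: le_trans (xc x0 Tx0); exact: enorm_ge0.
have G0 : 0 <= Gb by rewrite addr_ge0// mulr_ge0// mulr_ge0.
pose b := a *: grad f c; pose k : R := a * (f c - dot (grad f c) c) - f c * a.
pose q2 : 'rV[R]_d -> R := f c *: q + (fun x => dot b x + k).
have qb : quadratic (fun x => dot b x + k) by apply: affine_quadratic; exists b, k.
have qq2 : quadratic q2 by exact: quadratic_lin.
pose r x := f x * v x - q2 x.
have pE : piece w T = 1 *: q2 + interp p T r.
  rewrite (piece_interpolate hOmega cutoff_out TTh); apply/funext => x.
  rewrite (@eq_interp _ _ _ p T _ (fun y => q2 y + r y)); last first.
    by move=> i j; rewrite /r addrC subrK.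
  by rewrite interpD (interp_quadratic fT qq2) scale1r.
have rle x : geom T x -> `|r x| <= ell ^+ 2 * Gb.
  move=> Tx; have Cx := cell_in_closure TTh Tx.
  have seg s := segment_domain (s := s) Oc Cx.
  have t0 := taylor0_le smooth_f seg grad_f; have t1 := taylor1_le smooth_f seg hess_f.
  have -> : r x = a * (f x - f c - dot (grad f c) (x - c)) + (f x - f c) * (v x - a).
    rewrite /r /q2 !fctE /b /k dotZl dotBr /q (pieceE vV TTh Tx) /GRing.scale /=; ring.
  apply: le_trans (ler_normD _ _) _; rewrite !normrM.
  have e2 : enorm (x - c) ^+ 2 <= ell ^+ 2 by rewrite ler_pXn2r ?nnegrE ?enorm_ge0// xc.
  have dM : 0 <= d%:R * M2 by rewrite mulr_ge0.
  have A1 := ler_wpM2l (normr_ge0 a) (le_trans t1 (ler_wpM2l dM e2)).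
  have A2 := ler_pM (normr_ge0 _) (normr_ge0 _) (le_trans t0 (ler_wpM2l M1_ge0 (xc x Tx))) (va x Tx).
  apply: le_trans (lerD A1 A2) _; rewrite le_eqVlt; apply/orP; left; apply/eqP; rewrite /Gb; ring.
have rn i j : i \in T -> j \in T -> `|r (node p i j)| <= ell ^+ 2 * Gb.
  by move=> iT jT; apply: rle; exact: node_in.
have gam i : i \in T -> enorm (bgrad p T i) <= sigma / h T.
  by move=> iT; apply: (bgrad_le_div fT (regular TTh) iT); exact: ltW.
have l2 : ell ^+ 2 <= (1 + sigma) ^+ 2 * h T ^+ 2.
  by rewrite -exprMn ler_pXn2r ?nnegrE// (le_trans l0).
have lG := ler_wpM2r G0 l2.
have M0 : 0 <= ell ^+ 2 * Gb by rewrite mulr_ge0 ?sqr_ge0.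
have qi := quadratic_interp p T r.
split=> [x Tx|].
  rewrite pE (grad_lin _ _ qq2 qi) scale1r (grad_lin _ _ qq qb) grad_affine -/b.
  rewrite addrAC subrr add0r; apply: le_trans (grad_interp_le fT M0 gam rn Tx) _.
  have c0 : 0 <= 5 * (d.+1 * d.+1)%:R * (sigma / h T) :> R.
    by rewrite !mulr_ge0 ?invr_ge0 ?ler0n ?(ltW hsigma) ?(ltW h0).
  have -> : 5 * (d.+1 * d.+1)%:R * (ell ^+ 2 * Gb * (sigma / h T)) =
    5 * (d.+1 * d.+1)%:R * (sigma / h T) * (ell ^+ 2 * Gb) by ring.
  apply: le_trans (ler_wpM2l c0 lG) _; rewrite le_eqVlt; apply/orP; left; apply/eqP.
  by rewrite /grad_error_const; field; rewrite gt_eqF.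
have -> : cell_lap w T - f c * cell_lap v T = laplacian (interp p T r).
  have lE : laplacian q2 = f c * laplacian q by rewrite (laplacian_lin _ qq qb) laplacian_affine addr0.
  rewrite /cell_lap pE (laplacian_lin 1 qq2 qi) lE -/q.
  by move: (laplacian q) (laplacian _) => a1 a2; ring.
apply: le_trans (laplacian_interp_le fT gam rn) _.
have c0 : 0 <= 4 * (d.+1 * d.+1)%:R * (sigma / h T) ^+ 2 :> R.
  by nonneg.
have -> : 4 * (d.+1 * d.+1)%:R * (ell ^+ 2 * Gb * (sigma / h T) ^+ 2) =
  4 * (d.+1 * d.+1)%:R * (sigma / h T) ^+ 2 * (ell ^+ 2 * Gb) by ring.
apply: le_trans (ler_wpM2l c0 lG) _; rewrite le_eqVlt; apply/orP; left; apply/eqP.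
by rewrite /lap_error_const; field; rewrite gt_eqF.
Qed.

Definition cell_energy T : R := cell_L2 v T + cell_H1 v T.
Definition local_const : R := 4 * d%:R ^+ 2 * (2 + 8 * B ^+ 2 * cD) + 4 * cD.

Lemma cell_energy_ge0 T : T \in cells Th -> 0 <= cell_energy T.
Proof. by move=> TTh; rewrite addr_ge0 ?cell_L2_ge0 ?cell_H1_ge0. Qed.

Lemma cD_ge0 : 0 <= cD. Proof. exact: ler0n. Qed.

Lemma local_const_ge0 : 0 <= local_const.
Proof.
by rewrite /local_const; nonneg.
Qed.

Lemma meas_value_le T x : T \in cells Th -> geom T x ->
  meas T * v x ^+ 2 <= (2 + 8 * B ^+ 2 * cD) * cell_energy T.
Proof.
move=> TTh Tx; have fT := cell_full TTh; have qq := piece_quadratic vV TTh.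
have m0 := ltW (meas_cell_gt0 TTh); have := sqr_value_le_mean fT qq Tx.
rewrite (pieceE vV TTh Tx) => /(ler_wpM2l m0); rewrite mulrDr.
set L := smean T _; set s := grad_sup _ _ _ => H.
have H1 := cell_grad_sup vV TTh; rewrite -/s in H1.
have hB2 : h T ^+ 2 <= 4 * B ^+ 2.
  have -> : 4 * B ^+ 2 = (2 * B) ^+ 2 by ring.
  by rewrite ler_pXn2r ?nnegrE ?(ltW (h_gt0 TTh)) ?(h_le bounded)// mulr_ge0// ltW.
have s0 : 0 <= meas T * s ^+ 2 by rewrite mulr_ge0 ?sqr_ge0.
have H2 := ler_wpM2l s0 hB2.
have b0 : 0 <= 4 * B ^+ 2 by rewrite mulr_ge0 ?sqr_ge0.
have H3 := ler_wpM2r b0 H1.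
have L0 := cell_L2_ge0 v TTh; have G0 := cell_H1_ge0 v TTh.
have LE : cell_L2 v T = meas T * L by [].
have c8 : 0 <= 8 * B ^+ 2 * cD * cell_L2 v T by nonneg.
rewrite /geom in H2; rewrite /cell_energy; move: H H2 H3 c8 L0 G0; rewrite LE exprMn.
move: (cell_H1 v T) (B ^+ 2) (s ^+ 2) (diam _ ^+ 2) (meas T) cD => *; lra.
Qed.

Lemma meas_grad_le T : T \in cells Th ->
  meas T * grad_sup p T (piece v T) ^+ 2 <= cD * cell_energy T.
Proof.
move=> TTh; apply: le_trans (cell_grad_sup vV TTh) _; apply: ler_wpM2l; first exact: cD_ge0.
by rewrite lerDr; exact: cell_L2_ge0.
Qed.

Lemma ler_double (a : R) : 0 <= a -> a <= 2 * a.
Proof. by lra. Qed.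

Lemma cross_le (a b c e : R) : 0 <= a -> 0 <= b -> 0 <= c -> 0 <= e ->
  c * a <= (a + b) * (c + e) /\ e * b + c * a <= (a + b) * (c + e).
Proof.
move=> a0 b0 c0 e0; have := mulr_ge0 a0 e0; have := mulr_ge0 b0 c0.
by have := mulr_ge0 b0 e0; split; lra.
Qed.

(** The weight o of a face is bounded by the measures m and m' of both cells,
    so that each term is estimated on the cell to which it belongs. *)
Lemma two_cell_weight_le (o kap m m' E E' a g g' cV c : R) :
  0 <= o -> o <= kap * m -> o <= kap * m' -> 0 <= kap -> 0 <= E -> 0 <= E' -> 0 <= cV ->
  m * a ^+ 2 <= cV * E -> m * g ^+ 2 <= c * E -> m' * g' ^+ 2 <= c * E' ->
  o * a ^+ 2 <= cV * (kap * (E + E')) /\ o * (g + g') ^+ 2 <= 2 * c * (kap * (E + E')).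
Proof.
move=> o0 om om' k0 E0 E0' cV0 ha hg hg'.
have A1 := ler_wpM2r (sqr_ge0 a) om; have A2 := ler_wpM2l k0 ha.
have A3 := mulr_ge0 cV0 (mulr_ge0 k0 E0').
have G0 := ler_wpM2l o0 (sqrD_le g g').
have G1 := ler_wpM2r (sqr_ge0 g) om; have G2 := ler_wpM2l k0 hg.
have G3 := ler_wpM2r (sqr_ge0 g') om'; have G4 := ler_wpM2l k0 hg'.
by split; lra.
Qed.

Lemma split_error_le (m b err s l X E : R) : 0 <= m -> `|s| <= 1 ->
  err ^+ 2 <= l ^+ 2 * X -> m * X <= E ->
  m * (s * b + err) ^+ 2 <= 2 * (m * b ^+ 2) + 2 * l ^+ 2 * E.
Proof.
move=> m0 /sqr_le_of_norm; rewrite expr1n => s1 eX XE.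
have := ler_wpM2l m0 (sqrD_le (s * b) err); rewrite exprMn => K.
have K1 : s ^+ 2 * (m * b ^+ 2) <= 1 * (m * b ^+ 2) by rewrite ler_wpM2r// mulr_ge0 ?sqr_ge0.
have K2 := ler_wpM2l m0 eX; have K3 := ler_wpM2l (sqr_ge0 l) XE; lra.
Qed.

Lemma remainder_le (m a g E : R) : 0 <= m -> 0 <= E ->
  m * a ^+ 2 <= (2 + 8 * B ^+ 2 * cD) * E -> m * g ^+ 2 <= 2 * cD * E ->
  m * (d%:R * M2 * `|a| + M1 * g) ^+ 2 <= local_const * (M1 ^+ 2 + M2 ^+ 2) * E.
Proof.
move=> m0 E0 ha hg.
have := sqrD_le (d%:R * M2 * `|a|) (M1 * g); rewrite !exprMn real_normK ?num_real//.
move=> /(ler_wpM2l m0) K; apply: le_trans K _.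
have A := ler_wpM2l (mulr_ge0 (sqr_ge0 (d%:R : R)) (sqr_ge0 M2)) ha.
have A' := ler_wpM2l (sqr_ge0 M1) hg.
have Q1 : 0 <= d%:R ^+ 2 * (2 + 8 * B ^+ 2 * cD) * (M1 ^+ 2 * E) by nonneg.
have Q2 : 0 <= d%:R ^+ 2 * (2 + 8 * B ^+ 2 * cD) * (M2 ^+ 2 * E) by nonneg.
have Q3 : 0 <= cD * (M2 ^+ 2 * E) by nonneg.
have Q4 : 0 <= cD * (M1 ^+ 2 * E) by nonneg.
rewrite /local_const; move: A A' Q1 Q2 Q3 Q4; set cV := 2 + _; set D2 := d%:R ^+ 2; lra.
Qed.

(** The expansion is centred at a point of the cell. *)
Lemma cutoff_lap_le T : T \in cells Th ->
  meas T * cell_lap w T ^+ 2 <= 2 * (meas T * cell_lap v T ^+ 2) +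
    2 * lap_error_const ^+ 2 * (local_const * (M1 ^+ 2 + M2 ^+ 2) * cell_energy T).
Proof.
move=> TTh; set c := cell_point T; have Tc : geom T c by exact: cell_point_in.
have Oc : Omega c by exact: cell_point_domain.
have h0 := h_gt0 TTh; have fT := cell_full TTh.
set g := grad_sup p T (piece v T).
have [||||_] := @local_error T c (v c) (h T) g TTh Oc.
- by move=> x Tx; exact: enorm_le_diam.
- exact: grad_sup_ge0.
- move=> x Tx; rewrite -(pieceE vV TTh Tx) -(pieceE vV TTh Tc) mulrC.
  by apply: quadratic_lipschitz => //; exact: piece_quadratic.
- by rewrite mulrDl mul1r lerDl mulr_ge0// ltW.
set G := d%:R * M2 * _ + _ => /sqr_le_of_norm; rewrite exprMn => H.
have m0 := ltW (meas_cell_gt0 TTh).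
have E0 := cell_energy_ge0 TTh.
have G2 : meas T * G ^+ 2 <= local_const * (M1 ^+ 2 + M2 ^+ 2) * cell_energy T.
  apply: remainder_le => //; first exact: meas_value_le.
  by apply: le_trans (meas_grad_le TTh) _; rewrite -mulrA; exact: ler_double (mulr_ge0 cD_ge0 E0).
have f1 : `|f c| <= 1.
  by have /andP[f0 f1] := f01 (cell_in_closure TTh Tc); rewrite ger0_norm.
have -> : cell_lap w T = f c * cell_lap v T + (cell_lap w T - f c * cell_lap v T).
  by rewrite addrC subrK.
exact: split_error_le m0 f1 H G2.
Qed.

Definition face_error_const : R :=
  grad_error_const ^+ 2 * (d%:R * sigma / face_low (d' := d') sigma * (1 + sigma) ^+ 2).

Lemma face_error_const_ge0 : 0 <= face_error_const.
Proof.
by rewrite /face_error_const; nonneg; rewrite invr_ge0 ltW// face_low_gt0.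
Qed.

(** Adjacent cells share an edge, because d is at least 2, and the diameter of
    a shape regular cell is comparable to the length of each of its edges. *)
Lemma adjacent_diam_le T T' e : T \in cells Th -> T' \in cells Th -> e \in faces Th ->
  e \subset T -> e \subset T' -> h T <= sigma * h T'.
Proof.
move=> TTh T'Th ef eT eT'.
have : (1 < #|e|)%N by move: ef; rewrite inE => /andP[/eqP -> _].
move=> /card_gt1P[i [j [ie je ij]]].
have sub (A : simplex) k : e \subset A -> k \in e -> k \in A.
  by move=> /fintype.subsetP eA; exact: eA.
apply: le_trans (edge_ge (cell_full TTh) (regular TTh) (sub _ _ eT ie) (sub _ _ eT je) ij _) _.
  exact: ltW.
rewrite ler_wpM2l ?(ltW hsigma)//; apply: enorm_le_diam; apply: hull_vertex; exact: sub eT' _.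
Qed.

(** Both cells use the expansion centred at one point c of the minus cell; a
    vertex of the face connects c with the points of the plus cell. *)
Lemma cutoff_jump_le e : e \in interior_faces Th ->
  (face_diam e)^-1 * face_jump2 w e <= 2 * ((face_diam e)^-1 * face_jump2 v e) +
    2 * face_error_const * (local_const * (M1 ^+ 2 + M2 ^+ 2) *
      (cell_energy (cell_minus e) + cell_energy (cell_plus e))).
Proof.
move=> eI; have ef := interior_face eI.
have /adjacentP[mTh em] := cell_minus_adjacent ef.
have [/adjacentP[pTh ep] _] := cell_plus_adjacent eI.
set m := cell_minus e in mTh em *; set t := cell_plus e in pTh ep *.
pose c := cell_point m; have mc : geom m c by exact: cell_point_in.
have Oc : Omega c by exact: cell_point_domain.
have /set0Pn[i ie] := face_neq_set0 ef.
have im := fintype.subsetP em i ie; have it := fintype.subsetP ep i ie.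
have pm : geom m (p i) by exact: hull_vertex.
have pt' : geom t (p i) by exact: hull_vertex.
pose gm := grad_sup p m (piece v m); pose gt := grad_sup p t (piece v t).
have gm0 : 0 <= gm by exact: grad_sup_ge0.
have gt0 : 0 <= gt by exact: grad_sup_ge0.
have hm0 := ltW (h_gt0 mTh); have ht0 := ltW (h_gt0 pTh).
pose ell := h m + h t; pose g := gm + gt.
have g0 : 0 <= g := addr_ge0 gm0 gt0.
have ell0 : 0 <= ell := addr_ge0 hm0 ht0.
have lip T x y : T \in cells Th -> geom T x -> geom T y ->
    `|v x - v y| <= grad_sup p T (piece v T) * h T.
  move=> TTh Tx Ty; rewrite -(pieceE vV TTh Tx) -(pieceE vV TTh Ty).
  by apply: (quadratic_lipschitz (cell_full TTh)) => //; exact: piece_quadratic.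
have [g1 g2] := cross_le hm0 ht0 gm0 gt0; rewrite -/ell -/g in g1 g2.
have lm : ell <= (1 + sigma) * h m.
  by rewrite mulrDl mul1r lerD2l; exact: (adjacent_diam_le pTh mTh ef ep em).
have lt : ell <= (1 + sigma) * h t.
  by rewrite mulrDl mul1r /ell addrC lerD2l; exact: (adjacent_diam_le mTh pTh ef em ep).
have [|||//|em1 _] := @local_error m c (v c) ell g mTh Oc.
- by move=> x mx; apply: le_trans (enorm_le_diam mx mc) _; rewrite lerDl.
- exact: g0.
- by move=> x mx; apply: le_trans g1; exact: lip.
have [|||//|et1 _] := @local_error t c (v c) ell g pTh Oc.
- move=> x tx; have -> : x - c = (x - p i) + (p i - c) by rewrite addrA subrK.
  apply: le_trans (enormD _ _) _; rewrite /ell addrC.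
  by apply: lerD; [exact: enorm_le_diam pm mc | exact: enorm_le_diam tx pt'].
- exact: g0.
- move=> x tx; have -> : v x - v c = (v x - v (p i)) + (v (p i) - v c) by rewrite addrA subrK.
  apply: le_trans (ler_normD _ _) _; apply: le_trans g2.
  by apply: lerD; exact: lip.
move: em1 et1; set G := d%:R * M2 * _ + _ => em1 et1.
pose X := (grad_error_const * (ell * G)) ^+ 2.
have e0 := face_neq_set0 ef; have wV := cutoff_fe.
have pw := polyfX 2 (polyf_normal_jump wV eI); have pv := polyfX 2 (polyf_normal_jump vV eI).
have sm : smean e (fun l => normal_jump w e l ^+ 2) <=
    2 * smean e (fun l => normal_jump v e l ^+ 2) + 2 * X.
  rewrite -(smean_cst (2 * X) e0) -smean_lin//; last exact: polyf_cst.
  apply: ler_smean => //.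
    by apply: polyfD; [apply: polyfZ | exact: polyf_cst].
  move=> l le; have mx := hull_pt p (in_simplexS em le); have tx := hull_pt p (in_simplexS ep le).
  have := em1 _ mx; have := et1 _ tx.
  rewrite !normal_jumpE -/m -/t; set n := face_normal e; set x := pt p l.
  set Wt := grad (piece w t) x; set Wm := grad (piece w m) x.
  set Vt := grad (piece v t) x; set Vm := grad (piece v m) x; set K := v c *: _.
  set Et := Wt - _; set Em := Wm - _ => Etle Emle.
  have -> : dot Wt n - dot Wm n = f c * (dot Vt n - dot Vm n) + dot (Et - Em) n.
    exact: dot_common_part.
  have n1 : enorm n = 1 by exact: enorm_face_normal.
  have E1 : `|dot (Et - Em) n| <= grad_error_const * (ell * G).
    apply: le_trans (dot_le _ _) _; rewrite n1 mulr1.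
    apply: le_trans (enormD _ _) _; rewrite enormN; apply: le_trans (lerD Etle Emle) _.
    by rewrite /ell -mulrDr -mulrDl [h t + _]addrC.
  have f1 : `|f c| <= 1.
    by have /andP[f0 f1] := f01 (cell_in_closure mTh mc); rewrite ger0_norm.
  have := @split_error_le 1 (dot Vt n - dot Vm n) (dot (Et - Em) n) (f c) 1 X X ler01 f1.
  rewrite !expr1n !mul1r mulr1; apply; last exact: lexx.
  exact: sqr_le_of_norm.
have fd0 := face_diam_gt0 hd hsigma regular ef.
pose w0 := (face_diam e)^-1 * meas e.
have w00 : 0 <= w0 by rewrite mulr_ge0 ?meas_ge0 ?invr_ge0 ?ltW.
have jE u : (face_diam e)^-1 * face_jump2 u e = w0 * smean e (fun l => normal_jump u e l ^+ 2).
  exact: mulrA.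
rewrite [leLHS]jE (jE v); apply: le_trans (ler_wpM2l w00 sm) _.
rewrite mulrDr [w0 * (2 * _)]mulrCA lerD2l.
pose kap : R := d%:R * sigma / face_low (d' := d') sigma * (1 + sigma) ^+ 2.
have kap0 : 0 <= kap by rewrite /kap; nonneg; rewrite invr_ge0 ltW// face_low_gt0.
have wle T : T \in cells Th -> e \subset T -> ell <= (1 + sigma) * h T ->
    w0 * ell ^+ 2 <= kap * meas T.
  move=> TTh eT lT; have h0 := h_gt0 TTh.
  have := meas_face_inv_diam hd hsigma regular TTh ef eT; rewrite -/w0 => H.
  have l2 : ell ^+ 2 <= ((1 + sigma) * h T) ^+ 2.
    by have l1 := le_trans ell0 lT; rewrite ler_pXn2r ?nnegrE.
  apply: le_trans (ler_pM w00 (sqr_ge0 _) H l2) _.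
  by rewrite le_eqVlt; apply/orP; left; apply/eqP; rewrite /kap; field; rewrite !gt_eqF// face_low_gt0.
pose E := kap * (cell_energy m + cell_energy t).
have Em0 := cell_energy_ge0 mTh; have Et0 := cell_energy_ge0 pTh.
have [K1 K2] : w0 * ell ^+ 2 <= kap * meas m /\ w0 * ell ^+ 2 <= kap * meas t.
  by split; exact: wle.
have o0 : 0 <= w0 * ell ^+ 2 by rewrite mulr_ge0 ?sqr_ge0.
have cV0 : 0 <= 2 + 8 * B ^+ 2 * cD by nonneg.
have [W1 W2] := two_cell_weight_le o0 K1 K2 kap0 Em0 Et0 cV0 (meas_value_le mTh mc)
  (meas_grad_le mTh) (meas_grad_le pTh).
have E0 : 0 <= E := mulr_ge0 kap0 (addr_ge0 Em0 Et0).
have GE : w0 * ell ^+ 2 * G ^+ 2 <= local_const * (M1 ^+ 2 + M2 ^+ 2) * E.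
  exact: (remainder_le o0 E0 W1 W2).
have := ler_wpM2l (sqr_ge0 grad_error_const) GE.
have -> : w0 * (2 * X) = 2 * (grad_error_const ^+ 2 * (w0 * ell ^+ 2 * G ^+ 2)).
  by rewrite /X !exprMn; ring.
move=> H; apply: le_trans (ler_wpM2l _ H) _ => //.
rewrite le_eqVlt; apply/orP; left; apply/eqP; rewrite /face_error_const /E -/kap; ring.
Qed.

End Cutoff.
End Localization.

(** * Decompositions subordinate to the subdomains *)

Lemma sum_active_le (R : realType) (I : finType) (A : {set I}) (n : nat) (F : I -> R) (b : R) :
  (#|A| <= n)%N -> 0 <= b -> (forall j, j \in A -> F j <= b) ->
  (forall j, j \notin A -> F j = 0) -> \sum_j F j <= n%:R * b.
Proof.
move=> An b0 Fb F0; rewrite (bigID (mem A)) /= [X in _ + X]big1// addr0.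
apply: (@le_trans _ _ (\sum_(j in A) b)); first exact: ler_sum.
by rewrite sumr_const -[b *+ _]mulr_natl ler_wpM2r// ler_nat.
Qed.

Section Decomposition.
Context {R : realType} {d' : nat} {Omega : set 'rV[R]_d'.+1}.
Local Notation d := d'.+1.
Variables (hOmega : convex_polytope_domain Omega) (Th : triangulation Omega).
Variables (sigma B K : R) (hd : (0 < d')%N) (hsigma : 0 < sigma) (hB : 0 < B) (hK : 0 < K).
Hypothesis regular : shape_regular Th sigma.
Hypothesis bounded : forall x, closure Omega x -> enorm x <= B.
Local Notation simplex := {set 'I_(nvert Th)}.
Local Notation p := (vertex (t := Th)).
Variables (Nc : nat) (H delta : R) (J : nat).
Variables (Om : 'I_J -> set 'rV[R]_d) (theta : 'I_J -> 'rV[R]_d -> R).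
Hypothesis dec : overlapping_decomposition Th K Nc H delta Om theta.
Implicit Types (A T e : simplex) (x : 'rV[R]_d) (v : 'rV[R]_d -> R) (j : 'I_J).

Lemma sub_domain j x : Om j x -> Omega x.
Proof. by move=> Ox; rewrite (sub_cover dec); exists j. Qed.

(** The subdomains that contain the cell; by alignment the others do not meet
    its interior. *)
Definition active T : {set 'I_J} := [set j | `[< Om j (cell_point T) >]]%SET.

Lemma card_active T : T \in cells Th -> (#|active T| <= Nc)%N.
Proof. by move=> TTh; apply: (sub_overlap dec); exact: cell_point_domain. Qed.

Definition active_face e : {set 'I_J} := active (cell_minus e) :|: active (cell_plus e).

Lemma card_active_face e : e \in interior_faces Th -> (#|active_face e| <= 2 * Nc)%N.
Proof.
move=> eI; apply: leq_trans (leq_card_setU _ _) _; rewrite mul2n -addnn.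
have /adjacentP[mTh _] := cell_minus_adjacent (interior_face eI).
have [/adjacentP[pTh _] _] := cell_plus_adjacent eI.
by apply: leq_add; exact: card_active.
Qed.

Section Family.
Variables (u : 'I_J -> 'rV[R]_d -> R) (uV : forall j, u j \in fe_space Th).
Hypothesis u_local : forall j x, (Omega `\` Om j) x -> u j x = 0.

Lemma piece_inactive j T : T \in cells Th -> j \notin active T -> piece (u j) T = 0.
Proof.
move=> TTh; rewrite inE => /asboolPn nO; have [F FF E] := sub_aligned dec j.
exact: (piece_local_eq0 (sub_open (j := j) dec) FF E (uV j) (u_local (j := j)) TTh nO).
Qed.

Lemma cell_lap_inactive j T : T \in cells Th -> j \notin active T -> cell_lap (u j) T = 0.
Proof. by move=> TTh jT; rewrite /cell_lap piece_inactive//; exact: (laplacian_cst 0). Qed.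

Lemma normal_jump_inactive j e l : e \in interior_faces Th -> j \notin active_face e ->
  normal_jump (u j) e l = 0.
Proof.
move=> eI; rewrite inE negb_or => /andP[jm jp].
have /adjacentP[mTh _] := cell_minus_adjacent (interior_face eI).
have [/adjacentP[pTh _] _] := cell_plus_adjacent eI.
have g0 x : grad (0 : 'rV[R]_d -> R) x = 0 by exact: (grad_cst 0).
by rewrite normal_jumpE !piece_inactive// g0 dot0l subrr.
Qed.

Lemma face_jump2_inactive j e : e \in interior_faces Th -> j \notin active_face e ->
  face_jump2 (u j) e = 0.
Proof.
move=> eI je; have e0 := face_neq_set0 (interior_face eI).
rewrite /face_jump2 (@eq_smean _ _ _ _ (fun=> 0)) ?smean_cst ?mulr0// => l _.
by rewrite normal_jump_inactive// expr0n.
Qed.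

Lemma sum_fe : \sum_j u j \in fe_space Th.
Proof. by apply: rpred_sum => j _. Qed.

Lemma piece_sum T : T \in cells Th ->
  piece (\sum_j u j) T = (fun x => \sum_j 1 * piece (u j) T x).
Proof.
move=> TTh; apply: piece_eq => //; first exact: sum_fe.
  by apply: quadratic_sum => j; exact: piece_quadratic.
move=> x Tx; rewrite fct_sumE; apply: eq_bigr => j _.
by rewrite mul1r (pieceE (uV j) TTh Tx).
Qed.

Lemma cell_lap_sum T : T \in cells Th -> cell_lap (\sum_j u j) T = \sum_j cell_lap (u j) T.
Proof.
move=> TTh; rewrite /cell_lap piece_sum// laplacian_sum.
  by apply: eq_bigr => j _; rewrite mul1r.
by move=> j; exact: piece_quadratic.
Qed.

Lemma normal_jump_sum e l : e \in interior_faces Th ->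
  normal_jump (\sum_j u j) e l = \sum_j normal_jump (u j) e l.
Proof.
move=> eI; have /adjacentP[mTh _] := cell_minus_adjacent (interior_face eI).
have [/adjacentP[pTh _] _] := cell_plus_adjacent eI.
have qm j : quadratic (piece (u j) (cell_minus e)) by exact: piece_quadratic.
have qp j : quadratic (piece (u j) (cell_plus e)) by exact: piece_quadratic.
rewrite normal_jumpE !piece_sum// !grad_sum// !dot_suml -sumrB.
by apply: eq_bigr => j _; rewrite normal_jumpE !scale1r.
Qed.

Lemma sqr_sum_active (A : {set 'I_J}) (n : nat) (F : 'I_J -> R) : (#|A| <= n)%N ->
  (forall j, j \notin A -> F j = 0) -> (\sum_j F j) ^+ 2 <= n%:R * \sum_j F j ^+ 2.
Proof.
move=> An F0; have E (G : 'I_J -> R) : (forall j, j \notin A -> G j = 0) ->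
    \sum_j G j = \sum_(j in A) G j.
  by move=> G0; rewrite (bigID (mem A)) /= [X in _ + X]big1 ?addr0.
rewrite (E F)// (E (fun j => F j ^+ 2)); last by move=> j /F0 ->; rewrite expr0n.
exact: sqr_sum_le_nat.
Qed.

(** Only the functions whose subdomain meets a cell, or one of the two cells of
    a face, contribute to the sum there. *)
Lemma mesh_norm2_sum_le :
  mesh_norm2 Th (\sum_j u j) <= (2 * Nc)%:R * \sum_j mesh_norm2 Th (u j).
Proof.
rewrite /mesh_norm2 big_split /= mulrDr; apply: lerD.
  apply: (@le_trans _ _ (Nc%:R * \sum_j lap_energy Th (u j))); last first.
    apply: ler_wpM2r; first by apply: sumr_ge0 => j _; exact: lap_energy_ge0.
    by rewrite ler_nat leq_pmull.
  rewrite /lap_energy exchange_big /= mulr_sumr; apply: ler_sum => T TTh.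
  rewrite -mulr_sumr [leRHS]mulrCA ler_wpM2l ?meas_ge0// cell_lap_sum//.
  by apply: sqr_sum_active (card_active TTh) _ => j; exact: cell_lap_inactive.
rewrite /jump_energy exchange_big /= mulr_sumr; apply: ler_sum => e eI.
have ef := interior_face eI; have e0 := face_neq_set0 ef.
rewrite -mulr_sumr [leRHS]mulrCA ler_wpM2l ?invr_ge0 ?(ltW (face_diam_gt0 hd hsigma regular ef))//.
rewrite /face_jump2 -mulr_sumr [leRHS]mulrCA ler_wpM2l ?meas_ge0//.
have pj j : polyf (fun l => normal_jump (u j) e l ^+ 2).
  by apply: polyfX; exact: polyf_normal_jump.
rewrite -smean_sum// -smeanZ//; last exact: polyf_sum.
apply: ler_smean => //; [|exact: polyfZ (polyf_sum _ pj)|].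
  by apply: polyfX; apply: polyf_normal_jump; [exact: sum_fe|].
move=> l _; rewrite normal_jump_sum//.
by apply: sqr_sum_active (card_active_face eI) _ => j; exact: normal_jump_inactive.
Qed.

End Family.

Section Splitting.
Variables (v : 'rV[R]_d -> R) (vV : v \in fe_space Th).

Definition local_part j : 'rV[R]_d -> R := interpolate Th (fun x => theta j x * v x).

Lemma local_part_fe j : local_part j \in fe_space Th.
Proof. exact: (cutoff_fe hOmega vV). Qed.

Lemma v_out x : ~ Omega x -> v x = 0.
Proof. by have [_ + _] := (fe_spaceP Th v).1 vV; apply. Qed.

Lemma local_part_local j x : (Omega `\` Om j) x -> local_part j x = 0.
Proof.
move=> [Ox nO]; have [F FF E] := sub_aligned dec j.
apply: (interpolate_local (sub_open (j := j) dec) FF E _ nO) => y ny.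
have [Oy|nOy] := pselect (Omega y); last by rewrite (v_out nOy) mulr0.
by rewrite (theta_support dec) ?mul0r.
Qed.

(** The node values of the functions theta_j v add up to those of v, and
    interpolation is linear and exact on quadratics. *)
Lemma sum_local_part : \sum_j local_part j = v.
Proof.
apply/funext => x; rewrite fct_sumE.
have [[T [TTh Tx]]|h] := pselect (exists T, T \in cells Th /\ geom T x); last first.
  rewrite big1 => [|j _]; last first.
    by apply: interpolate_out => T TTh Tx; apply: h; exists T.
  apply/esym/v_out => Ox; have : closure Omega x by exact: subset_closure.
  by rewrite (cells_cover Th) => -[T /= TTh Tx]; apply: h; exists T.
have fT := cell_full TTh; rewrite -(pieceE vV TTh Tx).
rewrite -(interp_quadratic fT (piece_quadratic vV TTh)).
rewrite (eq_bigr (fun j => interp p T (fun y => theta j y * v y) x)); last first.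
  by move=> j _; exact: interpolateE.
rewrite -interp_sum; congr (_ x); apply: eq_interp_in => // y Ty.
rewrite -mulr_suml (theta_sum dec) ?mul1r ?(pieceE vV TTh Ty)//.
exact: cell_in_closure Ty.
Qed.

Lemma theta01 j x : closure Omega x -> 0 <= theta j x <= 1.
Proof.
move=> Cx; have t0 i : 0 <= theta i x by exact: (theta_ge0 dec).
by rewrite t0 -(theta_sum dec Cx) (bigD1 j)//= lerDl sumr_ge0.
Qed.

Local Notation M1 := (K * delta^-1).
Local Notation M2 := (K * delta ^- 2).

Lemma M1_ge0 : 0 <= M1.
Proof. by rewrite mulr_ge0 ?invr_ge0 ?ltW// (delta_gt0 dec). Qed.

Lemma M2_ge0 : 0 <= M2.
Proof. by rewrite mulr_ge0 ?invr_ge0 ?exprn_ge0 ?ltW// (delta_gt0 dec). Qed.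

Definition split_const : R :=
  (2 * lap_error_const (d' := d') sigma ^+ 2 + 2 * face_error_const (d' := d') sigma * d.+1%:R) *
  local_const (d' := d') B.

Lemma split_const_ge0 : 0 <= split_const.
Proof.
have := @face_error_const_ge0 R d' sigma hsigma; have := @local_const_ge0 R d' B => l0 f0.
by rewrite /split_const; nonneg.
Qed.

(** Here l and j are the Laplacian and jump parts of the splitting, lv and jv
    those of v, e is |v|^2 + |grad v|^2 over the cells and ev its sum over
    the faces. *)
Lemma split_arith (n l lv j jv e ev a b c m dd q : R) :
  0 <= n -> 0 <= b -> 0 <= c -> 0 <= m -> 0 <= dd -> 0 <= lv -> 0 <= e ->
  l <= n * (2 * lv + 2 * a ^+ 2 * (c * m * e)) ->
  j <= 2 * n * (2 * jv + 2 * b * (c * m * ev)) ->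
  ev <= dd * e -> e <= q * (lv + jv) ->
  l + j <= 2 * n * (2 + (2 * a ^+ 2 + 2 * b * dd) * c * m * q) * (lv + jv).
Proof.
move=> n0 b0 c0 m0 d0 lv0 e0 hl hj hev he.
have A1 : 0 <= n * lv by nonneg.
have A2 : 0 <= n * (a ^+ 2 * (c * m * e)) by nonneg.
have A3 : n * (b * (c * m)) * ev <= n * (b * (c * m)) * (dd * e) by apply: ler_wpM2l; nonneg.
have A4 : n * (b * (c * m)) * dd * e <= n * (b * (c * m)) * dd * (q * (lv + jv)).
  by apply: ler_wpM2l; nonneg.
have A5 : n * (a ^+ 2 * (c * m)) * e <= n * (a ^+ 2 * (c * m)) * (q * (lv + jv)).
  by apply: ler_wpM2l; nonneg.
lra.
Qed.

Lemma local_part_energy : \sum_j mesh_norm2 Th (local_part j) <=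
  2 * Nc%:R * (2 + split_const * (M1 ^+ 2 + M2 ^+ 2) *
     ((1 + 4 * B ^+ 2) * energy_const (d' := d') sigma B)) * mesh_norm2 Th v.
Proof.
have M10 := M1_ge0; have M20 := M2_ge0; have uV := local_part_fe.
have uL := local_part_local; set M := _ ^+ 2 + _ ^+ 2.
have M0 : 0 <= M by rewrite addr_ge0 ?sqr_ge0.
pose E := \sum_(T in cells Th) cell_energy v T.
have EE : E = L2_norm2 Th v + H1_norm2 Th v by rewrite /E big_split.
have cE0 T : T \in cells Th -> 0 <= cell_energy v T := @cell_energy_ge0 _ _ _ _ v T.
rewrite /mesh_norm2 big_split /=.
have lc := @local_const_ge0 R d' B.
apply: (@split_arith _ _ _ _ _ E
  (\sum_(e in interior_faces Th) (cell_energy v (cell_minus e) + cell_energy v (cell_plus e)))).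
- exact: ler0n.
- exact: face_error_const_ge0.
- exact: lc.
- exact: M0.
- exact: ler0n.
- exact: lap_energy_ge0.
- exact: sumr_ge0.
- rewrite /lap_energy exchange_big /= /E !mulr_sumr -big_split /= mulr_sumr.
  apply: ler_sum => T TTh; apply: sum_active_le (card_active TTh) _ _ _.
  + by have m0 := meas_ge0 T; have c1 := cE0 _ TTh; nonneg.
  + move=> j _; apply: (cutoff_lap_le hOmega hsigma hB regular bounded vV M10 M20 (theta_smooth dec j)).
    * exact: theta01.
    * exact: (theta_grad dec j).
    * exact: (theta_hess dec j).
    * exact: TTh.
  + by move=> j jT; rewrite (cell_lap_inactive uV uL TTh jT) expr0n mulr0.
- rewrite /jump_energy exchange_big /= !mulr_sumr -big_split /= mulr_sumr.
  apply: ler_sum => e eI; rewrite -[2 * Nc%:R]natrM.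
  have ef := interior_face eI.
  have /adjacentP[mTh _] := cell_minus_adjacent ef.
  have [/adjacentP[pTh _] _] := cell_plus_adjacent eI.
  apply: sum_active_le (card_active_face eI) _ _ _.
  + apply: addr_ge0; first by rewrite mulr_ge0// (face_term_ge0 hd hsigma regular).
    have := @face_error_const_ge0 R d' sigma hsigma => f0.
    apply: mulr_ge0; first exact: mulr_ge0 (ler0n _ 2) f0.
    exact: mulr_ge0 (mulr_ge0 lc M0) (addr_ge0 (cE0 _ mTh) (cE0 _ pTh)).
  + move=> j _; apply: (cutoff_jump_le hOmega hd hsigma hB regular bounded vV M10 M20 (theta_smooth dec j)).
    * exact: theta01.
    * exact: (theta_grad dec j).
    * exact: (theta_hess dec j).
    * exact: eI.
  + by move=> j je; rewrite (face_jump2_inactive uV uL eI je) mulr0.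
- exact: sum_interior_cells.
- rewrite EE; exact: (norms_le hOmega hd hsigma hB regular bounded vV).
Qed.

End Splitting.

(** delta is at most K H, and H is at most K times the diameter of any
    nonempty subdomain. *)
Lemma delta_le_domain : delta <= 2 * B * K ^+ 2.
Proof.
have [[x0 Ox0] _] := hOmega; have : (\bigcup_j Om j) x0 by rewrite -(sub_cover dec).
move=> [j _ Ojx]; have /andP[Hd _] := sub_diam dec j.
have dB : diam (Om j) <= 2 * B.
  apply: ge_sup; first by exists (enorm (x0 - x0)), x0 => //; exists x0.
  move=> _ [x Ox [y Oy <-]]; apply: le_trans (enormD _ _) _; rewrite enormN.
  have -> : 2 * B = B + B by ring.
  by apply: lerD; apply: bounded; apply: subset_closure; [exact: sub_domain Ox | exact: sub_domain Oy].
have HB : H <= K * (2 * B) by rewrite -ler_pdivrMl//; exact: le_trans dB.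
apply: le_trans (delta_le dec) _; apply: le_trans (ler_wpM2l (ltW hK) HB) _.
by rewrite le_eqVlt; apply/orP; left; apply/eqP; ring.
Qed.

Definition stable_const : R :=
  2 * Nc%:R * (2 * (2 * B * K ^+ 2) ^+ 4 + split_const * (K ^+ 2 * ((2 * B * K ^+ 2) ^+ 2 + 1)) *
     ((1 + 4 * B ^+ 2) * energy_const (d' := d') sigma B)).

(** The weaker power delta^-2 of the gradient bound is absorbed by delta^-4,
    because delta is bounded by the diameter of the domain. *)
Lemma stable_decomposition v : v \in fe_space Th ->
  \sum_j mesh_norm2 Th (local_part v j) <= stable_const * delta ^- 4 * mesh_norm2 Th v.
Proof.
move=> vV; apply: le_trans (local_part_energy vV) _.
apply: ler_wpM2r; first exact: (mesh_norm2_ge0 hd hsigma regular).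
have d0 := delta_gt0 dec; have dD := delta_le_domain; set D := 2 * B * _ in dD.
have pw n : delta ^+ n <= D ^+ n.
  by rewrite lerXn2r// nnegrE ltW// (lt_le_trans d0).
set S := split_const; have S0 : 0 <= S := split_const_ge0.
set Q := _ * energy_const _ _.
have Q0 : 0 <= Q.
  apply: mulr_ge0; first by nonneg.
  by rewrite ltW// energy_const_gt0.
have i4 : 0 <= delta ^- 4 by rewrite invr_ge0 exprn_ge0// ltW.
have E1 : 1 <= D ^+ 4 * delta ^- 4 by rewrite ler_pdivlMr ?exprn_gt0// mul1r.
have E2 : delta ^- 2 <= D ^+ 2 * delta ^- 4.
  by rewrite ler_pdivlMr ?exprn_gt0// -[4%N]/(2 + 2)%N exprD mulrA mulVf ?mul1r// expf_neq0// gt_eqF.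
have E3 : (K * delta^-1) ^+ 2 + (K * delta ^- 2) ^+ 2 <= K ^+ 2 * (D ^+ 2 + 1) * delta ^- 4.
  have -> : (K * delta^-1) ^+ 2 + (K * delta ^- 2) ^+ 2 = K ^+ 2 * delta ^- 2 + K ^+ 2 * delta ^- 4.
    by field; rewrite gt_eqF.
  by have := ler_wpM2l (sqr_ge0 K) E2; lra.
have F := ler_wpM2r Q0 (ler_wpM2l S0 E3).
rewrite /stable_const -/D -/S -/Q -[leRHS]mulrA; apply: ler_wpM2l; first by rewrite mulr_ge0.
by rewrite mulrDl; apply: lerD; [move: E1; lra | move: F; lra].
Qed.

End Decomposition.

(** * Symmetric forms on a finite dimensional space *)

Lemma scalar_eq (R : realType) (V : lmodType R) (f g : {scalar V}) : f =1 g -> f = g.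
Proof.
case: f g => [f [cf1 cf2]] [g [cg1 cg2]] /= /funext E; subst g.
by case: cf1 cg1 cf2 cg2 => [a] [b] [c] [e]; congr (GRing.Linear.Pack (GRing.Linear.Class _ _));
  congr (_ _); exact: Prop_irrelevance.
Qed.

Section Coordinates.
Context {R : realType} {V : lmodType R} {n : nat}.
Variables (phi : {linear V -> 'rV[R]_n}) (phi_inj : injective phi).

(** The image of phi is the row space of a matrix of maximal rank among those
    whose row space it contains. *)
Lemma image_row_space : exists M : 'M[R]_n, forall x, (x <= M)%MS <-> exists v, phi v = x.
Proof.
pose P (M : 'M[R]_n) := forall x : 'rV[R]_n, (x <= M)%MS -> exists v, phi v = x.
pose Q k := `[< exists2 M, P M & \rank M = k >].
have Q0 : exists k, Q k.
  exists 0%N; apply/asboolP; exists 0; last exact: mxrank0.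
  by move=> x; rewrite submx0 => /eqP ->; exists 0; rewrite linear0.
have Qn k : Q k -> (k <= n)%N by move=> /asboolP[M _ <-]; exact: rank_leq_col.
case: (ex_maxnP Q0 Qn) => k /asboolP[M PM rM] kmax; exists M => x; split; first exact: PM.
move=> [v <-]; apply: contraT => nv.
have PA : P (M + <<phi v>>)%MS.
  move=> y /sub_addsmxP[[a b] /= ->]; have [w1 E1] := PM (a *m M) (submxMl _ _).
  have : (b *m <<phi v>>%MS <= phi v)%MS by rewrite -(genmxE (phi v)) submxMl.
  move=> /sub_rVP[s E2].
  by exists (w1 + s *: v); rewrite linearD linearZ E1 E2.
have /kmax : Q (\rank (M + <<phi v>>)%MS) by apply/asboolP; exists (M + <<phi v>>)%MS.
rewrite -rM; have [le] := mxrank_leqif_sup (addsmxSl M <<phi v>>%MS).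
move=> E ge; have : \rank M == \rank (M + <<phi v>>)%MS by rewrite eqn_leq le ge.
by rewrite E addsmx_sub genmxE (negbTE nv) andbF.
Qed.

(** The rows of a basis of the image of phi are lifted to V. *)
Lemma linear_coordinates : exists k (psi : {linear 'rV[R]_k -> V}), bijective psi.
Proof.
have [M Mphi] := image_row_space; set W := row_base M.
have ex (x : 'rV[R]_(\rank M)) : exists v, phi v = x *m W.
  by apply/Mphi; rewrite -(eq_row_base M) submxMl.
pose psi x := xget 0 [set v | phi v = x *m W].
have psiE x : phi (psi x) = x *m W := @xgetPex _ 0 [set v | phi v = x *m W] (ex x).
have lpsi : linear psi.
  by move=> a x y; apply: phi_inj; rewrite linearP !psiE mulmxDl scalemxAl.
pose L := GRing.isLinear.Build _ _ _ _ psi lpsi.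
pose psiL : {linear 'rV[R]_(\rank M) -> V} := HB.pack psi L.
exists (\rank M), psiL; exists (fun v => phi v *m pinvmx W).
  by move=> x; rewrite /= psiE mulmxKp// row_base_free.
move=> v; apply: phi_inj; rewrite /= psiE mulmxKpV//.
by rewrite eq_row_base; apply/Mphi; exists v.
Qed.

End Coordinates.

Section Forms.
Context {R : realType} {V : lmodType R} {k : nat}.
Variables (psi : {linear 'rV[R]_k -> V}) (psi_bij : bijective psi).

Definition bilinear_symmetric (a : V -> V -> R) : Prop :=
  (forall u, scalar (a u)) /\ (forall u w, a u w = a w u).

Definition positive_definite (a : V -> V -> R) : Prop :=
  (forall u, 0 <= a u u) /\ forall u, a u u = 0 -> u = 0.

Section Gram.
Variables (a : V -> V -> R) (ha : bilinear_symmetric a).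

Lemma bformDr u w w' : a u (w + w') = a u w + a u w'.
Proof. by have := ha.1 u 1 w w'; rewrite scale1r mul1r. Qed.

Lemma bform0r u : a u 0 = 0.
Proof. by have := bformDr u 0 0; rewrite addr0 => /eqP; rewrite -subr_eq0 opprD addrA subrr sub0r oppr_eq0 => /eqP. Qed.

Lemma bformZr s u w : a u (s *: w) = s * a u w.
Proof. by have := ha.1 u s w 0; rewrite addr0 bform0r addr0. Qed.

Lemma bform_sumr (I : Type) (r : seq I) u (F : I -> V) :
  a u (\sum_(i <- r) F i) = \sum_(i <- r) a u (F i).
Proof. by elim/big_rec2: _ => [|i x y _ <-]; [exact: bform0r | exact: bformDr]. Qed.

Lemma bformDl u u' w : a (u + u') w = a u w + a u' w.
Proof. by rewrite !(ha.2 _ w) bformDr. Qed.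

Lemma bformZl s u w : a (s *: u) w = s * a u w.
Proof. by rewrite !(ha.2 _ w) bformZr. Qed.

Definition gram : 'M[R]_k := \matrix_(i, j) a (psi (delta_mx 0 i)) (psi (delta_mx 0 j)).

Lemma gramE x y : a (psi x) (psi y) = dot (x *m gram) y.
Proof.
rewrite {1}(row_sum_delta x) {1}(row_sum_delta y) !linear_sum /= bform_sumr.
rewrite /dot; apply: eq_bigr => j _; rewrite linearZ bformZr mulrC; congr (_ * _).
rewrite ha.2 bform_sumr mxE; apply: eq_bigr => i _.
by rewrite linearZ bformZr ha.2 mxE.
Qed.

Lemma gram_quadratic : quadratic (fun x => a (psi x) (psi x)).
Proof. by exists gram, 0, 0 => x; rewrite gramE dot0l !addr0. Qed.

(** In coordinates the representing vector solves a linear system whose matrix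
    is the invertible Gram matrix. *)
Lemma riesz (l : {scalar V}) : positive_definite a -> exists u, forall w, a u w = l w.
Proof.
move=> [_ a0]; have [phi psiK phiK] := psi_bij.
have fG : gram \in unitmx.
  rewrite -row_free_unit; apply: inj_row_free => x xG.
  have /a0 : a (psi x) (psi x) = 0 by rewrite gramE xG dot0l.
  by move=> /(congr1 phi); rewrite psiK -(linear0 psi) psiK.
pose y : 'rV[R]_k := \row_j l (psi (delta_mx 0 j)).
exists (psi (y *m invmx gram)) => w; rewrite -(phiK w) gramE mulmxKV//.
rewrite {2}(row_sum_delta (phi w)) !linear_sum /=; apply: eq_bigr => j _.
by rewrite mxE !linearZ mulrC.
Qed.

End Gram.

Lemma bilinear_symmetricN (b : V -> V -> R) : bilinear_symmetric b ->
  bilinear_symmetric (fun u w => - b u w).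
Proof.
move=> hb; split=> [u s y z|u w]; last by rewrite (hb.2 u).
by rewrite (bformDr hb) (bformZr hb) opprD -mulrN.
Qed.

Lemma form_young (a : V -> V -> R) w z (c : R) : bilinear_symmetric a ->
  (forall y, 0 <= a y y) -> 0 < c -> a w z <= c / 2 * a w w + (2 * c)^-1 * a z z.
Proof.
move=> ha a0 c0; have := a0 (c *: w + (-1) *: z).
rewrite (bformDl ha) !(bformDr ha) !(bformZl ha) !(bformZr ha) (ha.2 z w) => Q.
have -> : c / 2 * a w w + (2 * c)^-1 * a z z = (2 * c)^-1 * (c * (c * a w w) + a z z).
  by field; rewrite gt_eqF.
rewrite ler_pdivlMl ?mulr_gt0//; move: Q; lra.
Qed.

Lemma absorb_half (c x y s : R) : 0 < c -> x <= c / 2 * y + (2 * c)^-1 * s -> s <= c * x ->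
  x <= c * y.
Proof.
move=> c0 xy sx; have c2 : 0 <= (2 * c)^-1 by rewrite invr_ge0 mulr_ge0// ltW.
have := le_trans xy (lerD (lexx _) (ler_wpM2l c2 sx)).
have -> : (2 * c)^-1 * (c * x) = x / 2 by field; rewrite gt_eqF.
lra.
Qed.

(** If q(u, w) did not vanish, q would be negative at t u + w for a suitable
    t. *)
Lemma psd_null (q : V -> V -> R) u w : bilinear_symmetric q -> (forall v, 0 <= q v v) ->
  q u u = 0 -> q u w = 0.
Proof.
move=> hq q0 uu; apply/eqP; apply: contraT => uw.
(* With this t the value q(t u + w, t u + w) = 2 t q(u, w) + q(w, w) is -1. *)
pose t : R := - (q w w + 1) / (2 * q u w).
have := q0 (t *: u + w).
rewrite (bformDl hq) !(bformDr hq) !(bformZl hq) !(bformZr hq) uu (hq.2 w u).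
have -> : t * (t * 0) + t * q u w + (t * q u w + q w w) = -1.
  by rewrite /t; field.
by rewrite oppr_ge0 ler10.
Qed.

(** A maximizer of the Rayleigh quotient b(x, x) / a(x, x) on the unit sphere
    is a null vector of the semidefinite form lam a - b. *)
Lemma rayleigh a b : bilinear_symmetric a -> positive_definite a -> bilinear_symmetric b ->
  (exists v : V, v != 0) ->
  exists lam u, [/\ u != 0, forall w, b u w = lam * a u w & forall v, b v v <= lam * a v v].
Proof.
move=> ha [a_ge0 a0] hb [v0 v0N]; have [phi psiK phiK] := psi_bij.
have apos x : x != 0 -> 0 < a (psi x) (psi x).
  move=> x0; rewrite lt_def a_ge0 andbT; apply: contra x0 => /eqP/a0.
  by move=> /(congr1 phi); rewrite psiK -(linear0 psi) psiK => ->.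
pose S : set 'rV[R]_k := [set x | dot x x = 1].
have Sn0 x : S x -> x != 0 by move=> Sx; apply/eqP => x0; move: Sx; rewrite /S /= x0 dot0l => /eqP; rewrite eq_sym oner_eq0.
have qdot : quadratic (fun x : 'rV[R]_k => dot x x).
  by exists 1%:M, 0, 0 => x; rewrite mulmx1 dot0l !addr0.
have normS x : x != 0 -> S ((enorm x)^-1 *: x).
  move=> x0; have e0 : enorm x != 0 by rewrite enorm_eq0.
  by rewrite /S /= dotZl dotZr -enorm_sqr; field.
have cS : compact S.
  apply: bounded_closed_compact.
    exists 1; split; first exact: num_real.
    move=> M M1 x Sx; apply: le_trans (ltW M1).
    rewrite [leLHS]/Num.Def.normr /= mx_normrE; apply: bigmax_le => // -[i j] _ /=.
    by rewrite ord1; apply: le_trans (enorm_entry _ _) _; rewrite /enorm Sx sqrtr1.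
  have -> : S = (fun x => dot x x) @^-1` [set 1] by [].
  apply: preimage_closed; first by move=> x _; exact: quadratic_continuous.
  exact: closed_eq.
pose f x := b (psi x) (psi x) / a (psi x) (psi x).
have x0N : phi v0 != 0 by apply: contra v0N => /eqP E; rewrite -(phiK v0) E linear0.
have [] := @EVT_max_rV R k f S.
- by exists ((enorm (phi v0))^-1 *: phi v0); exact: normS.
- exact: cS.
- apply: continuous_in_subspaceT => x /set_mem Sx.
  rewrite /f; apply: (@continuousM _ _ (fun x => b (psi x) (psi x)) (fun x => (a (psi x) (psi x))^-1)); first exact: quadratic_continuous (gram_quadratic hb) x.
  apply: continuousV; last exact: quadratic_continuous (gram_quadratic ha) x.
  by rewrite gt_eqF// apos// Sn0.
move=> x /set_mem Sx xmax; pose lam := f x.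
have bx : b (psi x) (psi x) = lam * a (psi x) (psi x).
  by rewrite /lam /f mulfVK// gt_eqF// apos// Sn0.
have bv v : b v v <= lam * a v v.
  have [->|vN] := eqVneq v 0; first by rewrite (bform0r ha) (bform0r hb) mulr0.
  have yN : phi v != 0 by apply: contra vN => /eqP E; rewrite -(phiK v) E linear0.
  have := xmax _ (mem_set (normS _ yN)); rewrite -/lam /f !linearZ.
  rewrite !(bformZl ha) !(bformZl hb) !(bformZr ha) !(bformZr hb) phiK.
  have e0 : enorm (phi v) != 0 by rewrite enorm_eq0.
  have av : 0 < a v v by have := apos _ yN; rewrite phiK.
  have -> : (enorm (phi v))^-1 * ((enorm (phi v))^-1 * b v v) /
    ((enorm (phi v))^-1 * ((enorm (phi v))^-1 * a v v)) = b v v / a v v.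
    by field; rewrite e0 gt_eqF.
  by rewrite ler_pdivrMr.
pose q u w := lam * a u w - b u w.
have hq : bilinear_symmetric q.
  split=> [u s y z|u w]; last by rewrite /q ha.2 hb.2.
  by rewrite /q (bformDr ha) (bformDr hb) (bformZr ha) (bformZr hb) /=; ring.
exists lam, (psi x); split=> //.
  by apply: contra (Sn0 _ Sx) => /eqP E; rewrite -(psiK x) E -(linear0 psi) psiK.
move=> w; have : q (psi x) w = 0.
  by apply: psd_null => //; [move=> v; rewrite subr_ge0 | rewrite /q bx subrr].
by move=> /eqP; rewrite subr_eq0 => /eqP ->.
Qed.

End Forms.

(** * The additive Schwarz operator *)

Lemma broken_form_sym (R : realType) d (Omega : set 'rV[R]_d) (Th : triangulation Omega)
    (S F : {set {set 'I_(nvert Th)}}) v w : broken_form S F v w = broken_form S F w v.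
Proof.
rewrite /broken_form; apply: (congr2 (fun x y => x + 4^-1 * y)); apply: eq_bigr => A _.
  by rewrite [weak_laplacian v A * _]mulrC.
apply: (congr1 (fun f => (face_diam A)^-1 * integral_on A f)).
by apply/funext => x; rewrite mulrC.
Qed.

Section Nodes.
Context {R : realType} {d' : nat} {Omega : set 'rV[R]_d'.+1}.
Variable Th : triangulation Omega.
Local Notation p := (vertex (t := Th)).

Definition node_values (v : Vh Th) : 'rV[R]_(nvert Th * nvert Th) :=
  mxvec (\matrix_(i, j) val v (node p i j)).

Lemma node_values_linear : linear node_values.
Proof.
move=> a v w; rewrite /node_values -linearP; congr mxvec.
by apply/matrixP => i j; rewrite !mxE linearP.
Qed.

HB.instance Definition _ := GRing.isLinear.Build R (Vh Th) _ _ node_values node_values_linear.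

(** On every cell a quadratic is its own interpolant at the vertices and edge
    midpoints. *)
Lemma node_values_inj : injective node_values.
Proof.
apply: raddf_inj => v /eqP; rewrite /node_values mxvec_eq0 => /eqP v0.
have vV : val v \in fe_space Th by exact: valP.
apply: val_inj; rewrite raddf0; apply/funext => x.
have [Ox|nO] := pselect (Omega x); last by have [_ + _] := (fe_spaceP Th _).1 vV; apply.
have : closure Omega x by exact: subset_closure.
rewrite (cells_cover Th) => -[T /= TTh Tx]; have fT := cell_full TTh.
rewrite -(pieceE vV TTh Tx) -(interp_quadratic fT (piece_quadratic vV TTh)).
rewrite (@eq_interp_in _ _ _ p T _ (val v)) => [|//|y Ty]; last exact: pieceE.
by apply: interp0 => i j _ _; have /matrixP/(_ i j) := v0; rewrite !mxE.
Qed.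

End Nodes.

Section Schwarz.
Context {R : realType} {d' : nat} {Omega : set 'rV[R]_d'.+1}.
Local Notation d := d'.+1.
Variables (hOmega : convex_polytope_domain Omega) (Th : triangulation Omega).
Variables (sigma B K : R) (hd : (0 < d')%N) (hsigma : 0 < sigma) (hB : 0 < B) (hK : 0 < K).
Hypothesis regular : shape_regular Th sigma.
Hypothesis bounded : forall x, closure Omega x -> enorm x <= B.
Local Notation simplex := {set 'I_(nvert Th)}.
Local Notation p := (vertex (t := Th)).
Variables (Nc : nat) (H delta : R) (J : nat).
Variables (Om : 'I_J -> set 'rV[R]_d) (theta : 'I_J -> 'rV[R]_d -> R).
Hypothesis dec : overlapping_decomposition Th K Nc H delta Om theta.

Local Notation upper := (3 + 4 * lap_const (d' := d') sigma).
Local Notation lower := (6 + 16 * lap_const (d' := d') sigma).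

Lemma upper_gt0 : 0 < upper.
Proof. by have := @lap_const_ge0 R d' sigma hsigma; lra. Qed.

Lemma lower_gt0 : 0 < lower.
Proof. by have := @lap_const_ge0 R d' sigma hsigma; lra. Qed.

Lemma a_w_symmetric : bilinear_symmetric (@a_w _ _ _ Th).
Proof. by split=> [u|u w]; [exact: a_w_linear | exact: broken_form_sym]. Qed.

Lemma a_w_loc_symmetric G : bilinear_symmetric (@a_w_loc _ _ _ Th G).
Proof. by split=> [u|u w]; [exact: a_w_loc_linear | exact: broken_form_sym]. Qed.

Lemma a_w_le (u : Vh Th) : a_w u u <= upper * mesh_norm2 Th (val u).
Proof. exact: (broken_form_le hd hsigma regular (valP u)). Qed.

Lemma a_w_loc_le G (u : Vloc Th G) : a_w_loc u u <= upper * mesh_norm2 Th (val (val u)).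
Proof.
apply: (broken_form_le hd hsigma regular (valP (val u))).
  by apply/fintype.subsetP => T; rewrite inE => /andP[].
by apply/fintype.subsetP => e; rewrite inE => /andP[].
Qed.

Lemma a_w_ge (u : Vh Th) : mesh_norm2 Th (val u) <= lower * a_w u u.
Proof.
apply: (mesh_norm2_le hd hsigma regular (valP u)) => // T TTh.
by rewrite TTh.
Qed.

Lemma Vloc_local G (u : Vloc Th G) x : (Omega `\` G) x -> val (val u) x = 0.
Proof. by have /set_mem := valP u; exact. Qed.

(** A function of the local space vanishes on the cells outside the
    subdomain, so that the local form controls its whole mesh norm. *)
Lemma a_w_loc_ge j (u : Vloc Th (Om j)) : mesh_norm2 Th (val (val u)) <= lower * a_w_loc u u.
Proof.
have [F FF E] := sub_aligned dec j; have oj := sub_open (j := j) dec.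
apply: (mesh_norm2_le hd hsigma regular (valP (val u))).
- by apply/fintype.subsetP => T; rewrite inE => /andP[].
- by apply/fintype.subsetP => e; rewrite inE => /andP[].
- move=> T e; rewrite inE => /andP[TTh /asboolP TO] eI eT; rewrite inE eI /=.
  by apply/asboolP => x ex; apply: TO; exact: hullS ex.
- move=> T TTh; rewrite inE TTh /= => /asboolPn nT.
  apply: (piece_local_eq0 oj FF E (valP (val u)) (@Vloc_local (Om j) u) TTh) => Oc.
  by apply: nT; exact: (cell_inside oj FF E TTh Oc).
Qed.

Lemma norm_eq0 (u : Vh Th) : mesh_norm2 Th (val u) = 0 -> u = 0.
Proof.
move=> u0; apply: val_inj; rewrite raddf0.
exact: (mesh_norm2_eq0 hOmega hd hsigma hB regular bounded (valP u) u0).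
Qed.

Lemma norm_ge0 v : 0 <= mesh_norm2 Th v.
Proof. exact: (mesh_norm2_ge0 hd hsigma regular). Qed.

Lemma a_w_definite : positive_definite (@a_w _ _ _ Th).
Proof.
split=> u; first by have := le_trans (norm_ge0 _) (a_w_ge u); rewrite pmulr_rge0// lower_gt0.
move=> u0; apply: norm_eq0; apply/eqP; rewrite eq_le norm_ge0 andbT.
by have := a_w_ge u; rewrite u0 mulr0.
Qed.

Lemma a_w_loc_definite j : positive_definite (@a_w_loc _ _ _ Th (Om j)).
Proof.
split=> u; first by have := le_trans (norm_ge0 _) (a_w_loc_ge u); rewrite pmulr_rge0// lower_gt0.
move=> u0; apply: val_inj; rewrite raddf0; apply: norm_eq0; apply/eqP.
by rewrite eq_le norm_ge0 andbT; have := a_w_loc_ge u; rewrite u0 mulr0.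
Qed.

Lemma A_loc_surjective j (l : {scalar Vloc Th (Om j)}) : exists u, A_loc u = l.
Proof.
pose phi := node_values (Th := Th) \o injection Th (Om j).
have iphi : injective phi by apply: inj_comp; [exact: node_values_inj | exact: val_inj].
have [k [psi bij]] := linear_coordinates iphi.
have [u uE] := riesz bij (a_w_loc_symmetric (Om j)) l (a_w_loc_definite j).
by exists u; apply: scalar_eq.
Qed.

Lemma A_loc_invK j (l : {scalar Vloc Th (Om j)}) : A_loc (A_loc_inv l) = l.
Proof. exact: (@xgetPex _ 0 [set u | A_loc u = l] (A_loc_surjective l)). Qed.

Lemma A_loc_bijective j : bijective (A_loc (Th := Th) (G := Om j)).
Proof.
have hs := a_w_loc_symmetric (Om j); have [_ a0] := a_w_loc_definite j.
exists (@A_loc_inv _ _ _ Th (Om j)); last exact: A_loc_invK.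
move=> u; apply/eqP; rewrite -subr_eq0; apply/eqP; apply: a0.
set w := A_loc_inv _; have : A_loc w = A_loc u by exact: A_loc_invK.
move=> /(congr1 (fun f : {scalar _} => f (w - u))) E.
rewrite (bformDl hs) -scaleN1r (bformZl hs) scaleN1r -[a_w_loc w _]/(A_loc w _) E.
by rewrite mulN1r subrr.
Qed.

Definition local_solution (u : Vh Th) j : Vloc Th (Om j) :=
  A_loc_inv (injection_tr (Om j) (A_h u)).

Lemma local_solutionE u j z : a_w_loc (local_solution u j) z = a_w u (injection Th (Om j) z).
Proof.
have /(congr1 (fun f : {scalar _} => f z)) := A_loc_invK (injection_tr (Om j) (A_h u)).
exact.
Qed.

Local Notation schwarz := (fun u : Vh Th => B_h Om (A_h u)).

Lemma a_w_schwarz u w :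
  a_w u (schwarz w) = \sum_j a_w_loc (local_solution u j) (local_solution w j).
Proof.
rewrite /B_h (bform_sumr a_w_symmetric); apply: eq_bigr => j _.
by rewrite local_solutionE.
Qed.

Definition max_const : R := upper * (2 * Nc)%:R * lower.

Lemma max_const_ge0 : 0 <= max_const.
Proof. exact: mulr_ge0 (mulr_ge0 (ltW upper_gt0) (ler0n _ _)) (ltW lower_gt0). Qed.

(** The local solutions w_j satisfy sum of a_j(w_j, w_j) = a(u, Bu). *)
Lemma schwarz_le u : a_w (schwarz u) (schwarz u) <= max_const * a_w u (schwarz u).
Proof.
apply: le_trans (a_w_le _) _; rewrite -!mulrA ler_wpM2l ?(ltW upper_gt0)//.
have E : val (schwarz u) = \sum_j val (val (local_solution u j)) by rewrite raddf_sum.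
rewrite E; apply: le_trans (mesh_norm2_sum_le hOmega hd hsigma regular dec _ _) _.
- by move=> j; exact: valP.
- by move=> j x; exact: Vloc_local.
rewrite ler_wpM2l// a_w_schwarz mulr_sumr; apply: ler_sum => j _; exact: a_w_loc_ge.
Qed.

Definition min_const : R := upper * (stable_const (d' := d') sigma B K Nc + 1) * lower.

Lemma stable_const_ge0 : 0 <= stable_const (d' := d') sigma B K Nc.
Proof.
have S0 := @split_const_ge0 R d' sigma B hsigma.
have E0 : 0 <= (1 + 4 * B ^+ 2) * energy_const (d' := d') sigma B.
  by apply: mulr_ge0; [nonneg | rewrite ltW// energy_const_gt0].
rewrite /stable_const; apply: mulr_ge0; first by rewrite mulr_ge0.
have D0 : 0 <= 2 * B * K ^+ 2 by nonneg.
have D4 := exprn_ge0 4 D0; have D2 := exprn_ge0 2 D0; have K2 := sqr_ge0 K.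
apply: addr_ge0; first by apply: mulr_ge0.
apply: mulr_ge0 E0; apply: mulr_ge0 S0 _; apply: mulr_ge0 K2 _.
exact: addr_ge0 D2 ler01.
Qed.

Lemma min_const_gt0 : 0 < min_const.
Proof.
have S0 := stable_const_ge0; have U0 := upper_gt0; have L0 := lower_gt0.
by rewrite /min_const !mulr_gt0// ltr_wpDl.
Qed.

Definition local_component (u : Vh Th) j : Vloc Th (Om j) :=
  Sub (Sub (local_part Th theta (val u) j) (local_part_fe hOmega theta (valP u) j) : Vh Th)
    (mem_set (local_part_local dec (valP u) (j := j))).

Lemma sum_local_component u : \sum_j injection Th (Om j) (local_component u j) = u.
Proof.
apply: val_inj; rewrite raddf_sum -[RHS](sum_local_part dec (valP u)).
by apply: eq_bigr => j _.
Qed.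

(** Testing the stable splitting u = sum of u_j against u gives a(u, u) as the
    sum of the a_j(w_j, u_j), where w_j are the local solutions. *)
Lemma schwarz_ge u : a_w u u <= min_const * delta ^- 4 * a_w u (schwarz u).
Proof.
have d0 := delta_gt0 dec; set c := min_const * delta ^- 4.
have i4 : 0 < delta ^- 4 by rewrite invr_gt0 exprn_gt0.
have c0 : 0 < c := mulr_gt0 min_const_gt0 i4.
have SD : \sum_j a_w_loc (local_component u j) (local_component u j) <= c * a_w u u.
  apply: (@le_trans _ _ (upper * \sum_j mesh_norm2 Th (local_part Th theta (val u) j))).
    by rewrite mulr_sumr; apply: ler_sum => j _; exact: a_w_loc_le.
  have := stable_decomposition hOmega hd hsigma hB hK regular bounded dec (valP u).
  have := stable_const_ge0; set s := stable_const _ _ _ _ => S0 S1.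
  have S2 : s * delta ^- 4 * mesh_norm2 Th (val u) <=
      (s + 1) * delta ^- 4 * (lower * a_w u u).
    apply: ler_pM (mulr_ge0 S0 (ltW i4)) (norm_ge0 _) _ (a_w_ge u).
    by rewrite (ler_wpM2r (ltW i4))// lerDl.
  apply: le_trans (ler_wpM2l (ltW upper_gt0) (le_trans S1 S2)) _.
  have reorder (U t L i x : R) : U * (t * i * (L * x)) = U * t * L * i * x by ring.
  by rewrite reorder.
have E : a_w u u = \sum_j a_w_loc (local_solution u j) (local_component u j).
  rewrite -[X in a_w u X](sum_local_component u) (bform_sumr a_w_symmetric).
  by apply: eq_bigr => j _; rewrite local_solutionE.
have Y : a_w u u <= c / 2 * a_w u (schwarz u) + (2 * c)^-1 *
    \sum_j a_w_loc (local_component u j) (local_component u j).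
  rewrite a_w_schwarz [X in X <= _]E !mulr_sumr -big_split /=; apply: ler_sum => j _.
  exact: (form_young _ _ (a_w_loc_symmetric (Om j)) (a_w_loc_definite j).1 c0).
exact: absorb_half c0 Y SD.
Qed.

Definition energy_schwarz (u w : Vh Th) : R := a_w (schwarz u) w.

(** This symmetric expression makes the operator self-adjoint for a_w. *)
Lemma energy_schwarzE u w :
  energy_schwarz u w = \sum_j a_w_loc (local_solution u j) (local_solution w j).
Proof.
rewrite /energy_schwarz (a_w_symmetric.2) a_w_schwarz; apply: eq_bigr => j _.
exact: (a_w_loc_symmetric _).2.
Qed.

Lemma energy_schwarz_symmetric : bilinear_symmetric energy_schwarz.
Proof.
split=> [u|u w]; first exact: a_w_linear.
by rewrite !energy_schwarzE; apply: eq_bigr => j _; exact: (a_w_loc_symmetric _).2.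
Qed.

Lemma eigenvalue_bounds lam : is_eigenvalue schwarz lam ->
  (min_const * delta ^- 4)^-1 <= lam <= max_const.
Proof.
move=> [u u0 E]; have hs := a_w_symmetric; have [a_ge0 a_def] := a_w_definite.
have au : 0 < a_w u u.
  by rewrite lt_def a_ge0 andbT; apply: contra u0 => /eqP/a_def ->.
have c0 : 0 < min_const * delta ^- 4.
  by rewrite mulr_gt0 ?min_const_gt0// invr_gt0 exprn_gt0// (delta_gt0 dec).
have lo := schwarz_ge u; have up := schwarz_le u.
rewrite E (bformZr hs) in lo; rewrite E (bformZl hs) (bformZr hs) in up.
have l1 : (min_const * delta ^- 4)^-1 <= lam.
  rewrite -[leLHS]mulr1 ler_pdivrMl// -(ler_pM2r au) mul1r; apply: le_trans lo _.
  by rewrite mulrA.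
rewrite l1; have l0 : 0 < lam by apply: lt_le_trans l1; rewrite invr_gt0.
by rewrite -(ler_pM2r (mulr_gt0 l0 au)).
Qed.

(** The largest and the smallest values of the Rayleigh quotient of
    energy_schwarz with respect to a_w are attained, and they are
    eigenvalues. *)
Lemma extreme_eigenvalues : (exists v : Vh Th, v != 0) ->
  exists lmax lmin, max_eigenvalue schwarz lmax /\ min_eigenvalue schwarz lmin.
Proof.
move=> V0; have [k [psi bij]] := linear_coordinates (@node_values_inj _ _ _ Th).
have ha := a_w_symmetric; have pa := a_w_definite; have [pa1 pa2] := pa; have hb := energy_schwarz_symmetric.
have eig lam u : (forall w, energy_schwarz u w = lam * a_w u w) -> schwarz u = lam *: u.
  move=> h; apply/eqP; rewrite -subr_eq0; apply/eqP; apply: pa2.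
  set z := _ - _; rewrite {1}/z (bformDl ha) -scaleN1r (bformZl ha) (bformZl ha).
  by rewrite -[a_w _ z]/(energy_schwarz u z) h mulN1r subrr.
have ray m u : schwarz u = m *: u -> energy_schwarz u u = m * a_w u u.
  by move=> E; rewrite /energy_schwarz E (bformZl ha).
have apos (u : Vh Th) : u != 0 -> 0 < a_w u u.
  by move=> u0; rewrite lt_def pa1 andbT; apply: contra u0 => /eqP/pa2 ->.
have [l1 [u1 [u10 e1 m1]]] := rayleigh bij ha pa hb V0.
pose c (u w : Vh Th) := - energy_schwarz u w.
have hc : bilinear_symmetric c := bilinear_symmetricN hb.
have [l2 [u2 [u20 e2 m2]]] := rayleigh bij ha pa hc V0.
exists l1, (- l2); split; split.
- by exists u1; [exact: u10 | exact: eig e1].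
- by move=> m [u u0 E]; rewrite -(ler_pM2r (apos _ u0)) -(ray _ _ E).
- exists u2; [exact: u20 | apply: eig => w; by rewrite mulNr -e2 opprK].
- move=> m [u u0 E]; rewrite -(ler_pM2r (apos _ u0)) -(ray _ _ E) mulNr lerNl.
  exact: m2.
Qed.

End Schwarz.

Theorem theorem5p2 (R : realType) (d : nat) (hd : d = 2%N \/ d = 3%N)
    (Omega : set 'rV[R]_d) (hOmega : convex_polytope_domain Omega)
    (sigma K : R) (hsigma : 0 < sigma) (hK : 0 < K) (Nc : nat) :
  exists2 C : R, 0 < C &
    forall (Th : triangulation Omega) (H delta : R) (J : nat)
      (Om : 'I_J -> set 'rV[R]_d) (theta : 'I_J -> 'rV[R]_d -> R),
    shape_regular Th sigma ->
    overlapping_decomposition Th K Nc H delta Om theta ->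
    (forall j, bijective (A_loc (Th := Th) (G := Om j))) /\
    ((exists v : Vh Th, v != 0) ->
     exists lmax lmin : R,
       [/\ max_eigenvalue (fun u : Vh Th => B_h Om (A_h u)) lmax,
           min_eigenvalue (fun u : Vh Th => B_h Om (A_h u)) lmin,
           0 < lmin
         & lmax / lmin <= C * delta ^- 4]).
Proof.
have [d' dE hd'] : exists2 d', d = d'.+1 & (0 < d')%N.
  by case: hd => ->; [exists 1%N | exists 2%N].
subst d; clear hd; have [B hB bounded] := domain_bounded hOmega.
pose c1 := max_const (d' := d') sigma Nc; pose c2 := min_const (d' := d') sigma B K Nc.
have c10 : 0 <= c1 by exact: max_const_ge0.
have c20 : 0 < c2 by exact: min_const_gt0.
exists (c1 * c2 + 1) => [|Th H delta J Om theta regular dec].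
  by rewrite ltr_wpDl// mulr_ge0// ltW.
split=> [j|V0]; first exact: (A_loc_bijective hOmega hd' hsigma hB regular bounded dec).
have [lmax [lmin [hmax hmin]]] :=
  extreme_eigenvalues hOmega hd' hsigma hB regular bounded dec V0.
have bounds := eigenvalue_bounds hOmega hd' hsigma hB hK regular bounded dec.
have i4 : 0 < delta ^- 4 by rewrite invr_gt0 exprn_gt0// (delta_gt0 dec).
have /andP[_ up] := bounds _ hmax.1; have /andP[lo _] := bounds _ hmin.1.
have m0 : 0 < lmin by apply: lt_le_trans lo; rewrite invr_gt0 mulr_gt0.
exists lmax, lmin; split=> //; rewrite ler_pdivrMr//.
apply: le_trans up _; rewrite -/c1; have c0 : 0 < c2 * delta ^- 4 := mulr_gt0 c20 i4.
have l1 : 1 <= c2 * delta ^- 4 * lmin by move: lo; rewrite -[leLHS]mulr1 ler_pdivrMl.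
apply: (@le_trans _ _ (c1 * (c2 * delta ^- 4 * lmin))); first by rewrite ler_peMr.
by rewrite !mulrDl mul1r !mulrA lerDl mulr_ge0// ltW.
Qed.
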